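(* $$\mathscr S_{\mathscr R}(\mathscr Q)=\mathscr S_*(\mathscr Q).$$
   Context: $\mathbb Q$ denotes the quaternions, identified with $\mathbb R^4$, and $\Im\mathbb Q\cong\mathbb R^3$ the imaginary quaternions; $\langle q,h\rangle=\Re(\overline qh)$ is the Euclidean inner product and $|q|^2=\langle q,q\rangle$. The quaternion Heisenberg group is $\mathscr Q=\{(x,t):x\in\mathbb Q,\ t\in\Im\mathbb Q\}$ with product $(x,t)(x',t')=(x+x',\,t+t'-2\Im(\overline{x'}x))$ and Haar measure the Lebesgue measure $dx\,dt$. $\mathscr S(\mathscr Q)$ is the Schwartz space on $\mathbb R^4\times\mathbb R^3$. Fourier transform: for $0\ne a\in\Im\mathbb Q$ put $\tilde a=a/|a|$; right multiplication $q\mapsto q\tilde a$ is a complex structure on $\mathbb Q$, making $\mathbb Q\cong\mathbb C^2$. $\mathscr H_a$ is the Fock space of functions $F$ on $\mathbb Q$, holomorphic for this complex structure, with $\|F\|^2=\int_{\mathbb Q}|F(q)|^2e^{-2|a||q|^2}dq<\infty$. The unitary representation $\pi_a$ of $\mathscr Q$ on $\mathscr H_a$ is $$\pi_a(x,t)F(q)=F(q+x)\,e^{i\langle a,t\rangle-|a|(|x|^2+2\langle q,x\rangle-2i\langle q\tilde a,x\rangle)}.$$ For $f\in L^1(\mathscr Q)$, $\widehat f(a)=\int_{\mathscr Q}f(x,t)\pi_a(x,t)\,dx\,dt$; $\|\cdot\|_{HS}$ is the Hilbert–Schmidt norm on $\mathscr H_a$. The two spaces are $$\mathscr S_{\mathscr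 R}(\mathscr Q)=\Big\{f\in\mathscr S(\mathscr Q):\int_{\Im\mathbb Q}\|\widehat f(a)\|_{HS}^2|a|^{2-k}da<+\infty\text{ for all }k\in\mathbb N\Big\},$$ $$\mathscr S_*(\mathscr Q)=\Big\{f\in\mathscr S(\mathscr Q):\int_{\Im\mathbb Q}f(x,t)t^s\,dt=0\text{ for all }x\in\mathbb Q,\ s\in\mathbb N^3\Big\},$$ where $t=t_1i+t_2j+t_3k$ and $t^s=t_1^{s_1}t_2^{s_2}t_3^{s_3}$ for $s=(s_1,s_2,s_3)\in\mathbb N^3$. *)

(* Defs.v *)
From HB Require Import structures.
From mathcomp Require Import all_boot all_order all_algebra.
From mathcomp Require Import complex.
From mathcomp Require Import all_classical all_reals all_analysis.
From mathcomp Require Import ring.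

Set Implicit Arguments.
Unset Strict Implicit.
Unset Printing Implicit Defensive.
Import Order.TTheory GRing.Theory Num.Theory.
Import numFieldNormedType.Exports.
Local Open Scope classical_set_scope.
Local Open Scope ring_scope.
Local Open Scope complex_scope.

(* The quaternion w + x i + y j + z k is the tuple (w, x, y, z), and the
   imaginary quaternion x i + y j + z k is the tuple (x, y, z).  Both inherit
   the vector space, topological and Borel structures of products.  Beware:
   the library's componentwise ring product and its norm `|_| (a sup norm) on
   tuples are not the quaternion product and modulus, which are qmul, qabs. *)
Definition quat (R : realType) : Type := (R * R * R * R)%type.
Definition imquat (R : realType) : Type := (R * R * R)%type.
Definition heis (R : realType) : Type := (quat R * imquat R)%type.

Section Quaternions.
Variable R : realType.
Implicit Types (q h x : quat R) (a t : imquat R).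

Definition qmul q h : quat R :=
  let: (a0, a1, a2, a3) := q in
  let: (b0, b1, b2, b3) := h in
  (a0 * b0 - a1 * b1 - a2 * b2 - a3 * b3,
   a0 * b1 + a1 * b0 + a2 * b3 - a3 * b2,
   a0 * b2 - a1 * b3 + a2 * b0 + a3 * b1,
   a0 * b3 + a1 * b2 - a2 * b1 + a3 * b0).

Definition qconj q : quat R :=
  let: (a0, a1, a2, a3) := q in (a0, - a1, - a2, - a3).

Definition qre q : R := let: (a0, _, _, _) := q in a0.

Definition qim q : imquat R := let: (_, a1, a2, a3) := q in (a1, a2, a3).

Definition quat_of_im t : quat R := let: (t1, t2, t3) := t in (0, t1, t2, t3).

Definition qdot q h : R := qre (qmul (qconj q) h).
Definition qabs q : R := Num.sqrt (qdot q q).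
Definition imdot a t : R := qdot (quat_of_im a) (quat_of_im t).
Definition imabs a : R := qabs (quat_of_im a).

Definition heis_mul (p p' : heis R) : heis R :=
  let: (x, t) := p in
  let: (x', t') := p' in
  (x + x', t + t' - 2 *: qim (qmul (qconj x') x)).

(* The complex structure q |-> q (a / |a|), meaningful for a <> 0. *)
Definition qrot a q : quat R := qmul q (quat_of_im ((imabs a)^-1 *: a)).

End Quaternions.

(* The library's product of two sigma-finite measures is not recognized by
   inference as sigma-finite, which iterated products require. *)
Section ProductMeasure.
Context d1 d2 (T1 : measurableType d1) (T2 : measurableType d2) (R : realType).
Variable m1 : {sigma_finite_measure set T1 -> \bar R}.
Variable m2 : {sigma_finite_measure set T2 -> \bar R}.

Definition prod_measure : set (T1 * T2) -> \bar R := (m1 \x m2)%E.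

HB.instance Definition _ := Measure.copy prod_measure (m1 \x m2)%E.

Let prod_measure_sigma_finite : sigma_finite setT prod_measure.
Proof.
have /sigma_finiteP[F [TF ndF Foo]] := sigma_finiteT m1.
have /sigma_finiteP[G [TG ndG Goo]] := sigma_finiteT m2.
exists (fun n => F n `*` G n).
  rewrite -setXTT TF TG predeqE => -[x y]; split.
    move=> [/= [n _ Fnx] [k _ Gky]]; exists (maxn n k) => //; split.
    - by move: x Fnx; exact/subsetPset/ndF/leq_maxl.
    - by move: y Gky; exact/subsetPset/ndG/leq_maxr.
  by move=> [n _ []/= ? ?]; split; exists n.
move=> k; have [? ?] := Foo k; have [? ?] := Goo k.
split; first exact: measurableX.
by rewrite /prod_measure product_measure1E// lte_mul_pinfty// ge0_fin_numE.
Qed.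

HB.instance Definition _ := Measure_isSigmaFinite.Build _ _ _ prod_measure
  prod_measure_sigma_finite.

End ProductMeasure.

Section Measures.
Variable R : realType.

Local Notation leb := (@lebesgue_measure R).
Local Notation mR := (measurableTypeR R).

Definition leb_quat :
    {sigma_finite_measure set (mR * mR * mR * mR)%type -> \bar R} :=
  prod_measure (prod_measure (prod_measure leb leb) leb) leb.
Definition leb_im : {sigma_finite_measure set (mR * mR * mR)%type -> \bar R} :=
  prod_measure (prod_measure leb leb) leb.
Definition leb_heis :
    {sigma_finite_measure
       set ((mR * mR * mR * mR) * (mR * mR * mR))%type -> \bar R} :=
  prod_measure leb_quat leb_im.

End Measures.
Arguments leb_quat {R}.
Arguments leb_im {R}.
Arguments leb_heis {R}.

Section ComplexValued.
Variable R : realType.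

Definition cexp (z : R[i]) : R[i] :=
  (expR (complex.Re z) * cos (complex.Im z))
  +i* (expR (complex.Re z) * sin (complex.Im z)).

Definition cintegral (d : measure_display) (T : measurableType d)
    (mu : {measure set T -> \bar R}) (f : T -> R[i]) : R[i] :=
  (\int[mu]_x complex.Re (f x)) +i* (\int[mu]_x complex.Im (f x)).

Variable V : normedModType R.

(* R[i] is not a normed R-module in the library, so that real differentiability
   of complex-valued functions is expressed through Re and Im. *)
Definition cdifferentiable (f : V -> R[i]) (x : V) : Prop :=
  differentiable (fun y => complex.Re (f y)) x /\
  differentiable (fun y => complex.Im (f y)) x.

Definition cderive (v : V) (f : V -> R[i]) (x : V) : R[i] :=
  'D_v (fun y => complex.Re (f y)) x +i* 'D_v (fun y => complex.Im (f y)) x.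

Definition ccontinuous (f : V -> R[i]) : Prop :=
  continuous (fun y => complex.Re (f y)) /\
  continuous (fun y => complex.Im (f y)).

(* Iterated directional derivatives of f along the vectors of vs. *)
Definition cderives (vs : seq V) (f : V -> R[i]) : V -> R[i] :=
  foldr cderive f vs.

(* For V finite-dimensional: f is smooth and all its derivatives decay faster
   than any power of the norm (all norms on V define the same space). *)
Definition schwartz (f : V -> R[i]) : Prop :=
  forall vs : seq V,
    (forall x, cdifferentiable (cderives vs f) x) /\
    (forall N : nat, exists C : R,
       forall x, (1 + `|x|) ^+ N * Normc.normc (cderives vs f x) <= C).

End ComplexValued.

Section Fock.
Variable R : realType.
Variable a : imquat R.
Implicit Types F G : quat R -> R[i].

(* F is of class C^1 and its real differential is complex linear from the
   complex structure qrot a to that of R[i]. *)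
Definition holomorphic F : Prop :=
  [/\ forall q, cdifferentiable F q,
      forall h, ccontinuous (cderive h F)
    & forall q h, cderive (qrot a h) F q = 'i%C * cderive h F q].

Definition fock_norm2 F : \bar R :=
  (\int[leb_quat]_q
     (Normc.normc (F q) ^+ 2 * expR (- 2 * imabs a * qabs q ^+ 2))%:E)%E.

Definition fock F : Prop := holomorphic F /\ (fock_norm2 F < +oo)%E.

Definition fock_inner F G : R[i] :=
  cintegral leb_quat
    (fun q => F q * conjc (G q) * (expR (- 2 * imabs a * qabs q ^+ 2))%:C).

Definition orthonormal_basis (e : nat -> quat R -> R[i]) : Prop :=
  [/\ forall n, fock (e n),
      forall m n, fock_inner (e m) (e n) = (m == n)%:R
    & forall F, fock F ->
        (fun n => fock_norm2
           (fun q => F q - \sum_(i < n) fock_inner F (e i) * e i q))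
          @ \oo --> 0%E].

(* The squared Hilbert-Schmidt norm of T, an operator on the Fock space: it is
   computed in some orthonormal basis, and does not depend on which one. *)
Definition fock_basis : nat -> quat R -> R[i] :=
  xget (fun _ _ => 0) [set e | orthonormal_basis e].

Definition hs_norm2 (T : (quat R -> R[i]) -> quat R -> R[i]) : \bar R :=
  (\sum_(0 <= n <oo) fock_norm2 (T (fock_basis n)))%E.

Definition fock_rep (p : heis R) F : quat R -> R[i] := fun q =>
  let: (x, t) := p in
  F (q + x) *
  cexp ('i%C * (imdot a t)%:C
        - (imabs a)%:C * ((qabs x ^+ 2)%:C + 2 * (qdot q x)%:C
                          - 2 * 'i%C * (qdot (qrot a q) x)%:C)).

(* The operator-valued integral of f(x,t) pi_a(x,t), applied to F and evaluated
   at q: evaluations are continuous on the Fock space, hence commute with the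
   integral. *)
Definition fourier (f : heis R -> R[i]) F : quat R -> R[i] := fun q =>
  cintegral leb_heis (fun p => f p * fock_rep p F q).

End Fock.

Lemma cexpD (R : realType) (z w : R[i]) : cexp (z + w) = cexp z * cexp w.
Proof.
case: z w => [z1 z2] [w1 w2]; rewrite /cexp /= expRD cosD sinD.
by apply/eqP; rewrite eq_complex /=; apply/andP; split; apply/eqP; ring.
Qed.

(* The conventions are consistent: fock_rep a is a representation. *)
Lemma fock_rep_mul (R : realType) (a : imquat R) (p p' : heis R)
    (F : quat R -> R[i]) : a <> 0 ->
  fock_rep a p (fock_rep a p' F) = fock_rep a (heis_mul p p') F.
Proof.
move=> a0; apply/funext => q.
have qabsE (y : quat R) : qabs y ^+ 2 = qdot y y.
  rewrite sqr_sqrtr //; case: y => [[[y0 y1] y2] y3].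
  by rewrite /qdot /= !mulNr !opprK -!expr2 !addr_ge0 ?sqr_ge0.
have na0 : imabs a != 0.
  case: a a0 => [[a1 a2] a3] a0; apply/eqP => h; apply: a0.
  have : a1 ^+ 2 + a2 ^+ 2 + a3 ^+ 2 = 0.
    have <- : imabs (a1, a2, a3) ^+ 2 = a1 ^+ 2 + a2 ^+ 2 + a3 ^+ 2.
      by rewrite /imabs qabsE /qdot /=; ring.
    by rewrite h expr0n.
  move/eqP; rewrite !paddr_eq0 ?addr_ge0 ?sqr_ge0 // !sqrf_eq0.
  by case/andP => /andP[/eqP -> /eqP ->] /eqP ->.
case: p p' => [x t] [x' t']; rewrite /fock_rep /heis_mul.
rewrite -mulrA -cexpD; congr (_ * cexp _).
  by rewrite addrA.
have expE (r s b c d : R) :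
    'i%C * s%:C - r%:C * (b%:C + 2 * c%:C - 2 * 'i%C * d%:C)
    = (- (r * (b + 2 * c))) +i* (s + 2 * (r * d)).
  by apply/eqP; rewrite eq_complex /=; apply/andP; split; apply/eqP; ring.
have rotE (u v : quat R) :
    imabs a * qdot (qrot a u) v = qdot (qmul u (quat_of_im a)) v.
  have scaleE (c : R) : quat_of_im (c *: a) = c *: quat_of_im a :> quat R.
    case: a {a0 na0} => [[a1 a2] a3].
    by congr (_, _, _, _); rewrite /= /GRing.scale /= mulr0.
  rewrite /qrot scaleE.
  move: (imabs a) (quat_of_im a) na0 => r [[[b0 b1] b2] b3] r0.
  case: u v => [[[u0 u1] u2] u3] [[[v0 v1] v2] v3].
  have -> : r^-1 *: (b0, b1, b2, b3)
      = (r^-1 * b0, r^-1 * b1, r^-1 * b2, r^-1 * b3) by [].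
  rewrite /qdot /=; set w := r^-1.
  have rw : r * w = 1 by rewrite /w divff.
  rewrite -[RHS]mul1r -rw; ring.
rewrite !expE !rotE !qabsE.
move: (imabs a) => r {expE rotE qabsE na0 a0}.
case: a => [[a1 a2] a3].
case: x => [[[x0 x1] x2] x3]; case: x' => [[[y0 y1] y2] y3].
case: q => [[[q0 q1] q2] q3]; case: t => [[t1 t2] t3]; case: t' => [[s1 s2] s3].
apply/eqP; rewrite eq_complex /imdot /qdot /= /GRing.scale /=.
by apply/andP; split; apply/eqP; ring.
Qed.

Section Spaces.
Variable R : realType.

Definition schwartz_R : set (heis R -> R[i]) :=
  [set f | schwartz f /\
    forall k : nat,
      (\int[leb_im]_(a in [set a : imquat R | a <> 0%R])
         (hs_norm2 a (fourier a f) *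
          (imabs a ^ (2%:Z - k%:Z))%R%:E) < +oo)%E].

Definition im_monomial (s : nat * nat * nat) (t : imquat R) : R :=
  let: (s1, s2, s3) := s in
  let: (t1, t2, t3) := t in t1 ^+ s1 * t2 ^+ s2 * t3 ^+ s3.

Definition schwartz_star : set (heis R -> R[i]) :=
  [set f | schwartz f /\
    forall (x : quat R) (s : nat * nat * nat),
      cintegral leb_im (fun t => f (x, t) * (im_monomial s t)%:C) = 0].

End Spaces.
Arguments schwartz_R : clear implicits.
Arguments schwartz_star : clear implicits.

(* Main.v *)
(** Write g_a(x) for the integral of f(x,t) e^{i<a,t>} over t.  The theorem
    reduces to the Plancherel-type identity
      ||f^(a)||_HS^2 = (pi^2 / 4|a|^2) * int |g_a(x)|^2 dx,
    which turns the condition defining S_R into the finiteness of the integrals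
    of (int |g_a|^2) |a|^{-k} da for all k.  If all the t-moments of f vanish,
    the Taylor expansion of the exponential gives g_a = O(|a|^N) near a = 0, and
    integration by parts gives decay at infinity.  Conversely, if k is the least
    order for which the moment h(x,a) of <a,t>^k is not identically zero, then
    g_a = (i^k/k!) h(x,a) + O(|a|^{k+1}), so that int |g_a|^2 is at least
    c |a|^{2k} for a near some ray and the integral with exponent 2k+4
    diverges.

    For the identity, |f^(a) e_n|^2 summed over an orthonormal basis of the Fock
    space is expressed, pointwise in q, by the reproducing kernel; multiplying
    by e^{-eps|q|^2}, integrating over q (a Gaussian Fourier transform) and
    letting eps tend to 0 yields the result.  The reproducing property comes
    from the mean value property of holomorphic functions on circles, and an
    orthonormal basis is given by the normalized monomials in two complex
    coordinates adapted to the complex structure. *)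

Require Import Defs.
From HB Require Import structures.
From mathcomp Require Import all_boot all_order all_algebra.
From mathcomp Require Import complex.
From mathcomp Require Import all_classical all_reals all_analysis.
From mathcomp Require Import measurable_realfun ring lra.

Set Implicit Arguments.
Unset Strict Implicit.
Unset Printing Implicit Defensive.
Import Order.TTheory GRing.Theory Num.Theory.
Import numFieldNormedType.Exports.
Local Open Scope classical_set_scope.
Local Open Scope ring_scope.
Local Open Scope complex_scope.
Local Notation Re := complex.Re.
Local Notation Im := complex.Im.

(** * Complex-valued integrals *)

(** [fock_basis] is obtained by choice, so the Plancherel identity is proved for an arbitrary
    orthonormal basis; the monomials only show that one exists. Otherwise the default, a family of
    zeros, would be chosen and every Hilbert-Schmidt norm would vanish. The Gaussian regularization
    is forced. After summation over n, the variable q survives only in a unimodular factor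
    e^{4i|a|<Jq, x - y>}, whose integral over q is formally a delta at x = y and does not converge
    absolutely. With e^{-eps|q|^2} Fubini applies and an approximate identity in x - y appears;
    positivity of the sum lets monotone convergence remove the factor. The constant is (2|a|/pi)^2
    pi^2 (pi/4|a|^2)^2 = pi^2/4|a|^2. The mean value property is the only analytic source: it yields
    the reproducing kernel, the Fourier transform of Gaussians (no contour shift) and the norms of
    the monomials (no Gaussian moments). In the converse inclusion only the moments of the powers
    <a,t>^k are seen to vanish. Monomials are reached by polarization: <a + m v,t>^{k+1} is expanded
    in the integer m, and the coefficient of m releases one linear factor <v,t>. *)

Section ComplexBasics.
Variable R : realType.
Implicit Types z w : R[i].

Lemma complex_ext z w : Re z = Re w -> Im z = Im w -> z = w.
Proof. by case: z => a b; case: w => c d /= -> ->. Qed.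

Lemma cReM z w : Re (z * w) = Re z * Re w - Im z * Im w.
Proof. by case: z w => [a b] [c d]. Qed.

Lemma cImM z w : Im (z * w) = Re z * Im w + Im z * Re w.
Proof. by case: z w => [a b] [c d]. Qed.

Lemma cReD z w : Re (z + w) = Re z + Re w.
Proof. by case: z w => [a b] [c d]. Qed.

Lemma cImD z w : Im (z + w) = Im z + Im w.
Proof. by case: z w => [a b] [c d]. Qed.

Lemma cReN z : Re (- z) = - Re z. Proof. by case: z. Qed.
Lemma cImN z : Im (- z) = - Im z. Proof. by case: z. Qed.
Lemma cReJ z : Re (conjc z) = Re z. Proof. by case: z. Qed.
Lemma cImJ z : Im (conjc z) = - Im z. Proof. by case: z. Qed.
Lemma cRe_real (x : R) : Re x%:C = x. Proof. by []. Qed.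
Lemma cIm_real (x : R) : Im x%:C = 0. Proof. by []. Qed.
Lemma cRe_i : Re 'i%C = 0 :> R. Proof. by []. Qed.
Lemma cIm_i : Im 'i%C = 1 :> R. Proof. by []. Qed.

Lemma cRe_mk (x y : R) : Re (x +i* y) = x. Proof. by []. Qed.
Lemma cIm_mk (x y : R) : Im (x +i* y) = y. Proof. by []. Qed.

Definition cReE := (cRe_mk, cReM, cReD, cReN, cReJ, cRe_i, cRe_real).
Definition cImE := (cIm_mk, cImM, cImD, cImN, cImJ, cIm_i, cIm_real).

Lemma normcE2 z : Normc.normc z = Num.sqrt (Re z ^+ 2 + Im z ^+ 2).
Proof. by case: z. Qed.

Lemma normc_ge0 z : 0 <= Normc.normc z.
Proof. by rewrite normcE2 sqrtr_ge0. Qed.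

Lemma sqr_normcE z : Normc.normc z ^+ 2 = Re z ^+ 2 + Im z ^+ 2.
Proof. by rewrite normcE2 sqr_sqrtr// addr_ge0 ?sqr_ge0. Qed.

Lemma normc_Re z : `|Re z| <= Normc.normc z.
Proof.
rewrite normcE2 -(sqrtr_sqr (Re z)) ler_sqrt ?addr_ge0 ?sqr_ge0//.
by rewrite lerDl sqr_ge0.
Qed.

Lemma normc_Im z : `|Im z| <= Normc.normc z.
Proof.
rewrite normcE2 -(sqrtr_sqr (Im z)) ler_sqrt ?addr_ge0 ?sqr_ge0//.
by rewrite lerDr sqr_ge0.
Qed.

Lemma normc_le z : Normc.normc z <= `|Re z| + `|Im z|.
Proof.
rewrite -(@ler_pXn2r _ 2)// ?nnegrE ?addr_ge0 ?normc_ge0//.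
rewrite (sqr_normcE z) -(real_normK (num_real (Re z))) -(real_normK (num_real (Im z))).
rewrite sqrrD -addrA lerD2l lerDr.
by rewrite mulrn_wge0 ?mulr_ge0.
Qed.

Lemma normc_real (x : R) : Normc.normc x%:C = `|x|.
Proof. by rewrite normcE2 /= expr0n/= addr0 sqrtr_sqr. Qed.

Lemma cnormJ z : Normc.normc (conjc z) = Normc.normc z.
Proof. by rewrite !normcE2 cReJ cImJ sqrrN. Qed.

Lemma cnormM z w : Normc.normc (z * w) = Normc.normc z * Normc.normc w.
Proof. exact: Normc.normcM. Qed.

Lemma cnorm0 : Normc.normc (0 : R[i]) = 0.
Proof. by rewrite normcE2 /= expr0n addr0 sqrtr0. Qed.

Lemma cnorm1 : Normc.normc (1 : R[i]) = 1.
Proof. by rewrite normcE2 /= expr0n expr1n addr0 sqrtr1. Qed.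

Lemma cnormN z : Normc.normc (- z) = Normc.normc z.
Proof. by rewrite !normcE2 cReN cImN !sqrrN. Qed.

Lemma cnormD z w : Normc.normc (z + w) <= Normc.normc z + Normc.normc w.
Proof.
have E (u : R[i]) : `|u| = (Normc.normc u)%:C by rewrite normc_def normcE2.
by have := ler_normD z w; rewrite !E -rmorphD lecR.
Qed.

Lemma cnormX z n : Normc.normc (z ^+ n) = Normc.normc z ^+ n.
Proof.
elim: n => [|n ih]; first by rewrite !expr0 cnorm1.
by rewrite !exprS cnormM ih.
Qed.

Lemma cconjD z w : conjc (z + w) = conjc z + conjc w.
Proof. by apply: complex_ext; rewrite !(cReE, cImE) ?opprD. Qed.

Lemma cconjM z w : conjc (z * w) = conjc z * conjc w.
Proof. by apply: complex_ext; rewrite !(cReE, cImE); ring. Qed.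

Lemma cconj_real (x : R) : conjc x%:C = x%:C.
Proof. by apply: complex_ext; rewrite !(cReE, cImE) ?oppr0. Qed.

Lemma cconjK z : conjc (conjc z) = z.
Proof. by apply: complex_ext; rewrite !(cReE, cImE) ?opprK. Qed.

Lemma normc_cexp z : Normc.normc (cexp z) = expR (Re z).
Proof.
rewrite normcE2 /= !exprMn -mulrDr cos2Dsin2 mulr1 sqrtr_sqr ger0_norm//. 
Qed.

Lemma mulcJ z : z * conjc z = (Normc.normc z ^+ 2)%:C.
Proof.
case: z => a b; apply: complex_ext; rewrite [RHS]/= ?sqr_normcE /=; last by ring.
rewrite sqr_sqrtr ?addr_ge0 ?sqr_ge0//; ring.
Qed.

Lemma cexpJ z : conjc (cexp z) = cexp (conjc z).
Proof. by case: z => a b; rewrite /cexp /= cosN sinN mulrN. Qed.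

Lemma cexp0 : cexp 0 = 1 :> R[i].
Proof. by rewrite /cexp /= expR0 cos0 sin0 mulr0 mulr1. Qed.

Lemma cexp_real (x : R) : cexp x%:C = (expR x)%:C.
Proof. by rewrite /cexp /= cos0 sin0 mulr0 mulr1. Qed.

End ComplexBasics.

Section ComplexIntegral.
Context d (T : measurableType d) (R : realType).
Variable mu : {measure set T -> \bar R}.
Implicit Types (f g : T -> R[i]) (h : T -> R) (c : R[i]).

Definition cmeas f := measurable_fun setT (fun x => Re (f x)) /\
  measurable_fun setT (fun x => Im (f x)).

Definition cintegrable f :=
  mu.-integrable setT (EFin \o (fun x => Re (f x))) /\
  mu.-integrable setT (EFin \o (fun x => Im (f x))).

Lemma cmeasD f g : cmeas f -> cmeas g -> cmeas (fun x => f x + g x).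
Proof.
move=> [f1 f2] [g1 g2]; split.
  by under eq_fun do rewrite cReD; exact: measurable_funD.
by under eq_fun do rewrite cImD; exact: measurable_funD.
Qed.

Lemma cmeasM f g : cmeas f -> cmeas g -> cmeas (fun x => f x * g x).
Proof.
move=> [f1 f2] [g1 g2]; split.
  under eq_fun do rewrite cReM.
  by apply: measurable_funB; exact: measurable_funM.
under eq_fun do rewrite cImM.
by apply: measurable_funD; exact: measurable_funM.
Qed.

Lemma cmeasJ f : cmeas f -> cmeas (fun x => conjc (f x)).
Proof.
move=> [f1 f2]; split; first by under eq_fun do rewrite cReJ.
by under eq_fun do rewrite cImJ; exact: measurableT_comp.
Qed.

Lemma cmeas_real h : measurable_fun setT h -> cmeas (fun x => (h x)%:C).
Proof. by move=> mh; split => //=; exact: measurable_cst. Qed.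

Lemma cmeas_cst c : cmeas (fun=> c).
Proof. by split; exact: measurable_cst. Qed.

Lemma cmeasN f : cmeas f -> cmeas (fun x => - f x).
Proof.
move=> mf; under eq_fun do rewrite -mulN1r.
by apply: cmeasM => //; exact: cmeas_cst.
Qed.

Lemma cmeas_sum I (r : seq I) (P : pred I) (F : I -> T -> R[i]) :
  (forall i, cmeas (F i)) -> cmeas (fun x => \sum_(i <- r | P i) F i x).
Proof.
move=> mF; elim: r => [|i r ih].
  by under eq_fun do rewrite big_nil; exact: cmeas_cst.
under eq_fun do rewrite big_cons.
by case: (P i) => //; exact: cmeasD.
Qed.

Lemma cmeasX f n : cmeas f -> cmeas (fun x => f x ^+ n).
Proof.
move=> mf; elim: n => [|n ih].
  by under eq_fun do rewrite expr0; exact: cmeas_cst.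
by under eq_fun do rewrite exprS; exact: cmeasM.
Qed.

Lemma cmeas_cexp f : cmeas f -> cmeas (fun x => cexp (f x)).
Proof.
move=> [f1 f2].
have me : measurable_fun setT (fun x => expR (Re (f x))).
  exact: measurableT_comp.
split => /=; apply: measurable_funM => //.
- apply: (measurableT_comp (f := @cos R)) => //.
  by apply: continuous_measurable_fun; exact: continuous_cos.
- apply: (measurableT_comp (f := @sin R)) => //.
  by apply: continuous_measurable_fun; exact: continuous_sin.
Qed.

Lemma cmeas_normc f : cmeas f -> measurable_fun setT (fun x => Normc.normc (f x)).
Proof.
move=> [f1 f2]; under eq_fun do rewrite normcE2.
apply: (measurableT_comp (f := @Num.sqrt R)).
  by apply: continuous_measurable_fun; exact: sqrt_continuous.
by apply: measurable_funD; exact: measurable_funX.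
Qed.

Lemma cintegrable_meas f : cintegrable f -> cmeas f.
Proof.
by move=> [/measurable_int ? /measurable_int ?]; split;
  exact/measurable_EFinP.
Qed.

Lemma cintegrable_le f h : cmeas f -> mu.-integrable setT (EFin \o h) ->
  (forall x, Normc.normc (f x) <= h x) -> cintegrable f.
Proof.
move=> [f1 f2] ih le; split; apply: (le_integrable _ _ _ ih) => //=.
- exact/measurable_EFinP.
- move=> x _; rewrite lee_fin (le_trans (normc_Re _))//.
  by rewrite (le_trans (le _))// ler_norm.
- exact/measurable_EFinP.
- move=> x _; rewrite lee_fin (le_trans (normc_Im _))//.
  by rewrite (le_trans (le _))// ler_norm.
Qed.

Lemma cintegrable_normc f : cintegrable f ->
  mu.-integrable setT (EFin \o (fun x => Normc.normc (f x))).
Proof.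
move=> ff; have [f1 f2] := ff.
have := integrableD measurableT (integrable_abse f1) (integrable_abse f2).
apply: le_integrable => //=.
  by apply/measurable_EFinP; apply: cmeas_normc; exact: cintegrable_meas.
move=> x _; rewrite lee_fin ger0_norm ?normc_ge0//.
by rewrite ger0_norm ?addr_ge0// normc_le.
Qed.

Lemma cintegrableD f g : cintegrable f -> cintegrable g ->
  cintegrable (fun x => f x + g x).
Proof.
move=> [f1 f2] [g1 g2]; split.
  by rewrite (_ : _ \o _ = (EFin \o (fun x => Re (f x))) \+
    (EFin \o (fun x => Re (g x))))%E ?integrableD// funeqE => x /=; rewrite cReD.
by rewrite (_ : _ \o _ = (EFin \o (fun x => Im (f x))) \+
    (EFin \o (fun x => Im (g x))))%E ?integrableD// funeqE => x /=; rewrite cImD.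
Qed.

Lemma cintegrableZl f c : cintegrable f -> cintegrable (fun x => c * f x).
Proof.
move=> ff; apply: (@cintegrable_le _ (fun x => Normc.normc c * Normc.normc (f x))).
- by apply: cmeasM; [exact: cmeas_cst|exact: cintegrable_meas].
- rewrite (_ : _ \o _ =
    (fun x => (Normc.normc c)%:E * (EFin \o (fun x => Normc.normc (f x))) x)%E)//.
  exact/integrableZl/cintegrable_normc.
- by move=> x; rewrite cnormM.
Qed.

Lemma cintegrableJ f : cintegrable f -> cintegrable (fun x => conjc (f x)).
Proof.
move=> ff; apply: (cintegrable_le _ (cintegrable_normc ff)).
  exact/cmeasJ/cintegrable_meas.
by move=> x; rewrite cnormJ.
Qed.

Lemma cintegrable0 : cintegrable (fun=> 0).
Proof. by split => /=; rewrite (_ : _ \o _ = cst 0%E)//; exact: integrable0. Qed.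

Lemma cintegrable_sum I (r : seq I) (P : pred I) (F : I -> T -> R[i]) :
  (forall i, cintegrable (F i)) -> cintegrable (fun x => \sum_(i <- r | P i) F i x).
Proof.
move=> mF; elim: r => [|i r ih].
  by under eq_fun do rewrite big_nil; exact: cintegrable0.
under eq_fun do rewrite big_cons.
by case: (P i) => //; exact: cintegrableD.
Qed.

Lemma eq_cintegral f g : f =1 g -> cintegral mu f = cintegral mu g.
Proof. by move=> /funext ->. Qed.

Lemma cintegralD f g : cintegrable f -> cintegrable g ->
  cintegral mu (fun x => f x + g x) = cintegral mu f + cintegral mu g.
Proof.
move=> [f1 f2] [g1 g2]; apply: complex_ext => /=.
  by rewrite -RintegralD//; apply: eq_Rintegral => x _; rewrite cReD.
by rewrite -RintegralD//; apply: eq_Rintegral => x _; rewrite cImD.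
Qed.

Lemma cintegralZl f c : cintegrable f ->
  cintegral mu (fun x => c * f x) = c * cintegral mu f.
Proof.
move=> [f1 f2].
have Z (h : T -> R) r : mu.-integrable setT (EFin \o h) ->
    mu.-integrable setT (EFin \o (fun x => r * h x)).
  by move=> ih; rewrite (_ : _ \o _ = (fun x => r%:E * (EFin \o h) x)%E)//;
    exact: integrableZl.
apply: complex_ext; rewrite ?cReE ?cImE /= -!RintegralZl//.
  rewrite -RintegralB//; [|exact: Z|exact: Z].
  by apply: eq_Rintegral => x _; rewrite cReM.
rewrite -RintegralD//; [|exact: Z|exact: Z].
by apply: eq_Rintegral => x _; rewrite cImM.
Qed.

Lemma cintegralZr f c : cintegrable f ->
  cintegral mu (fun x => f x * c) = cintegral mu f * c.
Proof.
by move=> ff; rewrite mulrC -cintegralZl//; apply: eq_cintegral => x;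
  rewrite mulrC.
Qed.

Lemma cintegralJ f : cintegrable f ->
  cintegral mu (fun x => conjc (f x)) = conjc (cintegral mu f).
Proof.
move=> [f1 f2]; apply: complex_ext; rewrite ?cReE ?cImE /=.
  by apply: eq_Rintegral => x _; rewrite cReJ.
rewrite -mulN1r -RintegralZl//; apply: eq_Rintegral => x _.
by rewrite cImJ mulN1r.
Qed.

Lemma cintegral0 : cintegral mu (fun=> 0) = 0.
Proof. by rewrite /cintegral /= /Rintegral integral0. Qed.

Lemma cintegral_sum I (r : seq I) (P : pred I) (F : I -> T -> R[i]) :
  (forall i, cintegrable (F i)) ->
  cintegral mu (fun x => \sum_(i <- r | P i) F i x) =
  \sum_(i <- r | P i) cintegral mu (F i).
Proof.
move=> iF; elim: r => [|i r ih].
  by under eq_cintegral do rewrite big_nil; rewrite big_nil cintegral0.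
under eq_cintegral do rewrite big_cons.
rewrite big_cons; case: (P i) => //; rewrite cintegralD ?ih//.
exact: cintegrable_sum.
Qed.

Lemma cintegral_real h : cintegral mu (fun x => (h x)%:C) = (\int[mu]_x h x)%:C.
Proof.
apply: complex_ext => //=; rewrite /Rintegral.
by under eq_integral do rewrite /=; rewrite integral0.
Qed.

(** Real and imaginary parts are bounded separately, whence the factor 2; only the existence of some
    constant matters later. *)
Lemma normc_cintegral_le f : cintegrable f ->
  Normc.normc (cintegral mu f) <= 2 * \int[mu]_x Normc.normc (f x).
Proof.
move=> ff; have [f1 f2] := ff; have nf := cintegrable_normc ff.
rewrite (le_trans (normc_le _))//= mulr_natl mulr2n lerD//.
  apply: (le_trans (le_normr_Rintegral _ _)) => //.
  apply: le_Rintegral => //; [exact: integrable_norm|].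
  by move=> x _; exact: normc_Re.
apply: (le_trans (le_normr_Rintegral _ _)) => //.
apply: le_Rintegral => //; [exact: integrable_norm|].
by move=> x _; exact: normc_Im.
Qed.

Lemma le_Rintegral_of_integrable h (g : T -> R) : measurable_fun setT h ->
  mu.-integrable setT (EFin \o g) -> (forall x, `|h x| <= g x) ->
  mu.-integrable setT (EFin \o h).
Proof.
move=> mh ig hg; apply: (le_integrable _ _ _ ig) => //.
  exact/measurable_EFinP.
by move=> x _ /=; rewrite lee_fin (le_trans (hg x))// ler_norm.
Qed.

Lemma Rdominated_cvg (h_ : nat -> T -> R) h (g : T -> R) :
  (forall n, measurable_fun setT (h_ n)) -> measurable_fun setT h ->
  (forall x, h_ ^~ x @ \oo --> h x) ->
  mu.-integrable setT (EFin \o g) -> (forall n x, `|h_ n x| <= g x) ->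
  (fun n => \int[mu]_x h_ n x) @ \oo --> \int[mu]_x h x.
Proof.
move=> mh_ mh ch ig hg.
have ch' x : (EFin \o h_ ^~ x) @ \oo --> (h x)%:E.
  by apply/fine_cvgP; split; [exact: nearW|exact: ch].
have [ih _ cv] := @dominated_convergence _ _ _ mu setT measurableT
  (fun n => EFin \o h_ n) (EFin \o h) (EFin \o g)
  (fun n => proj2 (measurable_EFinP _ _) (mh_ n))
  (proj2 (measurable_EFinP _ _) mh)
  (aeW _ (fun x _ => ch' x))
  ig (aeW _ (fun x n _ => hg n x)).
have /fine_cvg : (fun n => \int[mu]_x (EFin \o h_ n) x)%E @ \oo -->
    (fine (\int[mu]_x (EFin \o h) x)%E)%:E.
  by rewrite fineK//; exact: integrable_fin_num.
exact.
Qed.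

(** Componentwise, so that real dominated convergence and uniqueness of real limits apply
    directly. *)
Definition ccvg (u : nat -> R[i]) (l : R[i]) :=
  ((fun n => Re (u n)) @ \oo --> Re l) /\ ((fun n => Im (u n)) @ \oo --> Im l).

Lemma cdominated_cvg (f_ : nat -> T -> R[i]) f (g : T -> R) :
  (forall n, cmeas (f_ n)) -> cmeas f ->
  (forall x, ccvg (f_ ^~ x) (f x)) ->
  mu.-integrable setT (EFin \o g) -> (forall n x, Normc.normc (f_ n x) <= g x) ->
  ccvg (fun n => cintegral mu (f_ n)) (cintegral mu f).
Proof.
move=> mf_ mf cf ig fg; split.
  apply: (Rdominated_cvg (h_ := fun n x => Re (f_ n x)) (g := g)) => //.
  - by move=> n; case: (mf_ n).
  - by case: mf.
  - by move=> x; case: (cf x).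
  - by move=> n x; exact: le_trans (normc_Re _) (fg _ _).
apply: (Rdominated_cvg (h_ := fun n x => Im (f_ n x)) (g := g)) => //.
- by move=> n; case: (mf_ n).
- by case: mf.
- by move=> x; case: (cf x).
- by move=> n x; exact: le_trans (normc_Im _) (fg _ _).
Qed.

End ComplexIntegral.

(** * Measure-preserving maps, Fubini and invariance of the Lebesgue measure *)

Section MeasurePreserving.
Context d (T : measurableType d) (R : realType).
Variable mu : {measure set T -> \bar R}.
Implicit Types s : T -> T.

(** Phrased through integrals of nonnegative functions instead of measures of preimages: in this
    form Tonelli gives stability under products, and linear changes of variables produce exactly
    this statement. *)
Definition mpres s := measurable_fun setT s /\
  forall f : T -> \bar R, measurable_fun setT f -> (forall x, 0 <= f x)%E ->
    (\int[mu]_x f (s x) = \int[mu]_x f x)%E.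

Lemma mpres_integral s (f : T -> \bar R) : mpres s -> measurable_fun setT f ->
  (\int[mu]_x f (s x) = \int[mu]_x f x)%E.
Proof.
move=> [ms ps] mf; rewrite [LHS]integralE [RHS]integralE.
congr (_ - _)%E.
  rewrite -[RHS](ps _ (measurable_funepos mf) (fun=> funepos_ge0 _ _)).
  by apply: eq_integral => x _; rewrite !funeposE.
rewrite -[RHS](ps _ (measurable_funeneg mf) (fun=> funeneg_ge0 _ _)).
by apply: eq_integral => x _; rewrite !funenegE.
Qed.

Lemma mpres_cintegral s (f : T -> R[i]) : mpres s -> cmeas f ->
  cintegral mu (fun x => f (s x)) = cintegral mu f.
Proof.
move=> ps [f1 f2]; apply: complex_ext => /=; congr fine.
  by apply: (mpres_integral (f := fun x => (Re (f x))%:E)) => //;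
    exact/measurable_EFinP.
by apply: (mpres_integral (f := fun x => (Im (f x))%:E)) => //;
  exact/measurable_EFinP.
Qed.

Lemma mpres_integrable s (f : T -> \bar R) : mpres s ->
  mu.-integrable setT f -> mu.-integrable setT (f \o s).
Proof.
move=> ps /integrableP[mf foo]; apply/integrableP; split.
  by apply: measurableT_comp => //; case: ps.
rewrite (mpres_integral (f := fun x => `|f x|%E)) => //.
exact: measurableT_comp.
Qed.

Lemma cmeas_comp (f : T -> R[i]) s : measurable_fun setT s -> cmeas f ->
  cmeas (fun x => f (s x)).
Proof.
by move=> ms [f1 f2]; split; [exact: (measurableT_comp f1)|
  exact: (measurableT_comp f2)].
Qed.

Lemma mpres_cintegrable s (f : T -> R[i]) : mpres s ->
  cintegrable mu f -> cintegrable mu (fun x => f (s x)).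
Proof.
by move=> ps [f1 f2]; split; [exact: (mpres_integrable ps f1)|
  exact: (mpres_integrable ps f2)].
Qed.

End MeasurePreserving.

Section Products.
Context d1 d2 (T1 : measurableType d1) (T2 : measurableType d2) (R : realType).
Variable m1 : {sigma_finite_measure set T1 -> \bar R}.
Variable m2 : {sigma_finite_measure set T2 -> \bar R}.
Local Notation m12 := (prod_measure m1 m2).

Lemma prod_tonelli1 (f : T1 * T2 -> \bar R) : measurable_fun setT f ->
  (forall z, 0 <= f z)%E ->
  (\int[m12]_z f z = \int[m1]_x \int[m2]_y f (x, y))%E.
Proof. by move=> mf f0; exact: (fubini_tonelli1 (m1 := m1) (m2 := m2)). Qed.

Lemma prod_tonelli2 (f : T1 * T2 -> \bar R) : measurable_fun setT f ->
  (forall z, 0 <= f z)%E ->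
  (\int[m12]_z f z = \int[m2]_y \int[m1]_x f (x, y))%E.
Proof. by move=> mf f0; exact: (fubini_tonelli2 (m1 := m1) (m2 := m2)). Qed.

Lemma mpres_prod (s1 : T1 -> T1) (s2 : T2 -> T2) : mpres m1 s1 -> mpres m2 s2 ->
  mpres m12 (fun z => (s1 z.1, s2 z.2)).
Proof.
move=> [ms1 p1] [ms2 p2].
have ms : measurable_fun setT (fun z : T1 * T2 => (s1 z.1, s2 z.2)).
  by apply: measurable_fun_pair; exact: measurableT_comp.
split => // f mf f0.
rewrite prod_tonelli1//; last exact: (measurableT_comp mf ms).
rewrite prod_tonelli1//= -[RHS](p1 (fun x => \int[m2]_y f (x, y)))%E; last 2 first.
- exact: (measurable_fun_fubini_tonelli_F (m2 := m2)).
- by move=> x; exact: integral_ge0.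
apply: eq_integral => x _; rewrite (p2 (fun y => f (s1 x, y)))//.
exact: (measurableT_comp mf (measurable_pair1 _)).
Qed.

(** Tonelli gives measurability for the positive and negative parts; their difference is then
    composed with the measurable function [fine]. *)
Lemma measurable_cintegral1 (f : T1 * T2 -> R[i]) : cmeas f ->
  cmeas (fun x => cintegral m2 (fun y => f (x, y))).
Proof.
have H (h : T1 * T2 -> R) : measurable_fun setT h ->
    measurable_fun setT (fun x => \int[m2]_y h (x, y)).
  move=> mh; apply: (measurableT_comp (f := @fine R)) => //.
  have mh' : measurable_fun setT (EFin \o h) by exact/measurable_EFinP.
  rewrite (_ : (fun x => _) = (fun x => \int[m2]_y (EFin \o h)^\+ (x, y)) \-
      (fun x => \int[m2]_y (EFin \o h)^\- (x, y)))%E.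
    apply: emeasurable_funB.
      by apply: (measurable_fun_fubini_tonelli_F (m2 := m2)) => //;
        exact: measurable_funepos.
    by apply: (measurable_fun_fubini_tonelli_F (m2 := m2)) => //;
      exact: measurable_funeneg.
  apply/funext => x /=; rewrite [LHS]integralE.
  congr (_ - _)%E; apply: eq_integral => y _.
    by rewrite !funeposE.
  by rewrite !funenegE.
by move=> [f1 f2]; split => /=; [exact: (H (fun z => Re (f z)))|
  exact: (H (fun z => Im (f z)))].
Qed.

Lemma integrable_prodM (u : T1 -> R) (v : T2 -> R) :
  m1.-integrable setT (EFin \o u) -> m2.-integrable setT (EFin \o v) ->
  m12.-integrable setT (EFin \o (fun z => u z.1 * v z.2)).
Proof.
move=> iu iv.
have mu_ : measurable_fun setT u by exact/measurable_EFinP/(measurable_int _ iu).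
have mv_ : measurable_fun setT v by exact/measurable_EFinP/(measurable_int _ iv).
have muv : measurable_fun setT (EFin \o (fun z : T1 * T2 => u z.1 * v z.2)).
  apply/measurable_EFinP; apply: measurable_funM.
    exact: (measurableT_comp mu_).
  exact: (measurableT_comp mv_).
apply/(@integrable12ltyP _ _ _ _ _ m1 m2 _ muv) => /=.
rewrite [ltLHS](_ : _ = (\int[m2]_y `|(v y)%:E| * \int[m1]_x `|(u x)%:E|)%E).
  apply: lte_mul_pinfty.
  - exact: integral_ge0.
  - by rewrite ge0_fin_numE ?integral_ge0//; case/integrableP : iv.
  - by case/integrableP : iu.
rewrite -ge0_integralZl//; last 2 first.
- by apply: measurableT_comp => //; exact/measurable_EFinP.
- exact: integral_ge0.
apply: eq_integral => x _; rewrite muleC -ge0_integralZl//.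
  by apply: eq_integral => y _; rewrite -abseM.
by apply: measurableT_comp => //; exact/measurable_EFinP.
Qed.

(** Integrability of every section, not of almost every one, makes the inner integral finite
    everywhere, so that [fine] can be taken inside the outer integral. *)
Lemma Rfubini1 (f : T1 * T2 -> R) : m12.-integrable setT (EFin \o f) ->
  (forall x, m2.-integrable setT (EFin \o (fun y => f (x, y)))) ->
  \int[m12]_z f z = \int[m1]_x \int[m2]_y f (x, y).
Proof.
move=> jf i2; rewrite /Rintegral; congr fine.
rewrite -(@integral12_prod_meas1 _ _ _ _ _ m1 m2 _ jf).
apply: eq_integral => x _; rewrite fineK//.
exact: (integrable_fin_num measurableT (i2 x)).
Qed.

Lemma Rfubini2 (f : T1 * T2 -> R) : m12.-integrable setT (EFin \o f) ->
  (forall y, m1.-integrable setT (EFin \o (fun x => f (x, y)))) ->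
  \int[m12]_z f z = \int[m2]_y \int[m1]_x f (x, y).
Proof.
move=> jf i2; rewrite /Rintegral; congr fine.
rewrite -(@integral21_prod_meas1 _ _ _ _ _ m1 m2 _ jf).
apply: eq_integral => x _; rewrite fineK//.
exact: (integrable_fin_num measurableT (i2 x)).
Qed.

Lemma cfubini1 (f : T1 * T2 -> R[i]) : cintegrable m12 f ->
  (forall x, cintegrable m2 (fun y => f (x, y))) ->
  cintegral m12 f = cintegral m1 (fun x => cintegral m2 (fun y => f (x, y))).
Proof.
move=> [f1 f2] jf; apply: complex_ext => /=.
  by rewrite (Rfubini1 (f := fun z => Re (f z)))// => x; case: (jf x).
by rewrite (Rfubini1 (f := fun z => Im (f z)))// => x; case: (jf x).
Qed.

Lemma cfubini2 (f : T1 * T2 -> R[i]) : cintegrable m12 f ->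
  (forall y, cintegrable m1 (fun x => f (x, y))) ->
  cintegral m12 f = cintegral m2 (fun y => cintegral m1 (fun x => f (x, y))).
Proof.
move=> [f1 f2] jf; apply: complex_ext => /=.
  by rewrite (Rfubini2 (f := fun z => Re (f z)))// => x; case: (jf x).
by rewrite (Rfubini2 (f := fun z => Im (f z)))// => x; case: (jf x).
Qed.

Lemma cmeas_fst (f : T1 -> R[i]) : cmeas f -> cmeas (fun z : T1 * T2 => f z.1).
Proof.
by move=> [f1 f2]; split; [exact: (measurableT_comp f1)|
  exact: (measurableT_comp f2)].
Qed.

Lemma cmeas_snd (f : T2 -> R[i]) : cmeas f -> cmeas (fun z : T1 * T2 => f z.2).
Proof.
by move=> [f1 f2]; split; [exact: (measurableT_comp f1)|
  exact: (measurableT_comp f2)].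
Qed.

Lemma cintegrable_prodM (f : T1 -> R[i]) (g : T2 -> R[i]) :
  cintegrable m1 f -> cintegrable m2 g ->
  cintegrable m12 (fun z => f z.1 * g z.2).
Proof.
move=> jf jg; apply: (cintegrable_le _ (integrable_prodM (cintegrable_normc jf)
  (cintegrable_normc jg))).
  apply: cmeasM; [apply: cmeas_fst; exact: cintegrable_meas jf|].
  by apply: cmeas_snd; exact: cintegrable_meas jg.
by move=> z; rewrite cnormM.
Qed.

Lemma cintegral_prodM (f : T1 -> R[i]) (g : T2 -> R[i]) :
  cintegrable m1 f -> cintegrable m2 g ->
  cintegral m12 (fun z => f z.1 * g z.2) = cintegral m1 f * cintegral m2 g.
Proof.
move=> jf jg; rewrite cfubini1 /=; first 1 last.
- exact: cintegrable_prodM.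
- by move=> x; exact: cintegrableZl.
rewrite -cintegralZr//; apply: eq_cintegral => x.
by rewrite cintegralZl.
Qed.

End Products.

(** * Open sets and continuous functions are Borel on the product spaces *)

Section CountableBase.

(* Open sets are Borel for the product sigma-algebra only because the topology
   has a countable base of measurable sets. *)
Definition cbase (T : topologicalType) (mm : set (set T)) :=
  exists B : nat -> set T, (forall n, mm (B n)) /\
    forall x U, nbhs x U -> exists n, B n x /\ B n `<=` U.

Lemma cbase_open (T : topologicalType) (mm : set (set T)) (A : set T) :
  cbase mm -> mm set0 -> (forall F : nat -> set T, (forall n, mm (F n)) ->
    mm (\bigcup_n F n)) -> open A -> mm A.
Proof.
move=> [B [mB BU]] m0 mU oA.
have -> : A = \bigcup_n (if `[< B n `<=` A >] then B n else set0).
  apply/seteqP; split => [x Ax|x [n _]].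
    have [n [Bx BA]] := BU x A (open_nbhs_nbhs (conj oA Ax)).
    by exists n => //; rewrite asboolT.
  by case: asboolP => // BA /BA.
by apply: mU => n; case: asboolP.
Qed.

Lemma cbase_prod (T1 T2 : topologicalType) (mm1 : set (set T1))
    (mm2 : set (set T2)) (mm : set (set (T1 * T2))) :
  (forall A B, mm1 A -> mm2 B -> mm (A `*` B)) ->
  cbase mm1 -> cbase mm2 -> cbase mm.
Proof.
move=> H [B1 [mB1 U1]] [B2 [mB2 U2]].
exists (fun n => if unpickle n is Some (i, j) then B1 i `*` B2 j
                 else B1 0%N `*` B2 0%N); split.
  by move=> n; case: unpickle => [[i j]|]; exact: H.
move=> [x y] U [[V W] /= [Vx Wy] VWU].
have [i [Bi BV]] := U1 x V Vx; have [j [Bj BW]] := U2 y W Wy.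
exists (pickle (i, j)); rewrite pickleK; split => // z [/= z1 z2].
by apply: VWU; split; [exact: BV|exact: BW].
Qed.

Lemma cbaseR (R : realType) :
  @cbase R (@measurable _ (measurableTypeR R)).
Proof.
pose I (p : rat * rat) : set R := `]ratr p.1, ratr p.2[%classic.
exists (fun n => if unpickle n is Some p then I p else set0); split.
  by move=> n; case: unpickle => [p|//]; exact: measurable_itv.
move=> x U /nbhs_ballP[e /= e0 xeU].
have [p] := @rat_in_itvoo R (x - e) x ltac:(by rewrite ltrBlDr ltrDl).
rewrite in_itv /= => /andP[p1 p2].
have [q] := @rat_in_itvoo R x (x + e) ltac:(by rewrite ltrDl).
rewrite in_itv /= => /andP[q1 q2].
exists (pickle (p, q)); rewrite pickleK /I; split => /=.
  by rewrite in_itv /= p2 q1.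
move=> y /=; rewrite in_itv /= => /andP[y1 y2]; apply: xeU.
rewrite /ball /= ltr_distlC; apply/andP; split.
  exact: lt_trans y1.
exact: lt_trans y2 _.
Qed.

End CountableBase.

Section ContinuousMeasurable.
Variable R : realType.
Local Notation mR := (measurableTypeR R).

Lemma preimage_measurable d (M : measurableType d) (f : M -> R) :
  (forall U : set R, open U -> measurable (f @^-1` U)) -> measurable_fun setT f.
Proof.
move=> H; apply: (measurability _ (RGenOInfty.measurableE R)) => //.
move=> /= _ [_ [a ->] <-]; rewrite setTI; apply: H.
exact: interval_open.
Qed.

Lemma cbase_quat : @cbase (quat R) (@measurable _ (mR * mR * mR * mR)%type).
Proof.
by do 3 (apply: cbase_prod; [exact: measurableX| |exact: cbaseR]);
  exact: cbaseR.
Qed.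

Lemma cbase_im : @cbase (imquat R) (@measurable _ (mR * mR * mR)%type).
Proof.
by do 2 (apply: cbase_prod; [exact: measurableX| |exact: cbaseR]);
  exact: cbaseR.
Qed.

Lemma cbase_heis : @cbase (heis R)
  (@measurable _ ((mR * mR * mR * mR) * (mR * mR * mR))%type).
Proof.
by apply: cbase_prod; [exact: measurableX|exact: cbase_quat|exact: cbase_im].
Qed.

Lemma continuous_measurable_quat (f : quat R -> R) : continuous f ->
  measurable_fun [set: (mR * mR * mR * mR)%type] f.
Proof.
move=> cf; apply: preimage_measurable => U oU.
have /continuousP/(_ _ oU) oV := cf.
by apply: (cbase_open cbase_quat measurable0 (@bigcupT_measurable _ _) oV).
Qed.

Lemma continuous_measurable_heis (f : heis R -> R) : continuous f ->
  measurable_fun [set: ((mR * mR * mR * mR) * (mR * mR * mR))%type] f.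
Proof.
move=> cf; apply: preimage_measurable => U oU.
have /continuousP/(_ _ oU) oV := cf.
by apply: (cbase_open cbase_heis measurable0 (@bigcupT_measurable _ _) oV).
Qed.

End ContinuousMeasurable.

(** * Translation invariance and linear changes of variables *)

Section Translation.
Variable R : realType.
Local Notation mR := (measurableTypeR R).
Local Notation leb := (@lebesgue_measure R).

(** The image measure agrees with Lebesgue measure on the intervals []a, b]], hence everywhere by
    uniqueness. *)
Lemma mpres_leb (v : R) : mpres leb (fun x : mR => x + v).
Proof.
have mv : measurable_fun setT (fun x : mR => x + v : mR).
  exact: measurable_funD.
split => // f mf f0.
have /= E := @ge0_integral_pushforward _ _ _ _ _ _ mv leb setT f measurableT mf
  (fun x _ => f0 x).
rewrite preimage_setT in E; rewrite -[LHS]E; apply: eq_measure_integral => A mA _.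
apply/esym; apply: (lebesgue_measure_unique (mu := pushforward leb _)) => //.
move=> _ [[a b] _ <-] /=; rewrite /pushforward.
rewrite [X in _ = leb X](_ : _ = `]a - v, b - v]%classic).
  rewrite !lebesgue_measure_itv /= !lte_fin ltrD2r; case: ifPn => // _.
  by congr EFin; ring.
apply/seteqP; split => x /=; rewrite !in_itv /=;
  by rewrite ltrBlDr lerBrDr.
Qed.

Lemma mpres_quat (v : quat R) : mpres leb_quat (fun q : quat R => q + v).
Proof.
rewrite (_ : (fun q : quat R => q + v) = fun q : quat R =>
  (q.1.1.1 + v.1.1.1, q.1.1.2 + v.1.1.2, q.1.2 + v.1.2, q.2 + v.2)); last first.
  by apply/funext => -[[[a b] c] d'].
apply: (@mpres_prod _ _ _ _ _ (prod_measure (prod_measure leb leb) leb) leb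
  (fun q => (q.1.1 + v.1.1.1, q.1.2 + v.1.1.2, q.2 + v.1.2)) (fun x => x + v.2));
  last exact: mpres_leb.
apply: (@mpres_prod _ _ _ _ _ (prod_measure leb leb) leb
  (fun q => (q.1 + v.1.1.1, q.2 + v.1.1.2)) (fun x => x + v.1.2));
  last exact: mpres_leb.
apply: (@mpres_prod _ _ _ _ _ leb leb
  (fun q => (q + v.1.1.1)) (fun x => x + v.1.1.2)); exact: mpres_leb.
Qed.

Lemma mpres_im (v : imquat R) : mpres leb_im (fun q : imquat R => q + v).
Proof.
rewrite (_ : (fun q : imquat R => q + v) = fun q : imquat R =>
  (q.1.1 + v.1.1, q.1.2 + v.1.2, q.2 + v.2)); last first.
  by apply/funext => -[[a b] c].
apply: (@mpres_prod _ _ _ _ _ (prod_measure leb leb) leb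
  (fun q => (q.1 + v.1.1, q.2 + v.1.2)) (fun x => x + v.2));
  last exact: mpres_leb.
apply: (@mpres_prod _ _ _ _ _ leb leb
  (fun q => (q + v.1.1)) (fun x => x + v.1.2)); exact: mpres_leb.
Qed.

Local Notation Q4 := (mR * mR * mR * mR)%type.

Lemma measurable_quat_proj d (T : measurableType d) (s : T -> Q4) :
  measurable_fun setT s -> [/\ measurable_fun setT (fun x => (s x).1.1.1),
    measurable_fun setT (fun x => (s x).1.1.2),
    measurable_fun setT (fun x => (s x).1.2) &
    measurable_fun setT (fun x => (s x).2)].
Proof.
move=> ms; have ms1 : measurable_fun setT (fun x => (s x).1).
  exact: measurableT_comp.
have ms2 : measurable_fun setT (fun x => (s x).1.1) by exact: measurableT_comp.
by split; [exact: (measurableT_comp (f := fst))|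
  exact: (measurableT_comp (f := snd))|exact: (measurableT_comp (f := snd))|
  exact: (measurableT_comp (f := snd))].
Qed.

Lemma measurable_quat_mk d (T : measurableType d) (a b c e : T -> mR) :
  measurable_fun setT a -> measurable_fun setT b -> measurable_fun setT c ->
  measurable_fun setT e ->
  measurable_fun setT (fun x => (a x, b x, c x, e x) : Q4).
Proof. by move=> ? ? ? ?; do 3 (apply: measurable_fun_pair => //). Qed.

Lemma measurable_quatD d (T : measurableType d) (s t : T -> Q4) :
  measurable_fun setT s -> measurable_fun setT t ->
  measurable_fun setT (fun x => (s x : quat R) + (t x : quat R) : Q4).
Proof.
move=> /measurable_quat_proj[? ? ? ?] /measurable_quat_proj[? ? ? ?].
rewrite (_ : (fun x => _) = fun x => ((s x).1.1.1 + (t x).1.1.1,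
  (s x).1.1.2 + (t x).1.1.2, (s x).1.2 + (t x).1.2, (s x).2 + (t x).2)).
  by apply: measurable_quat_mk; exact: measurable_funD.
by apply/funext => x; case: (s x) => [[[? ?] ?] ?]; case: (t x) => [[[? ?] ?] ?].
Qed.

Lemma measurable_quatN d (T : measurableType d) (s : T -> Q4) :
  measurable_fun setT s -> measurable_fun setT (fun x => - (s x : quat R) : Q4).
Proof.
move=> /measurable_quat_proj[? ? ? ?].
rewrite (_ : (fun x => _) = fun x => (- (s x).1.1.1,
  - (s x).1.1.2, - (s x).1.2, - (s x).2)).
  by apply: measurable_quat_mk; exact: measurableT_comp.
by apply/funext => x; case: (s x) => [[[? ?] ?] ?].
Qed.

Lemma measurable_qmul d (T : measurableType d) (s t : T -> Q4) :
  measurable_fun setT s -> measurable_fun setT t ->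
  measurable_fun setT (fun x => @qmul R (s x) (t x) : Q4).
Proof.
move=> /measurable_quat_proj[a b c e] /measurable_quat_proj[a' b' c' e'].
rewrite (_ : (fun x => _) = fun x => (
  (s x).1.1.1 * (t x).1.1.1 - (s x).1.1.2 * (t x).1.1.2 - (s x).1.2 * (t x).1.2 - (s x).2 * (t x).2,
  (s x).1.1.1 * (t x).1.1.2 + (s x).1.1.2 * (t x).1.1.1 + (s x).1.2 * (t x).2 - (s x).2 * (t x).1.2,
  (s x).1.1.1 * (t x).1.2 - (s x).1.1.2 * (t x).2 + (s x).1.2 * (t x).1.1.1 + (s x).2 * (t x).1.1.2,
  (s x).1.1.1 * (t x).2 + (s x).1.1.2 * (t x).1.2 - (s x).1.2 * (t x).1.1.2 + (s x).2 * (t x).1.1.1)).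
  by apply: measurable_quat_mk;
    do 3 ?(apply: measurable_funB || apply: measurable_funD);
    exact: measurable_funM.
by apply/funext => x; case: (s x) => [[[? ?] ?] ?]; case: (t x) => [[[? ?] ?] ?].
Qed.

Lemma qdotE (q h : quat R) : qdot q h = q.1.1.1 * h.1.1.1 + q.1.1.2 * h.1.1.2 +
  q.1.2 * h.1.2 + q.2 * h.2.
Proof.
by case: q => [[[? ?] ?] ?]; case: h => [[[? ?] ?] ?]; rewrite /qdot /=; ring.
Qed.

Lemma measurable_qdot d (T : measurableType d) (s t : T -> Q4) :
  measurable_fun setT s -> measurable_fun setT t ->
  measurable_fun setT (fun x => @qdot R (s x) (t x)).
Proof.
move=> /measurable_quat_proj[? ? ? ?] /measurable_quat_proj[? ? ? ?].
under eq_fun do rewrite qdotE.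
by do 3 ?apply: measurable_funD; exact: measurable_funM.
Qed.

(* Both sides equal the double integral of f x * g (L y + x), because the image
   of the measure under L is translation invariant.  Choosing for f a Gaussian
   determines the Jacobian of L without any determinant. *)
Lemma linear_change (L L' : quat R -> quat R) (f g : Q4 -> \bar R) :
  measurable_fun [set: Q4] (L : Q4 -> Q4) ->
  (forall x y, L (x + y) = L x + L y) -> cancel L' L ->
  measurable_fun setT f -> (forall x, 0 <= f x)%E ->
  (forall x : quat R, f (- x) = f x) ->
  measurable_fun setT g -> (forall x, 0 <= g x)%E ->
  (\int[leb_quat]_x g (L x) * \int[leb_quat]_x f x =
   \int[leb_quat]_x g x * \int[leb_quat]_x f (L x))%E.
Proof.
move=> mL LD LK mf f0 fN mg g0.
have LN x : L (- x) = - L x.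
  have L0 : L 0 = 0 by apply: (addrI (L 0)); rewrite -LD !addr0.
  by apply/eqP; rewrite -addr_eq0 -LD addNr L0.
have mfL : measurable_fun setT (f \o L) by exact: measurableT_comp.
have mgL : measurable_fun setT (g \o L) by exact: measurableT_comp.
(* Invariance of the image measure: v is L (L' v), so the translation can be carried out before
   applying L. *)
have nu (v : quat R) (h : Q4 -> \bar R) : measurable_fun setT h -> (forall x, 0 <= h x)%E ->
    (\int[leb_quat]_x h (L x + v : quat R)%R = \int[leb_quat]_x h (L x))%E.
  move=> mh h0; rewrite -[v]LK; under eq_integral do rewrite -LD.
  apply: (mpres_quat (L' v)).2 (fun x => h (L x)) _ _ => //.
  exact: measurableT_comp.
have mpD : measurable_fun setT (fun z : Q4 * Q4 => (L z.2 : quat R) + (z.1 : quat R) : Q4).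
  apply: measurable_quatD => //; exact: measurableT_comp.
have mpB : measurable_fun setT (fun z : Q4 * Q4 => (z.1 : quat R) - (L z.2 : quat R) : Q4).
  apply: measurable_quatD => //; apply: measurable_quatN.
  exact: measurableT_comp.
transitivity (\int[leb_quat]_x \int[leb_quat]_y (f x * g (L y + (x : quat R) : quat R)%R))%E.
  rewrite muleC -ge0_integralZr//; last exact: integral_ge0.
  apply: eq_integral => x _.
  rewrite ge0_integralZl//; last exact: (measurableT_comp mg (measurableT_comp mpD (measurable_pair1 x))).
  by rewrite nu.
have mF : measurable_fun setT (fun z : Q4 * Q4 => f z.1 * g (L z.2 + (z.1 : quat R) : quat R)%R)%E.
  apply: emeasurable_funM; first exact: measurableT_comp.
  exact: measurableT_comp.
rewrite (fubini_tonelli (m1 := leb_quat) (m2 := leb_quat) (fun z : Q4 * Q4 => f z.1 * g (L z.2 + (z.1 : quat R) : quat R)%R))%E//; last first.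
  by move=> z; exact: mule_ge0.
transitivity (\int[leb_quat]_y \int[leb_quat]_x (f ((x : quat R) - L y)%R * g x))%E.
  apply: eq_integral => y _.
  rewrite -((mpres_quat (- L y)).2 (fun x => f x * g (L y + (x : quat R) : quat R)%R)%E).
  - by apply: eq_integral => x _; rewrite [(L y + _)%R]addrC subrK.
  - exact: (measurableT_comp mF (measurable_pair2 y)).
  - by move=> x; exact: mule_ge0.
rewrite -(fubini_tonelli (m1 := leb_quat) (m2 := leb_quat) (fun z : Q4 * Q4 => f ((z.1 : quat R) - L z.2)%R * g z.1))%E//; last 2 first.
- apply: emeasurable_funM; first exact: measurableT_comp.
  exact: measurableT_comp.
- by move=> z; exact: mule_ge0.
rewrite -ge0_integralZr//; last exact: integral_ge0.
apply: eq_integral => x _ /=; rewrite ge0_integralZr//; last first.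
  exact: (measurableT_comp mf (measurableT_comp mpB (measurable_pair1 x))).
rewrite muleC; congr (_ * _)%E.
(* Evenness of f turns x - L y into L y - x, a translate of L y. *)
rewrite -(nu (- x : quat R) f)//; apply: eq_integral => y _.
by rewrite -[RHS]fN opprD opprK addrC.
Qed.

End Translation.

#[global] Arguments leb_quat {R} : simpl never.
#[global] Arguments leb_im {R} : simpl never.
#[global] Arguments leb_heis {R} : simpl never.

(** * Quaternions and Gaussian integrals on R^4 *)

Section QuaternionAlgebra.
Variable R : realType.
Implicit Types (q h v : quat R) (r : R).

Lemma quat_addE q h : q + h =
  (q.1.1.1 + h.1.1.1, q.1.1.2 + h.1.1.2, q.1.2 + h.1.2, q.2 + h.2).
Proof. by case: q => [[[? ?] ?] ?]; case: h => [[[? ?] ?] ?]. Qed.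

Lemma quat_scaleE r q : r *: q = (r * q.1.1.1, r * q.1.1.2, r * q.1.2, r * q.2).
Proof. by case: q => [[[? ?] ?] ?]. Qed.

Lemma quat_oppE q : - q = (- q.1.1.1, - q.1.1.2, - q.1.2, - q.2).
Proof. by case: q => [[[? ?] ?] ?]. Qed.

Lemma qdotC q h : qdot q h = qdot h q.
Proof. by rewrite !qdotE; ring. Qed.

Lemma qdotDl q h v : qdot (q + h) v = qdot q v + qdot h v.
Proof. by rewrite !qdotE quat_addE /=; ring. Qed.

Lemma qdotZl r q v : qdot (r *: q) v = r * qdot q v.
Proof. by rewrite !qdotE quat_scaleE /=; ring. Qed.

Lemma qdotNl q v : qdot (- q) v = - qdot q v.
Proof. by rewrite !qdotE quat_oppE /=; ring. Qed.

Lemma qdotDr q h v : qdot v (q + h) = qdot v q + qdot v h.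
Proof. by rewrite !(qdotC v) qdotDl. Qed.

Lemma qdotZr r q v : qdot v (r *: q) = r * qdot v q.
Proof. by rewrite !(qdotC v) qdotZl. Qed.

Lemma qdotNr q v : qdot v (- q) = - qdot v q.
Proof. by rewrite !(qdotC v) qdotNl. Qed.

Lemma qdot0l v : qdot 0 v = 0.
Proof. by rewrite qdotE /=; ring. Qed.

Definition qdotLE := (qdotDl, qdotDr, qdotNl, qdotNr, qdotZl, qdotZr).

Lemma qdot_ge0 q : 0 <= qdot q q.
Proof. by rewrite qdotE -!expr2 !addr_ge0 ?sqr_ge0. Qed.

Lemma qabs_sqr q : qabs q ^+ 2 = qdot q q.
Proof. by rewrite /qabs sqr_sqrtr ?qdot_ge0. Qed.

Lemma qmulDl q h v : qmul (q + h) v = qmul q v + qmul h v.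
Proof.
case: q => [[[? ?] ?] ?]; case: h => [[[? ?] ?] ?]; case: v => [[[? ?] ?] ?].
by rewrite /qmul !quat_addE /=; congr (_, _, _, _); ring.
Qed.

Lemma qmulZl r q v : qmul (r *: q) v = r *: qmul q v.
Proof.
case: q => [[[? ?] ?] ?]; case: v => [[[? ?] ?] ?].
by rewrite /qmul !quat_scaleE /=; congr (_, _, _, _); ring.
Qed.

Lemma qmulDr q h v : qmul v (q + h) = qmul v q + qmul v h.
Proof.
case: q => [[[? ?] ?] ?]; case: h => [[[? ?] ?] ?]; case: v => [[[? ?] ?] ?].
by rewrite /qmul !quat_addE /=; congr (_, _, _, _); ring.
Qed.

Lemma qmulZr r q v : qmul v (r *: q) = r *: qmul v q.
Proof.
case: q => [[[? ?] ?] ?]; case: v => [[[? ?] ?] ?].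
by rewrite /qmul !quat_scaleE /=; congr (_, _, _, _); ring.
Qed.

Lemma qmulA q h v : qmul q (qmul h v) = qmul (qmul q h) v.
Proof.
case: q => [[[? ?] ?] ?]; case: h => [[[? ?] ?] ?]; case: v => [[[? ?] ?] ?].
by rewrite /qmul /=; congr (_, _, _, _); ring.
Qed.

Lemma qdot_qmul q h v : qdot (qmul q v) (qmul h v) = qdot q h * qdot v v.
Proof.
case: q => [[[? ?] ?] ?]; case: h => [[[? ?] ?] ?]; case: v => [[[? ?] ?] ?].
by rewrite !qdotE /qmul /=; ring.
Qed.

Lemma qdot_qmull q h v : qdot (qmul v q) (qmul v h) = qdot v v * qdot q h.
Proof.
case: q => [[[? ?] ?] ?]; case: h => [[[? ?] ?] ?]; case: v => [[[? ?] ?] ?].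
by rewrite !qdotE /qmul /=; ring.
Qed.

End QuaternionAlgebra.

Section ComplexStructure.
Variable R : realType.
Variable a : imquat R.
Hypothesis a0 : a <> 0.
Implicit Types (q h v : quat R) (r : R).

Lemma imabs_sqr (b : imquat R) : imabs b ^+ 2 = imdot b b.
Proof. by rewrite /imabs qabs_sqr. Qed.

Lemma imabs_ge0 (b : imquat R) : 0 <= imabs b.
Proof. exact: sqrtr_ge0. Qed.

Lemma imabs_gt0 : 0 < imabs a.
Proof.
rewrite lt_neqAle imabs_ge0 andbT eq_sym; apply/eqP => h; apply: a0.
have := imabs_sqr a; rewrite h expr0n /= /imdot qdotE.
case: a => [[a1 a2] a3] /= /esym /eqP.
rewrite mulr0 add0r -!expr2 !paddr_eq0 ?addr_ge0 ?sqr_ge0 // !sqrf_eq0.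
by case/andP => /andP[/eqP -> /eqP ->] /eqP ->.
Qed.

Definition unit_dir : quat R := quat_of_im ((imabs a)^-1 *: a).
Local Notation u := unit_dir.
Local Notation J := (qrot a).

Lemma unit_dir_re : u.1.1.1 = 0.
Proof. by rewrite /unit_dir; case: (_ *: a) => [[? ?] ?]. Qed.

Lemma unit_dirE : u = (imabs a)^-1 *: quat_of_im a.
Proof.
rewrite /unit_dir; case: a => [[a1 a2] a3].
by rewrite quat_scaleE /= mulr0.
Qed.

Lemma unit_dir_norm : qdot u u = 1.
Proof.
rewrite unit_dirE !qdotLE -/(imdot a a) -imabs_sqr.
by have := imabs_gt0; set r := imabs a => r0; field; rewrite gt_eqF.
Qed.

Lemma qrotE q : J q = qmul q u. Proof. by []. Qed.

Lemma qrotD q h : J (q + h) = J q + J h.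
Proof. by rewrite !qrotE qmulDl. Qed.

Lemma qrotZ r q : J (r *: q) = r *: J q.
Proof. by rewrite !qrotE qmulZl. Qed.

Lemma qdot_rot q h : qdot (J q) (J h) = qdot q h.
Proof. by rewrite !qrotE qdot_qmul unit_dir_norm mulr1. Qed.

Lemma qmul_unit_dir : qmul u u = - (1, 0, 0, 0) :> quat R.
Proof.
have := unit_dir_norm; have := unit_dir_re.
case: u => [[[x0 x1] x2] x3] /=; rewrite qdotE /= => ->.
move=> H; rewrite quat_oppE /=; congr (_, _, _, _); last 3 first.
- by ring.
- by ring.
- by ring.
by rewrite -H; ring.
Qed.

Lemma qrotK q : J (J q) = - q.
Proof.
rewrite !qrotE -qmulA qmul_unit_dir.
by case: q => [[[? ?] ?] ?]; rewrite !quat_oppE /qmul /=; congr (_, _, _, _); ring.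
Qed.

Lemma qdot_rotl q h : qdot (J q) h = - qdot q (J h).
Proof. by rewrite -(qdot_rot q (J h)) qrotK qdotNr opprK. Qed.

Lemma qdot_rot_self q : qdot (J q) q = 0.
Proof.
by have := qdot_rotl q q; rewrite [in RHS]qdotC => /eqP; rewrite -addr_eq0
  -mulr2n mulrn_eq0 /= => /eqP.
Qed.

End ComplexStructure.

Section Gauss.
Variable R : realType.
Local Notation mR := (measurableTypeR R).
Local Notation leb := (@lebesgue_measure R).
Local Notation Q4 := (mR * mR * mR * mR)%type.

Definition gauss (e : R) (q : quat R) : R := expR (- (e * qdot q q)).

Lemma gauss_ge0 e q : 0 <= gauss e q. Proof. exact: expR_ge0. Qed.
Lemma gauss_le1 e q : 0 <= e -> gauss e q <= 1.
Proof.
by move=> e0; rewrite -[leRHS]expR0 ler_expR oppr_le0 mulr_ge0 ?qdot_ge0.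
Qed.

Lemma measurable_gauss e : measurable_fun [set: Q4] (gauss e).
Proof.
apply: measurableT_comp => //; apply: measurableT_comp => //.
by apply: measurable_funM => //; exact: measurable_qdot.
Qed.

(** Up to its peak value, the integrand is the centred normal density of variance 1/(2e). *)
Lemma integral_gauss1 (e : R) : 0 < e ->
  (\int[leb]_x (expR (- (e * x ^+ 2)))%:E = (Num.sqrt (pi / e))%:E)%E.
Proof.
move=> e0; pose s : R := Num.sqrt ((e *+ 2)^-1).
have s2 : s ^+ 2 = (e *+ 2)^-1.
  by rewrite sqr_sqrtr// invr_ge0 mulrn_wge0// ltW.
have s0 : s != 0.
  by rewrite gt_eqF// sqrtr_gt0 invr_gt0 mulrn_wgt0.
have s22 : s ^+ 2 *+ 2 = e^-1.
  rewrite s2 -mulr_natr -(mulr_natr e) invfM -mulrA mulVf ?mulr1//.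
have pk : normal_peak s = (Num.sqrt (pi / e))^-1.
  by rewrite /normal_peak -mulrnAl s22 mulrC.
have := integral_normal_pdf 0 s; rewrite (normal_pdfE _ s0) => H.
have pe : 0 < Num.sqrt (pi / e) by rewrite sqrtr_gt0 divr_gt0 ?pi_gt0.
rewrite -[RHS]mule1 -H -ge0_integralZl//; last 2 first.
- apply/measurable_EFinP; apply: measurable_funM => //.
  exact: measurable_normal_fun.
- move=> x _; rewrite lee_fin mulr_ge0 ?expR_ge0//; exact: normal_peak_ge0.
apply: eq_integral => x _; rewrite -EFinM; congr EFin.
rewrite pk mulVKf ?gt_eqF// /normal_fun subr0 s22 invrK.
by rewrite mulrC mulNr.
Qed.

Lemma ge0_integral_prodM d1 d2 (T1 : measurableType d1) (T2 : measurableType d2)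
  (m1 : {sigma_finite_measure set T1 -> \bar R})
  (m2 : {sigma_finite_measure set T2 -> \bar R}) (u : T1 -> R) (v : T2 -> R) :
  measurable_fun setT u -> measurable_fun setT v ->
  (forall x, 0 <= u x) -> (forall x, 0 <= v x) ->
  (\int[prod_measure m1 m2]_z (u z.1 * v z.2)%:E =
   \int[m1]_x (u x)%:E * \int[m2]_y (v y)%:E)%E.
Proof.
move=> mu_ mv_ u0 v0; rewrite prod_tonelli1/=; first last.
- by move=> z; rewrite lee_fin mulr_ge0.
- apply/measurable_EFinP; apply: measurable_funM.
    exact: (measurableT_comp mu_).
  exact: (measurableT_comp mv_).
rewrite muleC -ge0_integralZl//; first last.
- by apply: integral_ge0 => y _; rewrite lee_fin.
- by move=> x _; rewrite lee_fin.
- exact/measurable_EFinP.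
apply: eq_integral => x _; rewrite muleC -ge0_integralZl//.
- exact/measurable_EFinP.
- by move=> y _; rewrite lee_fin.
- by rewrite lee_fin.
Qed.

Lemma integral_gauss (e : R) : 0 < e ->
  (\int[leb_quat]_q (gauss e q)%:E = ((pi / e) ^+ 2)%:E)%E.
Proof.
move=> e0; pose g (x : mR) := expR (- (e * x ^+ 2)).
have g0 x : 0 <= g x by exact: expR_ge0.
have mg : measurable_fun setT g.
  apply: measurableT_comp => //; apply: measurableT_comp => //.
  exact: measurable_funM.
have E (q : Q4) : gauss e q = g q.1.1.1 * g q.1.1.2 * g q.1.2 * g q.2.
  by rewrite /gauss /g -!expRD qdotE; congr expR; ring.
under eq_integral do rewrite E.
have m2 : measurable_fun setT (fun z : mR * mR => g z.1 * g z.2).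
  by apply: measurable_funM; exact: (measurableT_comp mg).
have m3 : measurable_fun setT (fun z : mR * mR * mR => g z.1.1 * g z.1.2 * g z.2).
  apply: measurable_funM; last exact: (measurableT_comp mg).
  exact: (measurableT_comp m2).
rewrite (@ge0_integral_prodM _ _ _ _ (prod_measure (prod_measure leb leb) leb)
  leb (fun z : mR * mR * mR => g z.1.1 * g z.1.2 * g z.2) g)//; last first.
  by move=> x; rewrite !mulr_ge0.
rewrite (@ge0_integral_prodM _ _ _ _ (prod_measure leb leb)
  leb (fun z : mR * mR => g z.1 * g z.2) g)//; last first.
  by move=> x; rewrite !mulr_ge0.
rewrite (@ge0_integral_prodM _ _ _ _ leb leb g g)// integral_gauss1//.
rewrite -!EFinM; congr EFin.
have pe : 0 <= pi / e by rewrite divr_ge0 ?pi_ge0// ltW.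
by rewrite -mulrA -!expr2 sqr_sqrtr.
Qed.

Lemma integrable_gauss (e : R) : 0 < e ->
  leb_quat.-integrable setT (EFin \o gauss e).
Proof.
move=> e0; apply/integrableP; split.
  by apply/measurable_EFinP; exact: measurable_gauss.
under eq_integral do rewrite /= ger0_norm ?gauss_ge0//.
by rewrite integral_gauss// ltry.
Qed.

Lemma measurable_rot (a : imquat R) :
  measurable_fun [set: Q4] (qrot a : Q4 -> Q4).
Proof. by apply: measurable_qmul => //; exact: measurable_cst. Qed.

Lemma measurable_quatZ d (T : measurableType d) (c : T -> mR) (s : T -> Q4) :
  measurable_fun setT c -> measurable_fun setT s ->
  measurable_fun setT (fun x => (c x : R) *: (s x : quat R) : Q4).
Proof.
move=> mc /measurable_quat_proj[? ? ? ?].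
under eq_fun do rewrite quat_scaleE.
by apply: measurable_quat_mk; exact: measurable_funM.
Qed.

Lemma mule_cancelr (c : R) (x y : \bar R) : 0 < c ->
  (x * c%:E = y * c%:E)%E -> x = y.
Proof.
move=> c0 H; have := congr1 (fun z => z * (c^-1)%:E)%E H.
by rewrite /= -!muleA -!EFinM divff ?gt_eqF// !mule1.
Qed.

(** In [linear_change] the standard Gaussian is invariant under L, so the same finite nonzero factor
    stands on both sides and cancels. *)
Lemma mpres_isometry (L L' : quat R -> quat R) :
  measurable_fun [set: Q4] (L : Q4 -> Q4) ->
  (forall x y, L (x + y) = L x + L y) -> cancel L' L ->
  (forall x, qdot (L x) (L x) = qdot x x) -> mpres leb_quat L.
Proof.
move=> mL LD LK LI; split => // f mf f0.
have mg : measurable_fun setT (EFin \o gauss 1 : Q4 -> \bar R).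
  by apply/measurable_EFinP; exact: measurable_gauss.
have /= := @linear_change R L L' (EFin \o gauss 1) f mL LD LK mg _ _ mf f0.
have -> : (\int[leb_quat]_x (gauss 1 (L x))%:E = \int[leb_quat]_x (gauss 1 x)%:E)%E.
  by apply: eq_integral => x _; rewrite /gauss LI.
have g0 : (0 < (pi / 1 : R) ^+ 2)%R by rewrite exprn_gt0// divr_gt0 ?pi_gt0.
rewrite !integral_gauss// => H.
have {}H := H (fun x => ltac:(by rewrite lee_fin gauss_ge0))
  (fun x => ltac:(by rewrite /gauss qdotNl qdotNr opprK)).
by apply: (mule_cancelr g0).
Qed.

(** The Jacobian is the ratio of the Gaussian integrals with parameters r^2 and 1, again through
    [linear_change]. *)
Lemma integral_quat_scale (r : R) (f : Q4 -> \bar R) : 0 < r ->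
  measurable_fun setT f -> (forall x, 0 <= f x)%E ->
  (\int[leb_quat]_q f (r *: (q : quat R) : quat R)%R =
   (r ^- 4)%:E * \int[leb_quat]_q f q)%E.
Proof.
move=> r0 mf f0.
have mL : measurable_fun [set: Q4] (fun q : Q4 => r *: (q : quat R) : Q4).
  by apply: measurable_quatZ => //; exact: measurable_cst.
have mg : measurable_fun setT (EFin \o gauss 1 : Q4 -> \bar R).
  by apply/measurable_EFinP; exact: measurable_gauss.
have /= := @linear_change R ( *:%R r) ( *:%R r^-1) (EFin \o gauss 1) f mL
  (fun x y => scalerDr r x y) (scalerKV (lt0r_neq0 r0)) mg.
have -> : (\int[leb_quat]_x (gauss 1 (r *: (x : quat R)))%:E = \int[leb_quat]_x (gauss (r ^+ 2) x)%:E)%E.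
  by apply: eq_integral => x _; rewrite /gauss !qdotLE mul1r expr2 mulrA.
rewrite !integral_gauss ?exprn_gt0// => H.
have {}H := H (fun x => ltac:(by rewrite lee_fin gauss_ge0))
  (fun x => ltac:(by rewrite /gauss qdotNl qdotNr opprK)) mf f0.
have g0 : (0 < (pi / 1 : R) ^+ 2)%R by rewrite exprn_gt0// divr_gt0 ?pi_gt0.
apply: (mule_cancelr g0); rewrite H [RHS]muleAC [LHS]muleC; congr (_ * _)%E.
rewrite -EFinM; congr EFin.
by rewrite divr1 exprMn exprVn -exprM mulrC.
Qed.

End Gauss.

#[global] Arguments qdot : simpl never.
#[global] Arguments qmul : simpl never.
#[global] Arguments qrot : simpl never.

(** * Mean value property *)

Lemma integrable_indic_lty d (T : measurableType d) (R : realType)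
  (mu : {measure set T -> \bar R}) (D : set T) : measurable D ->
  (mu D < +oo)%E -> mu.-integrable setT (EFin \o (\1_D : T -> R)).
Proof.
move=> mD Doo; apply/integrableP; split.
  by apply/measurable_EFinP; exact: measurable_indic.
under eq_integral do rewrite /= ger0_norm//.
by rewrite integral_indic// setIT.
Qed.

Lemma integrable_mulrl d (T : measurableType d) (R : realType)
  (mu : {measure set T -> \bar R}) (h : T -> R) (r : R) :
  mu.-integrable setT (EFin \o h) ->
  mu.-integrable setT (EFin \o (fun x => r * h x)).
Proof.
move=> ih; rewrite (_ : _ \o _ = (fun x => r%:E * (EFin \o h) x)%E)//.
exact: integrableZl.
Qed.

Section CurveDerivatives.
Variable R : realType.
Variable V : normedModType R.

Lemma is_derive_scalel (c : R -> R) (d t : R) (v : V) :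
  is_derive t 1 c d -> is_derive t 1 (fun s => c s *: v) (d *: v).
Proof.
move=> [dc cE]; have dfc : differentiable c t by exact/derivable1_diffP.
have dfs := differentiableZl v dfc.
apply: DeriveDef; first exact/derivable1_diffP.
by rewrite deriveE// diffZl//= -cE deriveE.
Qed.

Lemma is_derive_comp_curve (f : V -> R) (g : R -> V) (t : R) (v : V) :
  differentiable f (g t) -> is_derive t 1 g v ->
  is_derive t 1 (fun s => f (g s)) ('D_v f (g t)).
Proof.
move=> df [dg gE]; have dfg : differentiable g t by exact/derivable1_diffP.
have dd : differentiable (f \o g) t by exact: differentiable_comp.
apply: DeriveDef; first exact/derivable1_diffP.
by rewrite deriveE// diff_comp//= deriveE// -gE deriveE.
Qed.

Lemma derive_lin2 (f : V -> R) (x : V) (c1 c2 : R) (v1 v2 : V) :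
  differentiable f x ->
  'D_(c1 *: v1 + c2 *: v2) f x = c1 * 'D_v1 f x + c2 * 'D_v2 f x.
Proof. by move=> df; rewrite !deriveE// linearD !linearZ. Qed.

Lemma FTC_is_derive (f F : R -> R) (a b : R) : a < b ->
  (forall x : R, is_derive x 1 F (f x)) -> continuous f ->
  \int[lebesgue_measure]_(x in `[a, b]) f x = F b - F a.
Proof.
move=> ab dF cf; rewrite /Rintegral (@continuous_FTC2 _ f F)//.
- exact: continuous_subspaceT.
- have cF x : {for x, continuous F}.
    by apply/differentiable_continuous/derivable1_diffP; exact: ex_derive.
  split => //; first exact/cvg_at_right_filter/cF.
  exact/cvg_at_left_filter/cF.
- by move=> x _; rewrite derive1E; exact: derive_val.
Qed.

(** A continuous function is bounded on the compact rectangle; extended by zero through indicators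
    it is integrable on the plane, where Fubini applies. *)
Lemma rectangle_fubini (h : R * R -> R) (a b c e : R) : continuous h ->
  \int[lebesgue_measure]_(x in `[a, b]) \int[lebesgue_measure]_(y in `[c, e]) h (x, y)
  = \int[lebesgue_measure]_(y in `[c, e]) \int[lebesgue_measure]_(x in `[a, b]) h (x, y).
Proof.
move=> ch; pose A : set R := `[a, b]%classic; pose B : set R := `[c, e]%classic.
have mA : measurable (A : set (measurableTypeR R)) by exact: measurable_itv.
have mB : measurable (B : set (measurableTypeR R)) by exact: measurable_itv.
pose k (z : measurableTypeR R * measurableTypeR R) : R := \1_A z.1 * \1_B z.2 * h z.
have mh : measurable_fun [set: (measurableTypeR R * measurableTypeR R)%type] h.
  apply: preimage_measurable => U oU.
  have /continuousP/(_ _ oU) oV := ch.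
  have cb : cbase (@measurable _ (measurableTypeR R * measurableTypeR R)%type).
    by apply: cbase_prod; [exact: measurableX|exact: cbaseR|exact: cbaseR].
  exact: (cbase_open cb measurable0 (@bigcupT_measurable _ _) oV).
have m1A : measurable_fun setT (\1_A : measurableTypeR R -> R) by exact: measurable_indic.
have m1B : measurable_fun setT (\1_B : measurableTypeR R -> R) by exact: measurable_indic.
have mk : measurable_fun setT k.
  apply: measurable_funM => //; apply: measurable_funM.
    exact: (measurableT_comp m1A).
  exact: (measurableT_comp m1B).
have [M M0 hM] : exists2 M, 0 <= M & forall z, A z.1 -> B z.2 -> `|h z| <= M.
  have cAB : compact (A `*` B : set (R * R)).
    by apply: compact_setX; exact: segment_compact.
  have := continuous_compact (continuous_subspaceT ch) cAB.
  move=> /compact_bounded[M [_ Mh]]; exists (`|M| + 1); first by rewrite addr_ge0.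
  move=> z Az Bz; apply: Mh => /=; last by exists z.
  by rewrite (le_lt_trans (ler_norm M))// ltrDl.
have lAB (x y : R) : (lebesgue_measure (`[x, y]%classic : set R) < +oo)%E.
  by rewrite lebesgue_measure_itv /=; case: ifP => _; rewrite ?ltry// -EFinD ltry.
have iA : lebesgue_measure.-integrable setT (EFin \o (\1_A : measurableTypeR R -> R)).
  by apply: integrable_indic_lty => //; exact: lAB.
have iB : lebesgue_measure.-integrable setT (EFin \o (\1_B : measurableTypeR R -> R)).
  by apply: integrable_indic_lty => //; exact: lAB.
have iMB : lebesgue_measure.-integrable setT (EFin \o (fun y : measurableTypeR R => M * \1_B y)).
  rewrite (_ : _ \o _ = (fun x => M%:E * (EFin \o \1_B) x)%E)//.
  exact: integrableZl.
have kle (z : measurableTypeR R * measurableTypeR R) : `|k z| <= \1_A z.1 * (M * \1_B z.2).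
  rewrite /k !normrM !indicE; case: (boolP (z.1 \in A)); case: (boolP (z.2 \in B));
    rewrite ?normr0 ?normr1 ?mul0r ?mulr0 ?mul0r// => /set_mem zB /set_mem zA.
  by rewrite !mul1r mulr1 hM.
have iK : (prod_measure lebesgue_measure lebesgue_measure).-integrable setT (EFin \o k).
  exact: (le_Rintegral_of_integrable mk (integrable_prodM iA iMB) kle).
have K1 x : lebesgue_measure.-integrable setT (EFin \o (fun y => k (x, y))).
  have mkx : measurable_fun setT (fun y => k (x, y)) by exact: (measurableT_comp mk).
  apply: (le_Rintegral_of_integrable mkx iMB) => y.
   rewrite (le_trans (kle _))//= indicE; case: (_ \in _).
    by rewrite mul1r.
  by rewrite mul0r mulr_ge0.
have iMA : lebesgue_measure.-integrable setT (EFin \o (fun y : measurableTypeR R => M * \1_A y)).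
  rewrite (_ : _ \o _ = (fun x => M%:E * (EFin \o \1_A) x)%E)//.
  exact: integrableZl.
have K2 y : lebesgue_measure.-integrable setT (EFin \o (fun x => k (x, y))).
  have mkx : measurable_fun setT (fun x => k (x, y)) by exact: (measurableT_comp mk).
  apply: (le_Rintegral_of_integrable mkx iMA) => x.
   rewrite (le_trans (kle _))//= mulrC -mulrA [\1_B _ * _]mulrC mulrA.
  rewrite [X in _ * X]indicE; case: (_ \in _).
    by rewrite mulr1.
  by rewrite mulr0 mulr_ge0.
have rE (D : set R) (g : R -> R) : \int[lebesgue_measure]_(x in D) g x =
    \int[lebesgue_measure]_x (\1_D x * g x).
  rewrite Rintegral_mkcond; apply: eq_Rintegral => x _.
  rewrite /patch indicE; case: (_ \in _); first by rewrite mul1r.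
  by rewrite mul0r.
transitivity (\int[lebesgue_measure]_x \int[lebesgue_measure]_y k (x, y)).
  rewrite rE; apply: eq_Rintegral => x _; rewrite rE; rewrite indicE.
  case: (boolP (x \in A)) => xA; rewrite ?mul1r ?mul0r; last first.
    rewrite [RHS](_ : _ = \int[lebesgue_measure]_y (cst 0 y : R)).
      by rewrite /Rintegral integral0.
    apply: eq_Rintegral => y _; rewrite /k /= indicE (negbTE xA).
    by rewrite mul0r mul0r.
  by apply: eq_Rintegral => y _; rewrite /k /= [\1_A _]indicE xA mul1r.
rewrite -[LHS](Rfubini1 iK K1) [LHS](Rfubini2 iK K2).
rewrite [RHS]rE; apply: eq_Rintegral => y _; rewrite [in RHS]rE; rewrite [in RHS]indicE.
case: (boolP (y \in B)) => yB; rewrite ?mul1r ?mul0r; last first.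
  rewrite [LHS](_ : _ = \int[lebesgue_measure]_y (cst 0 y : R)).
    by rewrite /Rintegral integral0.
  apply: eq_Rintegral => x _; rewrite /k /= [\1_B _]indicE (negbTE yB).
  by rewrite mulr0 mul0r.
by apply: eq_Rintegral => x _; rewrite /k /= [\1_B _]indicE yB mulr1.
Qed.

End CurveDerivatives.

Section MeanValue.
Variable R : realType.
Variable a : imquat R.
Hypothesis a0 : a <> 0.
Local Notation J := (qrot a).
Local Notation mR := (measurableTypeR R).
Local Notation leb := (@lebesgue_measure R).
Local Notation Q4 := (mR * mR * mR * mR)%type.

(** Right multiplication by e^{tu}, with u = [unit_dir a]: the scalar e^{it} of the complex
    structure. *)
Definition rot_by (t : R) (q : quat R) : quat R := cos t *: q + sin t *: J q.

Lemma rotD t p q : rot_by t (p + q) = rot_by t p + rot_by t q.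
Proof. by rewrite /rot_by qrotD !scalerDr addrACA. Qed.

Lemma qrot_rot t q : J (rot_by t q) = - sin t *: q + cos t *: J q.
Proof.
by rewrite /rot_by qrotD !qrotZ (qrotK a0) scalerN addrC scaleNr.
Qed.

Lemma rot_norm t q : qdot (rot_by t q) (rot_by t q) = qdot q q.
Proof.
rewrite /rot_by !qdotLE (qdot_rot a0) (qdot_rot_self a0) (qdotC q) (qdot_rot_self a0).
by rewrite -[RHS]mul1r -(cos2Dsin2 t); ring.
Qed.

Lemma rotK t : cancel (rot_by (- t)) (rot_by t).
Proof.
move=> q; rewrite {1}/rot_by qrot_rot /rot_by cosN sinN opprK !scalerDr !scalerA.
rewrite addrACA -!scalerDl mulrN [sin t * cos t]mulrC addNr scale0r addr0.
by rewrite -!expr2 cos2Dsin2 scale1r.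
Qed.

Lemma measurable_rot2 d (T : measurableType d) (t : T -> mR) (s : T -> Q4) :
  measurable_fun setT t -> measurable_fun setT s ->
  measurable_fun setT (fun x => rot_by (t x) (s x) : Q4).
Proof.
move=> mt ms; apply: measurable_quatD; apply: measurable_quatZ => //.
- apply: (measurableT_comp (f := @cos R)) => //.
  by apply: continuous_measurable_fun; exact: continuous_cos.
- apply: (measurableT_comp (f := @sin R)) => //.
  by apply: continuous_measurable_fun; exact: continuous_sin.
- by apply: measurable_qmul => //; exact: measurable_cst.
Qed.

Lemma mpres_rot t : mpres leb_quat (rot_by t).
Proof.
apply: (@mpres_isometry R _ (rot_by (- t))).
- by apply: measurable_rot2 => //; exact: measurable_cst.
- exact: rotD.
- exact: rotK.
- exact: rot_norm.
Qed.

(** A pair of conjugate functions: (Re F, Im F) and (Im F, - Re F) for holomorphic F both satisfy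
    the Cauchy-Riemann relation [UW], which yields the mean value of each part. *)
Variables U W : quat R -> R.
Hypothesis dU : forall q, differentiable U q.
Hypothesis dW : forall q, differentiable W q.
Hypothesis cU : forall h, continuous ('D_h U).
Hypothesis UW : forall h q, 'D_h U q = 'D_(J h) W q.

(** Replaces a direction that varies with t by two fixed ones, so that continuity of each ['D_h U]
    gives joint continuity of the integrand in (r, t). *)
Lemma derive_rot_expand (r t : R) (q : quat R) :
  'D_(rot_by t q) U (r *: rot_by t q) =
  cos t * 'D_q U (r *: rot_by t q) + sin t * 'D_(J q) U (r *: rot_by t q).
Proof. exact: derive_lin2. Qed.

Lemma rot_continuous q : continuous (fun t => rot_by t q).
Proof.
move=> t; apply: cvgD; apply: cvgZr_tmp; [exact: continuous_cos|
  exact: continuous_sin].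
Qed.

(* The derivative of the circle average with respect to the radius is, by the
   Cauchy-Riemann equations, the integral of an angular derivative, hence zero. *)
Lemma circle_mean q :
  \int[leb]_(t in `[0, pi *+ 2]) U (rot_by t q) = pi *+ 2 * U 0.
Proof.
pose phi (z : R * R) := 'D_(rot_by z.2 q) U (z.1 *: rot_by z.2 q).
have cphi : continuous phi.
  have crr : continuous (fun z : R * R => z.1 *: rot_by z.2 q).
    move=> z; apply: cvgZ; first exact: cvg_fst.
    exact: (@continuous_comp _ _ _ snd (fun t => rot_by t q) z cvg_snd (@rot_continuous q _)).
  have -> : phi = fun z => cos z.2 * 'D_q U (z.1 *: rot_by z.2 q) +
      sin z.2 * 'D_(J q) U (z.1 *: rot_by z.2 q).
    by apply/funext => z; rewrite /phi derive_rot_expand.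
  move=> z; apply: cvgD; apply: cvgM.
  - exact: (@continuous_comp _ _ _ snd cos z cvg_snd (@continuous_cos R _)).
  - exact: (cvg_comp _ _ (crr z) (@cU q _)).
  - exact: (@continuous_comp _ _ _ snd sin z cvg_snd (@continuous_sin R _)).
  - exact: (cvg_comp _ _ (crr z) (@cU (J q) _)).
have pi2 : 0 < pi *+ 2 :> R by rewrite mulrn_wgt0// pi_gt0.
have cphi1 t : continuous (fun r => phi (r, t)).
  move=> r; apply: (cvg_comp (fun r => (r, t)) phi); last exact: cphi.
  exact: (cvg_pair cvg_id (cvg_cst _)).
have cphi2 r : continuous (fun t => phi (r, t)).
  move=> t; apply: (cvg_comp (fun t => (r, t)) phi); last exact: cphi.
  exact: (cvg_pair (cvg_cst _) cvg_id).
have rad t : \int[leb]_(r in `[0, 1]) phi (r, t) = U (rot_by t q) - U 0.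
  have dr (r : R) : is_derive r 1 (fun r : R => U (r *: rot_by t q)) (phi (r, t)).
    apply: (is_derive_comp_curve (g := fun r : R => r *: rot_by t q)) => //.
    rewrite -[X in is_derive _ _ _ X]scale1r.
    exact: (is_derive_scalel (rot_by t q) (is_derive_id r 1)).
  by rewrite (FTC_is_derive ltr01 dr (cphi1 t)) scale1r scale0r.
(* By [UW] the radial derivative of U is r^-1 times the t-derivative of W along the circle of radius
   r, and W has the same value at both ends of the period. *)
have ang r : r != 0 -> \int[leb]_(t in `[0, pi *+ 2]) phi (r, t) = 0.
  move=> r0.
  suff dt (t : R) : is_derive t 1 (fun t : R => r^-1 * W (r *: rot_by t q)) (phi (r, t)).
    rewrite (FTC_is_derive pi2 dt (cphi2 r)).
    by rewrite /rot_by cos2pi sin2pi cos0 sin0 subrr.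
  rewrite /phi /= UW.
  have -> : 'D_(J (rot_by t q)) W (r *: rot_by t q) =
      r^-1 *: 'D_(r *: J (rot_by t q)) W (r *: rot_by t q).
    by rewrite !deriveE// linearZ scalerA mulVf// scale1r.
  apply: is_deriveZ; apply: (is_derive_comp_curve (g := fun t => r *: rot_by t q)) => //.
  apply: is_deriveZ; rewrite qrot_rot /rot_by.
  by apply: is_deriveD; exact: is_derive_scalel.
have H := @rectangle_fubini R phi 0 1 0 (pi *+ 2) cphi.
have E0 : \int[leb]_(x in `[0, 1]) \int[leb]_(y in `[0, pi *+ 2]) phi (x, y) = 0.
  have E0 : {in `]0, 1]%classic, cst 0 =1
      fun r : R => \int[leb]_(t in `[0, pi *+ 2]) phi (r, t)}.
    move=> r; rewrite inE /= in_itv /= => /andP[r0 _].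
    by apply/esym/ang; rewrite gt_eqF.
  (* The radius 0, which [ang] excludes, is a null set. *)
  rewrite -Rintegral_itv_obnd_cbnd.
    rewrite -(eq_Rintegral leb E0).
    by rewrite /Rintegral /= integral0.
  apply: (@eq_integrable _ _ _ leb _ (measurable_itv _) (cst 0%E)).
    by move=> r /E0 /= <-.
  exact: integrable0.
have {}H : \int[leb]_(t in `[0, pi *+ 2]) (U (rot_by t q) - U 0) = 0.
  rewrite -[RHS]E0 H; apply: eq_Rintegral => t _; exact: esym (rad t).
move: H.
have iU : leb.-integrable `[0, pi *+ 2] (EFin \o (fun t => U (rot_by t q))).
  apply: continuous_compact_integrable; first exact: segment_compact.
  apply: continuous_subspaceT => t.
  apply: (@continuous_comp _ _ _ (fun t => rot_by t q) U t (@rot_continuous q t)).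
  exact: differentiable_continuous.
have iC : leb.-integrable `[0, pi *+ 2] (EFin \o (fun t : R => U 0)).
  apply: continuous_compact_integrable; first exact: segment_compact.
  by apply: continuous_subspaceT => t; exact: cvg_cst.
rewrite RintegralB// Rintegral_cst//= => /eqP; rewrite subr_eq0 => /eqP ->.
rewrite lebesgue_measure_itv /= lte_fin pi2 /= subr0 mulrC//.
Qed.

(** Each [rot_by t] preserves both the measure and the Gaussian, so U may be replaced by its average
    over t; Fubini brings that average inside, where [circle_mean] evaluates it. *)
Lemma gauss_mean (e : R) : 0 < e ->
  leb_quat.-integrable setT (EFin \o (fun q => U q * gauss e q)) ->
  \int[leb_quat]_q (U q * gauss e q) = U 0 * (pi / e) ^+ 2.
Proof.
move=> e0 iU.
have pi2 : 0 < pi *+ 2 :> R by rewrite mulrn_wgt0// pi_gt0.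
pose D : set mR := `[0, pi *+ 2]%classic.
have mD : measurable D by exact: measurable_itv.
have lD : leb D = (pi *+ 2)%:E.
  by rewrite lebesgue_measure_itv /= lte_fin pi2 sube0.
have lDoo : (leb D < +oo)%E by rewrite lD ltry.
pose k (z : mR * Q4) : R := \1_D z.1 * (U (rot_by z.1 z.2) * gauss e z.2).
have cU0 : continuous U by move=> q; exact: differentiable_continuous.
have mU := continuous_measurable_quat cU0.
have m1D : measurable_fun setT (\1_D : mR -> R) by exact: measurable_indic.
have mrot : measurable_fun setT (fun z : mR * Q4 => rot_by z.1 z.2 : Q4).
  by apply: measurable_rot2.
have mk : measurable_fun setT k.
  apply: measurable_funM; first exact: (measurableT_comp m1D).
  apply: measurable_funM; first exact: (measurableT_comp mU).
  exact: (measurableT_comp (measurable_gauss e)).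
have grot t q : gauss e (rot_by t q) = gauss e q by rewrite /gauss rot_norm.
have irot t : leb_quat.-integrable setT (EFin \o (fun q => U (rot_by t q) * gauss e q)).
  rewrite (_ : _ \o _ = (EFin \o (fun q => U q * gauss e q)) \o rot_by t); last first.
    by apply/funext => q /=; rewrite grot.
  by apply: mpres_integrable => //; exact: mpres_rot.
have mUg : measurable_fun setT (EFin \o (fun q : Q4 => U q * gauss e q)).
  exact: (measurable_int _ iU).
have Erot t : \int[leb_quat]_q (U (rot_by t q) * gauss e q) = \int[leb_quat]_q (U q * gauss e q).
  congr fine; rewrite -(mpres_integral (mpres_rot t) mUg).
  by apply: eq_integral => q _ /=; rewrite grot.
have ik : (prod_measure leb leb_quat).-integrable setT (EFin \o k).
  apply/(@integrable12ltyP _ _ _ _ _ leb leb_quat _ (proj2 (measurable_EFinP _ _) mk)) => /=.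
  have E t : (\int[leb_quat]_y `|(k (t, y))%:E| =
      (\1_D t)%:E * \int[leb_quat]_q `|(U q * gauss e q)%:E|)%E.
    rewrite -ge0_integralZl//; last first.
    - exact: measurableT_comp.
    transitivity (\int[leb_quat]_y ((\1_D t)%:E * `|(U (rot_by t y) * gauss e (rot_by t y))%:E|))%E.
      apply: eq_integral => q _; rewrite /k /= grot normrM EFinM; congr (_ * _)%E.
      by rewrite ger0_norm.
    apply: ((mpres_rot t).2 (fun q => (\1_D t)%:E * `|(U q * gauss e q)%:E|)%E).
    - by apply: measurable_funeM; exact: measurableT_comp.
    - by move=> q; rewrite mule_ge0// lee_fin.
  rewrite [ltLHS](_ : _ = \int[leb]_t ((\1_D t)%:E * \int[leb_quat]_q `|(U q * gauss e q)%:E|))%E; last first.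
    by apply: eq_integral => t _; rewrite -E; apply: eq_integral => q _.
  rewrite ge0_integralZr//; last 2 first.
  - exact/measurable_EFinP.
  - exact: integral_ge0.
  rewrite integral_indic// setIT [X in (X * _)%E](_ : _ = (pi *+ 2)%:E)//.
  by apply: lte_mul_pinfty => //; [rewrite lee_fin ltW|case/integrableP : iU].
have E1 : \int[prod_measure leb leb_quat]_z k z =
    pi *+ 2 * \int[leb_quat]_q (U q * gauss e q).
  rewrite (Rfubini1 ik (fun t => integrable_mulrl (\1_D t) (irot t))).
  transitivity (\int[leb]_t (\1_D t * \int[leb_quat]_q (U q * gauss e q))).
    by apply: eq_Rintegral => t _; rewrite -(Erot t) -RintegralZl.
  rewrite RintegralZr//; last first.
    exact: integrable_indic_lty mD lDoo.
  rewrite /Rintegral integral_indic// setIT.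
  by rewrite [X in fine X](_ : _ = (pi *+ 2)%:E).
have E2 : \int[prod_measure leb leb_quat]_z k z = pi *+ 2 * (U 0 * (pi / e) ^+ 2).
  have iq q : leb.-integrable D (EFin \o (fun t => U (rot_by t q))).
    apply: continuous_compact_integrable; first exact: segment_compact.
    apply: continuous_subspaceT => t.
    exact: (@continuous_comp _ _ _ (fun t => rot_by t q) U t (@rot_continuous q t) (cU0 _)).
  have DE (g : R -> R) : (fun t => \1_D t * g t) = g \_ D.
    by apply/funext => t; rewrite patchE indicE; case: ifP; rewrite ?mul1r ?mul0r.
  have kE q : (fun t => k (t, q)) = fun t => gauss e q * (\1_D t * U (rot_by t q)).
    by apply/funext => t; rewrite /k /=; ring.
  have iDU q : leb.-integrable setT (EFin \o (fun t => \1_D t * U (rot_by t q))).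
    rewrite DE -restrict_EFin; apply/integrable_restrict => //.
    by rewrite setTI; exact: iq.
  have i2 q : leb.-integrable setT (EFin \o (fun t => k (t, q))).
    by rewrite kE; exact: integrable_mulrl.
  rewrite (Rfubini2 ik i2).
  transitivity (\int[leb_quat]_q (pi *+ 2 * U 0 * gauss e q)).
    apply: eq_Rintegral => q _; rewrite kE RintegralZl// mulrC; congr (_ * _).
    by rewrite -(circle_mean q) [RHS]Rintegral_mkcond -DE.
  rewrite RintegralZl//; last exact: integrable_gauss.
  by rewrite /Rintegral integral_gauss// mulrA.
by apply: (mulfI (lt0r_neq0 pi2)); rewrite -E1 E2.
Qed.

End MeanValue.

(** * Holomorphic functions *)

Section HolomorphicCalculus.
Variable R : realType.

Section RealChain.
Variable V : normedModType R.

Lemma derive_chain (f : R -> R) (U : V -> R) (x v : V) (d : R) :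
  differentiable U x -> is_derive (U x) 1 f d ->
  differentiable (fun y => f (U y)) x /\
  'D_v (fun y => f (U y)) x = d * 'D_v U x.
Proof.
move=> dU [df fE]; have dfU : differentiable f (U x) by exact/derivable1_diffP.
have dd : differentiable (f \o U) x by exact: differentiable_comp.
split => //; rewrite deriveE// diff_comp//= deriveE//.
rewrite -[X in 'd f _ X]mulr1 -[_ * 1]/(_ *: 1) linearZ /= -fE deriveE//.
by rewrite mulrC.
Qed.

End RealChain.

Section ComplexDerivative.
Variable V : normedModType R.
Implicit Types (F G : V -> R[i]) (h q : V).

Lemma cderiveM F G h q : cdifferentiable F q -> cdifferentiable G q ->
  cdifferentiable (fun q => F q * G q) q /\
  cderive h (fun q => F q * G q) q = cderive h F q * G q + F q * cderive h G q.
Proof.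
move=> [f1 f2] [g1 g2].
have ReE0 : (fun y => Re (F y * G y)) =
    (fun y => Re (F y)) * (fun y => Re (G y)) - (fun y => Im (F y)) * (fun y => Im (G y)).
  by apply/funext => y; rewrite cReM.
have ImE0 : (fun y => Im (F y * G y)) =
    (fun y => Re (F y)) * (fun y => Im (G y)) + (fun y => Im (F y)) * (fun y => Re (G y)).
  by apply/funext => y; rewrite cImM.
split.
  split; rewrite ?ReE0 ?ImE0.
    by apply: differentiableB; exact: differentiableM.
  by apply: differentiableD; exact: differentiableM.
have d1 := @diff_derivable _ _ _ _ _ h f1.
have d2 := @diff_derivable _ _ _ _ _ h f2.
have d3 := @diff_derivable _ _ _ _ _ h g1.
have d4 := @diff_derivable _ _ _ _ _ h g2.
have sc (x y : R) : x *: y = x * y :> R by [].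
apply: complex_ext; rewrite /cderive ?cReE ?cImE ?ReE0 ?ImE0.
  rewrite (deriveB (derivableM d1 d3) (derivableM d2 d4)) (deriveM d1 d3) (deriveM d2 d4).
  by rewrite !sc; do 4 move: (derive _ _ _) => ?; ring.
rewrite ?cIm_mk ?cRe_mk.
rewrite (deriveD (derivableM d1 d4) (derivableM d2 d3)) (deriveM d1 d4) (deriveM d2 d3).
by rewrite !sc; do 4 move: (derive _ _ _) => ?; ring.
Qed.

Lemma cderiveD F G h q : cdifferentiable F q -> cdifferentiable G q ->
  cdifferentiable (fun q => F q + G q) q /\
  cderive h (fun q => F q + G q) q = cderive h F q + cderive h G q.
Proof.
move=> [f1 f2] [g1 g2].
have ReE0 : (fun y => Re (F y + G y)) = (fun y => Re (F y)) + (fun y => Re (G y)).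
  by apply/funext => y; rewrite cReD.
have ImE0 : (fun y => Im (F y + G y)) = (fun y => Im (F y)) + (fun y => Im (G y)).
  by apply/funext => y; rewrite cImD.
split; first by split; rewrite ?ReE0 ?ImE0; exact: differentiableD.
apply: complex_ext; rewrite /cderive ?cReE ?cImE ?ReE0 ?ImE0.
  by rewrite deriveD//; exact: diff_derivable.
by rewrite deriveD//; exact: diff_derivable.
Qed.

Lemma cderive_cst (c : R[i]) h q :
  cdifferentiable (fun _ : V => c) q /\ cderive h (fun _ : V => c) q = 0.
Proof.
split; first by split; exact: differentiable_cst.
by apply: complex_ext; rewrite /cderive /= derive_cst.
Qed.

Lemma cderive_cexp F h q : cdifferentiable F q ->
  cdifferentiable (fun q => cexp (F q)) q /\
  cderive h (fun q => cexp (F q)) q = cexp (F q) * cderive h F q.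
Proof.
move=> [f1 f2].
have [e1 e2] := derive_chain h f1 (is_derive_expR (Re (F q))).
have [c1 c2] := derive_chain h f2 (is_derive_cos (Im (F q))).
have [s1 s2] := derive_chain h f2 (is_derive_sin (Im (F q))).
split.
  by split; [exact: (differentiableM e1 c1)|exact: (differentiableM e1 s1)].
have d1 := @diff_derivable _ _ _ _ _ h e1.
have d2 := @diff_derivable _ _ _ _ _ h c1.
have d3 := @diff_derivable _ _ _ _ _ h s1.
have sc (x y : R) : x *: y = x * y :> R by [].
apply: complex_ext; rewrite /cderive ?cReE ?cImE.
  by rewrite [LHS](deriveM d1 d2) e2 c2 !sc; ring.
by rewrite [LHS](deriveM d1 d3) e2 s2 !sc; ring.
Qed.

End ComplexDerivative.

Variable a : imquat R.
Implicit Types F G : quat R -> R[i].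
Local Notation J := (qrot a).

Lemma ccontinuousD F G : ccontinuous F -> ccontinuous G ->
  ccontinuous (fun q => F q + G q).
Proof.
move=> [f1 f2] [g1 g2]; split => q.
  under eq_fun do rewrite cReD.
  by apply: continuousD; [exact: f1|exact: g1].
under eq_fun do rewrite cImD.
by apply: continuousD; [exact: f2|exact: g2].
Qed.

Lemma ccontinuousM F G : ccontinuous F -> ccontinuous G ->
  ccontinuous (fun q => F q * G q).
Proof.
move=> [f1 f2] [g1 g2]; split => q.
  under eq_fun do rewrite cReM.
  by apply: cvgB; apply: cvgM; [exact: f1|exact: g1|exact: f2|exact: g2].
under eq_fun do rewrite cImM.
by apply: cvgD; apply: cvgM; [exact: f1|exact: g2|exact: f2|exact: g1].
Qed.

Lemma ccontinuous_cst (c : R[i]) : ccontinuous (fun _ : quat R => c).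
Proof. by split => q; exact: cvg_cst. Qed.

Lemma cdifferentiable_ccontinuous F : (forall q, cdifferentiable F q) ->
  ccontinuous F.
Proof.
by move=> dF; split => q; have [d1 d2] := dF q; exact: differentiable_continuous.
Qed.

Lemma ccontinuous_cmeas F : ccontinuous F ->
  @cmeas _ (measurableTypeR R * measurableTypeR R * measurableTypeR R * measurableTypeR R)%type R F.
Proof. by move=> [f1 f2]; split; exact: continuous_measurable_quat. Qed.

Lemma holomorphic_of F (dF : quat R -> quat R -> R[i]) :
  (forall q, cdifferentiable F q) -> (forall h q, cderive h F q = dF h q) ->
  (forall h, ccontinuous (dF h)) -> (forall h q, dF (J h) q = 'i%C * dF h q) ->
  holomorphic a F.
Proof.
move=> H1 H2 H3 H4; split => //.
  by move=> h; rewrite (_ : cderive h F = dF h)//; apply/funext => q; exact: H2.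
by move=> q h; rewrite !H2.
Qed.

Lemma holomorphicM F G : holomorphic a F -> holomorphic a G ->
  holomorphic a (fun q => F q * G q).
Proof.
move=> [dF cF CF] [dG cG CG].
apply: (@holomorphic_of _ (fun h q => cderive h F q * G q + F q * cderive h G q)).
- by move=> q; have [] := cderiveM 0 (dF q) (dG q).
- by move=> h q; have [] := cderiveM h (dF q) (dG q).
- move=> h; apply: ccontinuousD; apply: ccontinuousM => //;
    exact: cdifferentiable_ccontinuous.
- by move=> h q; rewrite CF CG mulrDr; rewrite !mulrA; congr (_ + _ * _); rewrite mulrC.
Qed.

Lemma holomorphic_cst (c : R[i]) : holomorphic a (fun=> c).
Proof.
apply: (@holomorphic_of _ (fun _ _ => 0)).
- by move=> q; have [] := cderive_cst c (0 : quat R) q.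
- by move=> h q; have [] := cderive_cst c h q.
- by move=> h; exact: ccontinuous_cst.
- by move=> h q; rewrite mulr0.
Qed.

Lemma holomorphic_cexp F : holomorphic a F -> holomorphic a (fun q => cexp (F q)).
Proof.
move=> [dF cF CF].
apply: (@holomorphic_of _ (fun h q => cexp (F q) * cderive h F q)).
- by move=> q; have [] := cderive_cexp 0 (dF q).
- by move=> h q; have [] := cderive_cexp h (dF q).
- move=> h; apply: ccontinuousM => //; apply: cdifferentiable_ccontinuous.
  by move=> q; have [] := cderive_cexp 0 (dF q).
- by move=> h q; rewrite CF mulrCA.
Qed.

Lemma holomorphicX F n : holomorphic a F -> holomorphic a (fun q => F q ^+ n).
Proof.
move=> hF; elim: n => [|n ih].
  by under eq_fun do rewrite expr0; exact: holomorphic_cst.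
by under eq_fun do rewrite exprS; exact: holomorphicM.
Qed.

Lemma holomorphic_shift F w : holomorphic a F -> holomorphic a (fun q => F (q + w)).
Proof.
move=> [dF cF CF].
have dS (U : quat R -> R) q : differentiable U (q + w) ->
    differentiable (fun q => U (q + w)) q.
  move=> dU; apply: (@differentiable_comp _ _ _ _ (fun q => q + w) U) => //.
have DS (U : quat R -> R) h q : 'D_h (fun q => U (q + w)) q = 'D_h U (q + w).
  rewrite /derive.
  have -> // : (fun r : R => r^-1 *: (((fun q => U (q + w)) \o shift q) (r *: h) - U (q + w)))
    = (fun r : R => r^-1 *: ((U \o shift (q + w)) (r *: h) - U (q + w))).
  by apply/funext => r /=; rewrite addrA.
apply: (@holomorphic_of _ (fun h q => cderive h F (q + w))).
- by move=> q; have [d1 d2] := dF (q + w); split;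
    [exact: (dS (fun q => Re (F q)) q d1)|exact: (dS (fun q => Im (F q)) q d2)].
- by move=> h q; rewrite /cderive (DS (fun q => Re (F q))) (DS (fun q => Im (F q))).
- move=> h; have [c1 c2] := cF h.
  have cs : continuous (fun q : quat R => q + w).
    by move=> q; apply: continuousD; [exact: cvg_id|exact: cvg_cst].
  split => q.
    exact: (@continuous_comp _ _ _ (fun q : quat R => q + w)
      (fun y => Re (cderive h F y)) q (cs q) (c1 _)).
  exact: (@continuous_comp _ _ _ (fun q : quat R => q + w)
    (fun y => Im (cderive h F y)) q (cs q) (c2 _)).
- by move=> h q; exact: CF.
Qed.

Lemma is_diff_linear_fun (L : {linear quat R -> R}) q h :
  continuous L -> differentiable L q /\ 'D_h L q = L h.
Proof.
move=> cL; have dL : differentiable L q by exact: linear_differentiable.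
by split => //; rewrite deriveE// diff_lin.
Qed.

Lemma continuous_qdot (h : quat R) : continuous (fun q : quat R => qdot q h).
Proof.
move=> q; under eq_fun do rewrite qdotE.
have c1 : (fst : quat R -> _) @ q --> q.1 by exact: cvg_fst.
have c11 : (fun q : quat R => q.1.1) @ q --> q.1.1.
  exact: (cvg_comp _ _ c1 cvg_fst).
have c111 : (fun q : quat R => q.1.1.1) @ q --> q.1.1.1.
  exact: (cvg_comp _ _ c11 cvg_fst).
have c112 : (fun q : quat R => q.1.1.2) @ q --> q.1.1.2.
  exact: (cvg_comp _ _ c11 cvg_snd).
have c12 : (fun q : quat R => q.1.2) @ q --> q.1.2.
  exact: (cvg_comp _ _ c1 cvg_snd).
have c2 : (fun q : quat R => q.2) @ q --> q.2 by exact: cvg_snd.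
by do 3 (apply: cvgD; last by apply: cvgMr_tmp);
  apply: cvgMr_tmp.
Qed.

Lemma qdot_derive (h v q : quat R) :
  differentiable (fun q : quat R => qdot q h) q /\
  'D_v (fun q : quat R => qdot q h) q = qdot v h.
Proof.
have lin : linear (fun q : quat R => qdot q h : R).
  by move=> c x y; rewrite qdotDl qdotZl.
pose glM := GRing.isLinear.Build _ _ _ _ _ lin.
pose gL : {linear quat R -> R} := HB.pack (fun q : quat R => qdot q h : R) glM.
exact: (@is_diff_linear_fun gL q v (@continuous_qdot h)).
Qed.

(** The Hermitian form of the complex structure: linear in [q], conjugate linear in [h], with the
    Euclidean inner product as its real part. *)
Definition zeta (h q : quat R) : R[i] := qdot q h +i* qdot q (J h).

Hypothesis a0 : a <> 0.

Lemma zeta_rot h q : zeta h (J q) = 'i%C * zeta h q.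
Proof.
apply: complex_ext; rewrite /zeta ?cReE ?cImE.
  by rewrite qdot_rotl// mul0r mul1r sub0r.
by rewrite qdot_rot// mul0r mul1r add0r.
Qed.

Lemma holomorphic_zeta h : holomorphic a (zeta h).
Proof.
apply: (@holomorphic_of _ (fun v _ => zeta h v)).
- by move=> q; split; [have [] := qdot_derive h 0 q|
    have [] := qdot_derive (J h) 0 q].
- move=> v q; rewrite /cderive /zeta /=.
  by have [_ ->] := qdot_derive h v q; have [_ ->] := qdot_derive (J h) v q.
- by move=> v; exact: ccontinuous_cst.
- by move=> v q; exact: zeta_rot.
Qed.

Lemma cgauss_mean F (e : R) : 0 < e -> holomorphic a F ->
  cintegrable leb_quat (fun q => F q * (gauss e q)%:C) ->
  cintegral leb_quat (fun q => F q * (gauss e q)%:C) = F 0 * ((pi / e) ^+ 2)%:C.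
Proof.
move=> e0 [dF cF CF] [i1 i2].
have dR q : differentiable (fun q => Re (F q)) q by have [] := dF q.
have dI q : differentiable (fun q => Im (F q)) q by have [] := dF q.
have ReE0 q : Re (F q * (gauss e q)%:C) = Re (F q) * gauss e q.
  by rewrite cReM /= mulr0 subr0.
have ImE0 q : Im (F q * (gauss e q)%:C) = Im (F q) * gauss e q.
  by rewrite cImM /= mulr0 add0r.
have C1 h q : 'D_(J h) (fun q => Im (F q)) q = 'D_h (fun q => Re (F q)) q.
  by have := congr1 (@complex.Im R) (CF q h); rewrite cImM /= mul0r mul1r add0r.
have C2 h q : 'D_(J h) (fun q => Re (F q)) q = - 'D_h (fun q => Im (F q)) q.
  by have := congr1 (@complex.Re R) (CF q h); rewrite cReM /= mul0r mul1r sub0r.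
have D1 h : continuous ('D_h (fun q => Re (F q))).
  have [+ _] := cF h; rewrite (_ : (fun y => _) = 'D_h (fun q => Re (F q)))//.
have D2 h : continuous ('D_h (fun q => Im (F q))).
  have [_ +] := cF h; rewrite (_ : (fun y => _) = 'D_h (fun q => Im (F q)))//.
apply: complex_ext; rewrite ?cReE ?cImE.
  rewrite mulr0 subr0 -(@gauss_mean R a a0 (fun q => Re (F q)) (fun q => Im (F q)))//.
  - by apply: eq_Rintegral => q _.
  - by move: i1; congr (_.-integrable _ _); apply/funext => q /=; rewrite ReE0.
rewrite mulr0 add0r -(@gauss_mean R a a0 (fun q => Im (F q)) (fun q => - Re (F q)))//.
- by apply: eq_Rintegral => q _.
- by move=> q; exact: differentiableN.
- move=> h q; rewrite deriveN; last exact: diff_derivable.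
  by rewrite C2 opprK.
- by move: i2; congr (_.-integrable _ _); apply/funext => q /=; rewrite ImE0.
Qed.

End HolomorphicCalculus.

(** * Taylor expansion of the exponential and weighted L2 spaces *)

Section CexpTaylor.
Variable R : realType.
Implicit Types z : R[i].

Definition cexp_sum (N : nat) z : R[i] := \sum_(k < N) z ^+ k * (k`!%:R^-1)%:C.

Lemma cexp_neq0 z : cexp z * cexp (- z) = 1.
Proof. by rewrite -cexpD subrr cexp0. Qed.

Lemma MVT_bound (f df : R -> R) (M : R) :
  (forall t : R, is_derive t 1 f (df t)) ->
  (forall t, 0 <= t <= 1 -> `|df t| <= M) -> `|f 1 - f 0| <= M.
Proof.
move=> Df dfM.
have [c /[!in_itv] /= /andP[c0 c1]] := @MVT R f df 0 1 ltr01 (fun x _ => Df x)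
  (continuous_subspaceT (fun x => differentiable_continuous
    ((derivable1_diffP _ _).1 (@ex_derive _ _ _ _ _ _ _ (Df x))))).
by rewrite subr0 mulr1 => ->; apply: dfM; rewrite !ltW.
Qed.

Lemma cderive_line (c : R[i]) (u : R -> R) (du t : R) : is_derive t 1 u du ->
  cdifferentiable (fun t : R => c * (u t)%:C) t /\
  cderive (1 : R) (fun t : R => c * (u t)%:C) t = c * du%:C.
Proof.
move=> Du; have du' : differentiable u t by apply/derivable1_diffP; exact: ex_derive.
have [d1 e1] : cdifferentiable (fun t : R => (u t)%:C) t /\
    cderive (1 : R) (fun t : R => (u t)%:C) t = du%:C.
  split; first by split => //=; exact: differentiable_cst.
  by apply: complex_ext; rewrite /= ?derive_val// derive_cst.
have [d0 e0] := cderive_cst c (1 : R) t.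
by have [? ->] := cderiveM (1 : R) d0 d1; rewrite e0 e1 mul0r add0r.
Qed.

Definition expterm (k : nat) (t : R) : R := t ^+ k / k`!%:R.

Lemma is_derive_expterm k (t : R) :
  is_derive t 1 (expterm k) (if k is k'.+1 then expterm k' t else 0).
Proof.
case: k => [|k]; first by rewrite /expterm; under eq_fun do rewrite expr0; exact: is_derive_cst.
have k0 : k.+1%:R != 0 :> R by rewrite pnatr_eq0.
have f0 : k`!%:R != 0 :> R by rewrite pnatr_eq0 -lt0n fact_gt0.
have D := is_deriveX k.+1 (is_derive_id t (1 : R)).
have := is_deriveZ (k.+1)`!%:R^-1 D.
rewrite (_ : _ \*: _ = expterm k.+1); last first.
  by apply/funext => s; rewrite /expterm /= exprfctE mulrC.
rewrite (_ : _ *: _ = expterm k t)//.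
rewrite /expterm /GRing.scale /= !mulr1 factS natrM.
by move: (k.+1%:R) (k`!%:R) k0 f0 => A B A0 B0; field; rewrite A0 B0.
Qed.

Lemma cexp_sumE N z (t : R) :
  cexp_sum N (t%:C * z) = \sum_(k < N) z ^+ k * (expterm k t)%:C.
Proof.
rewrite /cexp_sum; apply: eq_bigr => k _.
by rewrite exprMn -rmorphXn [_ * z ^+ k]mulrC -mulrA -rmorphM.
Qed.

Lemma cderive_cexp_sum N z (t : R) :
  cdifferentiable (fun t : R => cexp_sum N.+1 (t%:C * z)) t /\
  cderive (1 : R) (fun t : R => cexp_sum N.+1 (t%:C * z)) t = z * cexp_sum N (t%:C * z).
Proof.
have E n : (fun t : R => cexp_sum n (t%:C * z)) =
    (fun t : R => \sum_(k < n) z ^+ k * (expterm k t)%:C).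
  by apply/funext => s; exact: cexp_sumE.
rewrite E cexp_sumE; elim: N => [|N [d1 e1]].
  have [] := cderive_line (z ^+ 0) (@is_derive_expterm 0 t).
  rewrite (_ : (fun t : R => _) = (fun t : R => \sum_(k < 1) z ^+ k * (expterm k t)%:C)).
    by move=> ? ->; rewrite big_ord0 !mulr0.
  by apply/funext => s; rewrite big_ord1.
have [d2 e2] := cderive_line (z ^+ N.+1) (@is_derive_expterm N.+1 t).
have [] := cderiveD (1 : R) d1 d2; rewrite e1 e2.
rewrite (_ : (fun t : R => _) = (fun t : R => \sum_(k < N.+2) z ^+ k * (expterm k t)%:C)).
  by move=> ? ->; split => //; rewrite [in RHS]big_ord_recr /= mulrDr exprS mulrA.
by apply/funext => s; rewrite [in RHS]big_ord_recr.
Qed.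

(** Differentiating a truncated exponential drops its top term, so in the product with e^{-tz} all
    terms but the top one cancel. *)
Lemma cexp_taylor_curve N z (t : R) :
  cdifferentiable (fun t : R => cexp (t%:C * - z) * cexp_sum N.+1 (t%:C * z)) t /\
  cderive (1 : R) (fun t : R => cexp (t%:C * - z) * cexp_sum N.+1 (t%:C * z)) t =
  - (cexp (t%:C * - z) * (z ^+ N.+1 * (expterm N t)%:C)).
Proof.
have [d1 e1] := cderive_cexp_sum N z t.
have [d2 e2] := cderive_line (- z) (is_derive_id t (1 : R)).
have [d3 e3] := cderive_cexp (1 : R) d2.
have [] := cderiveM (1 : R) d3 d1; rewrite e1 e3 e2.
rewrite (_ : (fun t : R => cexp (- z * t%:C) * _) =
  (fun t : R => cexp (t%:C * - z) * cexp_sum N.+1 (t%:C * z))); last first.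
  by apply/funext => s; rewrite [s%:C * - z]mulrC.
move=> ? ->; split => //; rewrite !cexp_sumE big_ord_recr /= [t%:C * - z]mulrC.
rewrite exprS; ring.
Qed.

(** The curve phi(t) = e^{-tz} S(tz), S the truncated series, satisfies e^z (phi(0) - phi(1)) = e^z
    - S(z). The mean value theorem for its two components gives the factor 2, and bounding t^N by 1
    leaves N! in the denominator. *)
Lemma cexp_taylor (N : nat) z (M : R) :
  (forall t : R, 0 <= t <= 1 -> expR (Re (t%:C * - z)) <= M) ->
  Normc.normc (cexp z - cexp_sum N.+1 z) <=
  2 * expR (Re z) * M * (Normc.normc z ^+ N.+1 / N`!%:R).
Proof.
move=> hM; pose phi (t : R) := cexp (t%:C * - z) * cexp_sum N.+1 (t%:C * z).
pose B := M * (Normc.normc z ^+ N.+1 / N`!%:R).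
have nB (t : R) : 0 <= t <= 1 -> Normc.normc (cderive (1 : R) phi t) <= B.
  move=> t01; have [_ ->] := cexp_taylor_curve N z t.
  rewrite cnormN !cnormM normc_cexp normc_real /B.
  rewrite cnormX; apply: ler_pM; rewrite ?expR_ge0 ?mulr_ge0 ?exprn_ge0 ?normc_ge0//.
    exact: hM.
  rewrite ler_wpM2l ?exprn_ge0 ?normc_ge0//.
  move: t01 => /andP[t0 t1].
  rewrite /expterm ger0_norm ?divr_ge0 ?exprn_ge0//.
  by rewrite ler_piMl ?invr_ge0// exprn_ile1.
have [dR dI] : (forall t : R, is_derive t 1 (fun t => Re (phi t)) (Re (cderive (1 : R) phi t))) /\
    (forall t : R, is_derive t 1 (fun t => Im (phi t)) (Im (cderive (1 : R) phi t))).
  split => t; have [[dd1 dd2] _] := cexp_taylor_curve N z t;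
    by apply: DeriveDef => //; exact: diff_derivable.
have H1 := MVT_bound dR (fun t t01 => le_trans (normc_Re _) (nB t t01)).
have H2 := MVT_bound dI (fun t t01 => le_trans (normc_Im _) (nB t t01)).
have p0 : phi 0 = 1.
  rewrite /phi !mul0r cexp0 mul1r /cexp_sum big_ord_recl big1 ?addr0.
    by rewrite expr0 fact0 invr1 mulr1.
  by move=> i _; rewrite exprS !mul0r.
have E : cexp z - cexp_sum N.+1 z = cexp z * (phi 0 - phi 1).
  by rewrite p0 /phi !mul1r mulrBr mulr1 mulrA cexp_neq0 mul1r.
rewrite E cnormM normc_cexp.
have : Normc.normc (phi 0 - phi 1) <= B + B.
  rewrite (le_trans (normc_le _))// cReD cReN cImD cImN.
  rewrite (distrC (Re (phi 0))) (distrC (Im (phi 0))).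
  exact: lerD.
move=> H; rewrite [leRHS](_ : _ = expR (Re z) * (B + B)); last by rewrite /B; ring.
by rewrite ler_wpM2l ?expR_ge0.
Qed.

Lemma cexp_taylor_im (N : nat) (s : R) :
  Normc.normc (cexp ('i%C * s%:C) - cexp_sum N.+1 ('i%C * s%:C)) <=
  2 * (`|s| ^+ N.+1 / N`!%:R).
Proof.
have R0 : Re ('i%C * s%:C) = 0 by rewrite cReM /= mul0r mul1r subrr.
have nz : Normc.normc ('i%C * s%:C) = `|s|.
  rewrite cnormM normc_real [Normc.normc 'i%C]normcE2 /=.
  by rewrite expr0n expr1n add0r sqrtr1 mul1r.
have := @cexp_taylor N ('i%C * s%:C) 1; rewrite R0 expR0 nz !mulr1; apply.
by move=> t _; rewrite cReM cReN cImN R0 /= mul0r oppr0 mulr0 addr0 expR0.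
Qed.

Lemma normc_cexp_sum N z : Normc.normc (cexp_sum N z) <= expR (Normc.normc z).
Proof.
rewrite /cexp_sum; apply: (@le_trans _ _ (\sum_(k < N) Normc.normc z ^+ k / k`!%:R)).
  have : Normc.normc (\sum_(k < N) z ^+ k * (k`!%:R^-1)%:C) <=
      \sum_(k < N) Normc.normc (z ^+ k * (k`!%:R^-1)%:C).
    elim/big_ind2: _ => //; first by rewrite cnorm0.
    by move=> x1 x2 y1 y2 h1 h2; rewrite (le_trans (cnormD _ _))// lerD.
  move=> /le_trans; apply; apply: ler_sum => k _.
  rewrite cnormM normc_real ger0_norm ?invr_ge0//.
  rewrite ler_wpM2r ?invr_ge0//.
  by rewrite cnormX.
have := exp_coeff_ge0.
rewrite -[expR _]/(limn (series (exp_coeff (Normc.normc z)))).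
have -> : \sum_(k < N) Normc.normc z ^+ k / k`!%:R = series (exp_coeff (Normc.normc z)) N.
  by rewrite /series /= big_mkord.
move=> _; apply: nondecreasing_cvgn_le; last exact: is_cvg_series_exp_coeff.
apply/nondecreasing_seqP => n; rewrite /series /= big_nat_recr//= lerDl.
by rewrite exp_coeff_ge0 ?normc_ge0.
Qed.

Lemma cexp_sum_cvg z : ccvg (fun N => cexp_sum N z) (cexp z).
Proof.
pose C := 2 * expR (Re z) * expR (Normc.normc z) * Normc.normc z.
have cC : (fun N => C * exp_coeff (Normc.normc z) N) @ \oo --> (0 : R).
  by rewrite -(mulr0 C); apply: cvgMl_tmp; exact: cvg_exp_coeff.
have H N : Normc.normc (cexp z - cexp_sum N.+1 z) <= C * exp_coeff (Normc.normc z) N.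
  apply: le_trans (@cexp_taylor N z (expR (Normc.normc z)) _) _.
    move=> t /andP[t0 t1]; rewrite ler_expR (le_trans (ler_norm _))//.
    rewrite (le_trans (normc_Re _))// cnormM cnormN normc_real ger0_norm//.
    by rewrite ler_piMl ?normc_ge0.
  by rewrite /C /exp_coeff /= exprS -!mulrA.
have sq (f : R[i] -> R) (fB : forall u v, f (u - v) = f u - f v)
    (fn : forall u, `|f u| <= Normc.normc u) : (fun N => f (cexp_sum N z)) @ \oo --> f (cexp z).
  rewrite -(cvg_shiftn 1) /=; apply/cvgrPdist_le => e e0.
  have /cvgrPdist_le/(_ e e0) := cC; apply: filterS => N.
  rewrite sub0r normrN addn1 => hN; rewrite -fB (le_trans (fn _))// (le_trans (H N))//.
  by rewrite (le_trans (ler_norm _)).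
split; apply: sq => //.
- by move=> u v; rewrite cReD cReN.
- exact: normc_Re.
- by move=> u v; rewrite cImD cImN.
- exact: normc_Im.
Qed.

End CexpTaylor.

(** * Weighted L2 spaces: Cauchy-Schwarz and Bessel inequalities *)

Section WeightedL2.
Context d (T : measurableType d) (R : realType).
Variable mu : {measure set T -> \bar R}.
Variable w : T -> R.
Hypothesis w0 : forall x, 0 <= w x.
Hypothesis mw : measurable_fun setT w.
Implicit Types (F G : T -> R[i]) (c : R[i]).

Definition wL2 F := cmeas F /\
  mu.-integrable setT (EFin \o (fun x => Normc.normc (F x) ^+ 2 * w x)).
Definition wip F G := cintegral mu (fun x => F x * conjc (G x) * (w x)%:C).
Definition wn2 F := \int[mu]_x (Normc.normc (F x) ^+ 2 * w x).

Lemma wn2_ge0 F : 0 <= wn2 F.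
Proof. by apply: Rintegral_ge0 => x _; rewrite mulr_ge0 ?sqr_ge0. Qed.

Lemma amgm (x y : R) : x * y <= x ^+ 2 + y ^+ 2.
Proof.
have := sqr_ge0 (x - y); have := sqr_ge0 x; have := sqr_ge0 y.
by rewrite sqrrB; nra.
Qed.

Lemma integrable_addr (f g : T -> R) : mu.-integrable setT (EFin \o f) ->
  mu.-integrable setT (EFin \o g) -> mu.-integrable setT (EFin \o (fun x => f x + g x)).
Proof.
move=> jf jg; rewrite (_ : _ \o _ = (EFin \o f) \+ (EFin \o g))%E//.
exact: integrableD.
Qed.

Lemma wip_integrable F G : wL2 F -> wL2 G ->
  cintegrable mu (fun x => F x * conjc (G x) * (w x)%:C).
Proof.
move=> [mF iF] [mG iG]; apply: (cintegrable_le _ (integrable_addr iF iG)).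
  by apply: cmeasM; [apply: cmeasM => //; exact: cmeasJ|exact: cmeas_real].
move=> x; rewrite !cnormM cnormJ normc_real ger0_norm// -mulrDl.
by rewrite ler_wpM2r// amgm.
Qed.

Lemma wL2D F G : wL2 F -> wL2 G -> wL2 (fun x => F x + G x).
Proof.
move=> [mF iF] [mG iG]; split; first exact: cmeasD.
apply: (@le_Rintegral_of_integrable _ _ _ _ _ _ _
  (integrable_mulrl 2 (integrable_addr iF iG))).
  by apply: measurable_funM => //; apply: measurable_funX;
    exact: cmeas_normc (cmeasD mF mG).
move=> x /=; rewrite ger0_norm; last by rewrite mulr_ge0 ?sqr_ge0.
rewrite -mulrDl mulrA ler_wpM2r//.
have := cnormD (F x) (G x); have := normc_ge0 (F x + G x).
have := normc_ge0 (F x); have := normc_ge0 (G x).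
move: (Normc.normc _) (Normc.normc _) (Normc.normc _) => p q r *.
have : p ^+ 2 <= (q + r) ^+ 2 by rewrite ler_pXn2r ?nnegrE ?addr_ge0.
have := sqr_ge0 (q - r); rewrite sqrrB sqrrD; nra.
Qed.

Lemma wL2Z F c : wL2 F -> wL2 (fun x => c * F x).
Proof.
move=> [mF iF]; split; first by apply: cmeasM => //; exact: cmeas_cst.
have := integrable_mulrl (Normc.normc c ^+ 2) iF.
by congr (_.-integrable _ _); apply/funext => x /=; rewrite cnormM exprMn mulrA.
Qed.

Lemma wL2_0 : wL2 (fun=> 0).
Proof.
split; first exact: cmeas_cst.
rewrite (_ : _ \o _ = cst 0%E); first exact: integrable0.
by apply/funext => x; rewrite /comp cnorm0 expr0n mul0r.
Qed.

Lemma wL2B F G : wL2 F -> wL2 G -> wL2 (fun x => F x - G x).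
Proof.
move=> hF hG; under eq_fun do rewrite -mulN1r.
by apply: wL2D => //; exact: wL2Z.
Qed.

Lemma wL2_sum (I : Type) (r : seq I) (P : pred I) (F : I -> T -> R[i]) :
  (forall i, wL2 (F i)) -> wL2 (fun x => \sum_(i <- r | P i) F i x).
Proof.
move=> mF; elim: r => [|i r ih].
  by under eq_fun do rewrite big_nil; exact: wL2_0.
under eq_fun do rewrite big_cons.
by case: (P i) => //; exact: wL2D.
Qed.

Lemma wipDl F G H : wL2 F -> wL2 G -> wL2 H ->
  wip (fun x => F x + G x) H = wip F H + wip G H.
Proof.
move=> hF hG hH; rewrite /wip -cintegralD; [|exact: wip_integrable..].
by apply: eq_cintegral => x; rewrite !mulrDl.
Qed.

Lemma wipZl F G c : wL2 F -> wL2 G -> wip (fun x => c * F x) G = c * wip F G.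
Proof.
move=> hF hG; rewrite /wip -cintegralZl; last exact: wip_integrable.
by apply: eq_cintegral => x; rewrite !mulrA.
Qed.

Lemma wipC F G : wL2 F -> wL2 G -> wip G F = conjc (wip F G).
Proof.
move=> hF hG; rewrite /wip -cintegralJ; last exact: wip_integrable.
apply: eq_cintegral => x; apply: complex_ext; rewrite ?(cReE, cImE); ring.
Qed.

Lemma wip_self F : wip F F = (wn2 F)%:C.
Proof.
rewrite /wip /wn2 -cintegral_real; apply: eq_cintegral => x.
by rewrite mulcJ -rmorphM.
Qed.

Lemma wip_suml (I : Type) (r : seq I) (c : I -> R[i]) (e : I -> T -> R[i]) G :
  (forall i, wL2 (e i)) -> wL2 G ->
  wip (fun x => \sum_(i <- r) c i * e i x) G = \sum_(i <- r) c i * wip (e i) G.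
Proof.
move=> he hG; elim: r => [|i r ih].
  rewrite big_nil; under eq_fun do rewrite big_nil.
  by rewrite /wip; under eq_cintegral do rewrite !mul0r; exact: cintegral0.
rewrite big_cons -ih -wipZl// -wipDl//.
- by rewrite /wip; apply: eq_cintegral => x; rewrite big_cons.
- exact: wL2Z.
- by apply: wL2_sum => j; exact: wL2Z.
Qed.

Lemma wipDr F G H : wL2 F -> wL2 G -> wL2 H ->
  wip H (fun x => F x + G x) = wip H F + wip H G.
Proof.
move=> hF hG hH; rewrite wipC//; last exact: wL2D.
by rewrite wipDl// cconjD -!wipC.
Qed.

Lemma wipZr F G c : wL2 F -> wL2 G -> wip G (fun x => c * F x) = conjc c * wip G F.
Proof.
move=> hF hG; rewrite wipC//; last exact: wL2Z.
by rewrite wipZl// cconjM -wipC.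
Qed.

Lemma wn2B F G : wL2 F -> wL2 G ->
  wn2 (fun x => F x - G x) = wn2 F - 2 * Re (wip F G) + wn2 G.
Proof.
move=> hF hG.
have hG' : wL2 (fun x => (-1) * G x) by exact: wL2Z.
have E : (fun x => F x - G x) = (fun x => F x + (-1) * G x).
  by apply/funext => x; rewrite mulN1r.
have := wip_self (fun x => F x - G x); rewrite {1 2}E.
rewrite wipDl//; last exact: wL2D.
rewrite !wipDr// !wipZl//.
rewrite !wipZr// !wip_self (wipC hF hG) => H.
have := congr1 (@complex.Re R) H; rewrite !(cReE, cImE) => <-.
by rewrite /=; ring.
Qed.

(** The squared norm of F - t z G with z = <F, G> and t real is a real quadratic polynomial in t; t
    = 1/|G|^2 minimizes it. *)
Lemma wip_CauchySchwarz F G : wL2 F -> wL2 G ->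
  Normc.normc (wip F G) ^+ 2 <= wn2 F * wn2 G.
Proof.
move=> hF hG; set z := wip F G; set A := wn2 F; set C := wn2 G.
have key t : 0 <= A - 2 * t * Normc.normc z ^+ 2 + t ^+ 2 * Normc.normc z ^+ 2 * C.
  have := wn2_ge0 (fun x => F x - (t%:C * z) * G x).
  rewrite wn2B//; last exact: wL2Z.
  rewrite wipZr// -/z.
  have -> : wn2 (fun x => t%:C * z * G x) = t ^+ 2 * Normc.normc z ^+ 2 * C.
    rewrite /C /wn2 -RintegralZl//; last by case: hG.
    apply: eq_Rintegral => x _; rewrite !cnormM normc_real !exprMn real_normK ?num_real//.
    by rewrite !mulrA.
  have -> : Re (conjc (t%:C * z) * z) = t * Normc.normc z ^+ 2; last by rewrite mulrA.
  by rewrite sqr_normcE !(cReE, cImE); ring.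
move: (normc_ge0 z) (wn2_ge0 F) (wn2_ge0 G) key; rewrite -/A -/C.
move: (Normc.normc z) => n n0 A0 C0 key.
(* When |G|^2 = 0 the polynomial is affine in t; if z were nonzero, the value of t chosen below
   would make it equal to -1. *)
have [C00|C1] := eqVneq C 0.
  rewrite C00 mulr0; rewrite leNgt; apply/negP => n2.
  have := key ((A + 1) / (2 * n ^+ 2)); rewrite C00 mulr0 addr0.
  have -> : 2 * ((A + 1) / (2 * n ^+ 2)) * n ^+ 2 = A + 1.
    by field; move: n2; rewrite exprn_even_gt0.
  by rewrite opprD addrA subrr sub0r oppr_ge0 ler10.
have Cp : 0 < C by rewrite lt_neqAle eq_sym C1.
have := key C^-1; have -> : A - 2 * C^-1 * n ^+ 2 + C^-1 ^+ 2 * n ^+ 2 * C = A - n ^+ 2 / C.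
  by field.
by rewrite subr_ge0 ler_pdivrMr.
Qed.

(** The index type is left free: bases are indexed by integers, monomials by pairs of exponents. *)
Variable I : eqType.
Variable e : I -> T -> R[i].
Hypothesis he : forall i, wL2 (e i).
Hypothesis one : forall i j, wip (e i) (e j) = (i == j)%:R.

Lemma wip_proj F (r : seq I) (j : I) : uniq r -> wL2 F -> j \in r ->
  wip (fun x => \sum_(i <- r) wip F (e i) * e i x) (e j) = wip F (e j).
Proof.
move=> ur hF jr; rewrite wip_suml// (bigD1_seq j)//= one eqxx mulr1 big1 ?addr0//.
by move=> i ij; rewrite one (negbTE ij) mulr0.
Qed.

Lemma bessel_id F (r : seq I) : uniq r -> wL2 F ->
  wn2 (fun x => F x - \sum_(i <- r) wip F (e i) * e i x) =
  wn2 F - \sum_(i <- r) Normc.normc (wip F (e i)) ^+ 2.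
Proof.
move=> ur hF; pose S x := \sum_(i <- r) wip F (e i) * e i x.
have hS : wL2 S by apply: wL2_sum => i; exact: wL2Z.
have E1 : wip S F = (\sum_(i <- r) Normc.normc (wip F (e i)) ^+ 2)%:C.
  rewrite wip_suml// rmorph_sum; apply: eq_bigr => i _ /=.
  by rewrite (wipC hF (he i)) mulcJ.
have E2 : wip S S = (\sum_(i <- r) Normc.normc (wip F (e i)) ^+ 2)%:C.
  rewrite {1}/S wip_suml// rmorph_sum; rewrite !big_seq; apply: eq_bigr => i ir /=.
  rewrite (wipC hS (he i)) (_ : wip S (e i) = wip F (e i)); last exact: wip_proj.
  by rewrite mulcJ.
rewrite wn2B//.
have -> : Re (wip F S) = \sum_(i <- r) Normc.normc (wip F (e i)) ^+ 2.
  by rewrite (wipC hS hF) cReJ E1.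
have -> : wn2 S = \sum_(i <- r) Normc.normc (wip F (e i)) ^+ 2.
  by have := wip_self S; rewrite E2 => -[].
by ring.
Qed.

Lemma bessel_le F (r : seq I) : uniq r -> wL2 F ->
  \sum_(i <- r) Normc.normc (wip F (e i)) ^+ 2 <= wn2 F.
Proof.
move=> ur hF; rewrite -subr_ge0 -bessel_id//; exact: wn2_ge0.
Qed.

Lemma wip_bessel F G (r : seq I) : uniq r -> wL2 F -> wL2 G ->
  wip (fun x => F x - \sum_(i <- r) wip F (e i) * e i x) G =
  wip F G - \sum_(i <- r) wip F (e i) * wip (e i) G.
Proof.
move=> ur hF hG; rewrite -wip_suml//.
have E : (fun x => F x - \sum_(i <- r) wip F (e i) * e i x) =
    (fun x => F x + (-1) * \sum_(i <- r) wip F (e i) * e i x).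
  by apply/funext => x; rewrite mulN1r.
have hS : wL2 (fun x => \sum_(i <- r) wip F (e i) * e i x).
  by apply: wL2_sum => i; exact: wL2Z.
by rewrite E wipDl//; [rewrite wipZl// mulN1r|exact: wL2Z].
Qed.

End WeightedL2.

(** * Reproducing kernel of the Fock space *)

Section FockSpace.
Variable R : realType.
Variable a : imquat R.
Hypothesis a0 : a <> 0.
Local Notation J := (qrot a).
Local Notation lam := (imabs a).
Local Notation mR := (measurableTypeR R).
Local Notation Q4 := (mR * mR * mR * mR)%type.
Local Notation w := (gauss (2 * lam)).
Local Notation L2 := (@wL2 _ Q4 R leb_quat w).
Local Notation ip := (@wip _ Q4 R leb_quat w).
Local Notation n2 := (@wn2 _ Q4 R leb_quat w).
Implicit Types (F G : quat R -> R[i]) (q v h : quat R).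

Lemma lam_gt0 : 0 < lam. Proof. exact: imabs_gt0. Qed.
Let lam2 : 0 < 2 * lam. Proof. by rewrite mulr_gt0// lam_gt0. Qed.
Let w0 q : 0 <= w q. Proof. exact: gauss_ge0. Qed.
Let mw : measurable_fun [set: Q4] w. Proof. exact: measurable_gauss. Qed.

Let l2B := @wL2B _ Q4 R leb_quat w w0 mw.
Let l2Z F c : L2 F -> L2 (fun q => c * F q).
Proof. exact: wL2Z. Qed.
Let l2_sum := @wL2_sum _ Q4 R leb_quat w w0 mw.
Let ipC := @wipC _ Q4 R leb_quat w w0 mw.
Let besselle := @bessel_le _ Q4 R leb_quat w w0 mw.
Let ip_bessel := @wip_bessel _ Q4 R leb_quat w w0 mw.
Let CS := @wip_CauchySchwarz _ Q4 R leb_quat w w0 mw.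

Lemma fock_weightE q : expR (- 2 * lam * qabs q ^+ 2) = w q.
Proof. by rewrite /gauss qabs_sqr !mulNr. Qed.

Lemma holomorphic_cmeas F : holomorphic a F -> @cmeas _ Q4 R F.
Proof.
by move=> [dF _ _]; apply: ccontinuous_cmeas; exact: cdifferentiable_ccontinuous.
Qed.

Lemma fock_norm2E F : L2 F -> fock_norm2 a F = (n2 F)%:E.
Proof.
move=> [_ iF]; rewrite /wn2 /Rintegral fineK; last exact: integrable_fin_num.
by apply: eq_integral => q _; rewrite fock_weightE.
Qed.

Lemma fock_wL2 F : fock a F -> L2 F.
Proof.
move=> [hF nF]; have mF := holomorphic_cmeas hF; split => //.
apply/integrableP; split.
  apply/measurable_EFinP; apply: measurable_funM => //.
  by apply: measurable_funX; exact: cmeas_normc.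
apply: le_lt_trans nF; rewrite le_eqVlt; apply/orP; left; apply/eqP.
apply: eq_integral => q _ /=; rewrite fock_weightE ger0_norm//.
by rewrite mulr_ge0 ?sqr_ge0.
Qed.

Lemma wL2_fock F : holomorphic a F -> L2 F -> fock a F.
Proof. by move=> hF lF; split => //; rewrite fock_norm2E// ltry. Qed.

Lemma fock_innerE F G : fock_inner a F G = ip F G.
Proof. by apply: eq_cintegral => q; rewrite fock_weightE. Qed.

(** The reproducing kernel at [v] up to the constant [repc]. *)
Definition kernelK v q : R[i] := cexp ((2 * lam)%:C * zeta a v q).

Lemma holomorphic_K v : holomorphic a (kernelK v).
Proof.
apply: holomorphic_cexp; apply: holomorphicM; first exact: holomorphic_cst.
exact: holomorphic_zeta.
Qed.

Lemma normc_K v q : Normc.normc (kernelK v q) ^+ 2 * w q =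
  expR (2 * lam * qdot v v) * gauss (2 * lam) (q - v).
Proof.
rewrite /kernelK normc_cexp /gauss -expRM_natl -!expRD; congr expR.
rewrite cReM cRe_real cIm_real /zeta cRe_mk mul0r subr0.
rewrite !qdotLE (qdotC v q); ring.
Qed.

Lemma wL2_K v : L2 (kernelK v).
Proof.
split; first exact/holomorphic_cmeas/holomorphic_K.
rewrite (_ : _ \o _ = EFin \o (fun q : Q4 => expR (2 * lam * qdot v v) *
    gauss (2 * lam) (q - v))); last first.
  by apply/funext => q /=; rewrite normc_K.
apply: integrable_mulrl.
exact: (mpres_integrable (mpres_quat (- v)) (integrable_gauss lam2)).
Qed.

Lemma zeta0 h : zeta a h 0 = 0.
Proof. by apply: complex_ext; rewrite /zeta ?cRe_mk ?cIm_mk qdot0l. Qed.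

(** The inverse of the total mass of the Gaussian weight. *)
Definition repc : R := locked ((2 * lam / pi) ^+ 2).

Lemma repcE : repc = (2 * lam / pi) ^+ 2.
Proof. by rewrite /repc -lock. Qed.

Lemma repc_gt0 : 0 < repc.
Proof. by rewrite repcE exprn_gt0// divr_gt0// pi_gt0. Qed.

(* Mean value property for p |-> F (p + v) e^{- 2 |a| zeta_v(p)}: translating the
   Gaussian by v completes the square. *)
Lemma reproducing F v : holomorphic a F -> L2 F ->
  F v = repc%:C * ip F (kernelK v).
Proof.
move=> hF lF.
pose G q := F (q + v) * cexp (- (2 * lam)%:C * zeta a v q).
have hG : holomorphic a G.
  apply: holomorphicM; first exact: holomorphic_shift.
  apply: holomorphic_cexp; apply: holomorphicM; first exact: holomorphic_cst.
  exact: holomorphic_zeta.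
pose H q := F q * conjc (kernelK v q) * (w q)%:C.
have HG q : H (q + v) = G q * (gauss (2 * lam) q)%:C.
  rewrite /H /G -!mulrA; congr (_ * _).
  rewrite /kernelK cexpJ /gauss -!cexp_real -!cexpD; congr cexp.
  apply: complex_ext; rewrite /zeta !(cReE, cImE).
    by rewrite !qdotLE (qdotC v q); ring.
  by rewrite !qdotLE (qdotC v (J v)) qdot_rot_self//; ring.
have iH : cintegrable leb_quat H by apply: wip_integrable => //; exact: wL2_K.
have iG : cintegrable leb_quat (fun q => G q * (gauss (2 * lam) q)%:C).
  have := mpres_cintegrable (mpres_quat v) iH.
  by congr cintegrable; apply/funext => q; exact: HG.
have := cgauss_mean a0 lam2 hG iG.
have -> : cintegral leb_quat (fun q => G q * (gauss (2 * lam) q)%:C) = ip F (kernelK v).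
  apply: etrans (mpres_cintegral (mpres_quat v) (cintegrable_meas iH)).
  by apply: eq_cintegral => q; exact: esym (HG q).
move=> ->; rewrite /G zeta0 mulr0 cexp0 mulr1 add0r mulrC -mulrA -rmorphM.
rewrite (_ : _ * repc = 1) ?mulr1// repcE -exprMn mulrA mulfVK ?mulfV ?expr1n//.
  by rewrite gt_eqF// pi_gt0.
by rewrite gt_eqF.
Qed.

Lemma ip_KK v q : ip (kernelK v) (kernelK q) = (repc^-1)%:C * kernelK v q.
Proof.
rewrite (reproducing q (holomorphic_K v) (wL2_K v)) mulrA -rmorphM.
by rewrite mulVf ?mul1r// gt_eqF// repc_gt0.
Qed.

Section OrthonormalBasis.
Variable e : nat -> quat R -> R[i].
Hypothesis one : orthonormal_basis a e.

Let hole n : holomorphic a (e n).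
Proof. by have [H _ _] := one; have [] := H n. Qed.
Let l2e n : L2 (e n).
Proof. by have [H _ _] := one; exact: fock_wL2. Qed.
Let orth i j : ip (e i) (e j) = (i == j)%:R.
Proof. by have [_ H _] := one; rewrite -fock_innerE. Qed.

(** Half of the weight is absorbed in each basis function; after this the partial sums of the kernel
    are bounded on the whole space, uniformly in their length. *)
Definition psi n q : R[i] := e n q * (expR (- (lam * qdot q q)))%:C.

(** The reproducing kernel multiplied by the half weights at q and v. Completing the square leaves a
    Gaussian in q - v and a unimodular phase. *)
Definition kerpsi q v : R[i] := (repc * expR (- (lam * qdot (q - v) (q - v))))%:C *
  cexp ('i%C * (2 * lam * qdot q (J v))%:C).

Lemma basis_eval n q : e n q = repc%:C * ip (e n) (kernelK q).
Proof. exact: reproducing. Qed.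

(** Values at q are inner products with [kernelK q], so this is Bessel's inequality for that kernel,
    whose squared norm is its value at q divided by [repc]. *)
Lemma psi_bessel q (N : nat) :
  \sum_(0 <= n < N) Normc.normc (psi n q) ^+ 2 <= repc.
Proof.
have H := besselle l2e orth (iota_uniq 0 (N - 0)) (wL2_K q).
have := ip_KK q q; rewrite (@wip_self _ Q4 R leb_quat w) => /(congr1 (@complex.Re R)).
rewrite cRe_real cReM cIm_real mul0r subr0 cRe_real => nK.
have Kqq : Re (kernelK q q) = expR (2 * lam * qdot q q).
  rewrite /kernelK (_ : zeta a q q = (qdot q q)%:C) -?rmorphM ?cexp_real//.
  by apply: complex_ext; rewrite /zeta ?cRe_mk ?cIm_mk// qdotC qdot_rot_self.
rewrite Kqq in nK; rewrite nK in H.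
have E n : Normc.normc (psi n q) ^+ 2 = repc ^+ 2 * expR (- (2 * lam * qdot q q)) *
    Normc.normc (ip (kernelK q) (e n)) ^+ 2.
  rewrite /psi basis_eval; move: repc => r; rewrite !cnormM !normc_real (ipC (l2e n) (wL2_K q)) cnormJ.
  rewrite ![(_ * _) ^+ 2]exprMn !real_normK ?num_real// -expRM_natl.
  by rewrite mulrAC (_ : 2 * - (lam * qdot q q) = - (2 * lam * qdot q q)); last ring.
rewrite (eq_bigr _ (fun n _ => E n)) -mulr_sumr.
apply: le_trans (ler_wpM2l _ H) _; first by rewrite mulr_ge0 ?sqr_ge0 ?expR_ge0.
rewrite le_eqVlt; apply/orP; left; apply/eqP.
rewrite expRN; have r0 := repc_gt0; have x0 := expR_gt0 (2 * lam * qdot q q).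
by move: (expR _) repc x0 r0 => x r x0 r0; field; rewrite !gt_eqF.
Qed.

Lemma normc_psi n q : Normc.normc (psi n q) ^+ 2 <= repc.
Proof.
apply: le_trans (psi_bessel q n.+1); rewrite big_nat_recr//= lerDr.
by apply: sumr_ge0 => i _; exact: sqr_ge0.
Qed.

Lemma psi_kernel_bound (N : nat) q v :
  Normc.normc (\sum_(0 <= n < N) psi n q * conjc (psi n v)) <= 2 * repc.
Proof.
apply: (@le_trans _ _ (\sum_(0 <= n < N) Normc.normc (psi n q * conjc (psi n v)))).
  elim/big_ind2: _ => //; first by rewrite cnorm0.
  by move=> x1 x2 y1 y2 h1 h2; rewrite (le_trans (cnormD _ _))// lerD.
apply: (@le_trans _ _ (\sum_(0 <= n < N) (Normc.normc (psi n q) ^+ 2 + Normc.normc (psi n v) ^+ 2))).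
  by apply: ler_sum => n _; rewrite cnormM cnormJ; exact: amgm.
by rewrite big_split /= mulr_natl mulr2n lerD// psi_bessel.
Qed.

(** The expansion of [kernelK v] in the basis converges in norm. Evaluation at q is pairing with
    [kernelK q], so Cauchy-Schwarz makes the convergence pointwise. *)
Lemma psi_kernel_cvg q v :
  ccvg (fun N => \sum_(0 <= n < N) psi n q * conjc (psi n v)) (kerpsi q v).
Proof.
pose D N y := kernelK v y - \sum_(0 <= n < N) ip (kernelK v) (e n) * e n y.
have DL2 N : L2 (D N).
  apply: l2B; first exact: wL2_K.
  by apply: l2_sum => n; exact: l2Z.
have D0 : (fun N => n2 (D N)) @ \oo --> (0 : R).
  have [_ _ /(_ _ (wL2_fock (holomorphic_K v) (wL2_K v)))] := one.
  rewrite (_ : (fun n : nat => _) = fun N => (n2 (D N))%:E); last first.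
    apply/funext => N; rewrite -fock_norm2E//; congr fock_norm2; apply/funext => y.
    rewrite /D big_mkord; apply: (congr1 (fun s => kernelK v y - s)).
    by apply: eq_bigr => n _; rewrite fock_innerE.
  by move=> /fine_cvgP[_].
pose c1 : R := repc * expR (- (lam * qdot q q)) * expR (- (lam * qdot v v)).
have c10 : 0 <= c1 by exact: mulr_ge0 (mulr_ge0 (ltW repc_gt0) (expR_ge0 _)) (expR_ge0 _).
have E N : kerpsi q v - \sum_(0 <= n < N) psi n q * conjc (psi n v) =
    (c1 * repc)%:C * ip (D N) (kernelK q).
  rewrite (ip_bessel l2e (iota_uniq 0 (N - 0)) (wL2_K v) (wL2_K q)).
  rewrite mulrBr; congr (_ - _).
    have cM (x y : R) : (x * y)%:C = x%:C * y%:C by exact: rmorphM.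
    rewrite ip_KK mulrA -cM -[c1 * _ * _]mulrA mulfV ?mulr1; last by rewrite gt_eqF// repc_gt0.
    have -> : c1%:C = repc%:C * (expR (- (lam * qdot q q)))%:C * (expR (- (lam * qdot v v)))%:C.
      by rewrite /c1; rewrite -!cM.
    rewrite /kerpsi /kernelK (cM repc) -!cexp_real.
    rewrite -(mulrA repc%:C) -[in RHS](mulrA repc%:C) -!cexpD -(mulrA repc%:C) -cexpD.
    apply: (congr1 (fun z => repc%:C * cexp z)).
    apply: complex_ext; rewrite /zeta !(cReE, cImE).
      by rewrite !qdotLE (qdotC v q); ring.
    by ring.
  rewrite mulr_sumr; apply: eq_bigr => n _.
  rewrite /psi !cconjM !cconj_real !basis_eval !cconjM cconj_real.
  rewrite -(ipC (l2e n) (wL2_K v)) /c1 !rmorphM; ring.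
have nb N : Normc.normc (ip (D N) (kernelK q)) <= Num.sqrt (n2 (D N) * n2 (kernelK q)).
  rewrite -[X in X <= _](ger0_norm (normc_ge0 _)) -sqrtr_sqr ler_sqrt; last first.
    by rewrite mulr_ge0//; exact: wn2_ge0.
  by apply: CS => //; exact: wL2_K.
have cB : (fun N => c1 * repc * Num.sqrt (n2 (D N) * n2 (kernelK q))) @ \oo --> (0 : R).
  rewrite -[X in _ --> X](mulr0 (c1 * repc)); apply: cvgMl_tmp.
  rewrite -[X in _ --> X]sqrtr0; apply: (cvg_comp _ (@Num.sqrt R)); last exact: sqrt_continuous.
  have := cvgM D0 (cvg_cst (n2 (kernelK q))); rewrite mul0r; exact.
have sq (f : R[i] -> R) (fB : forall x y, f (x - y) = f x - f y)
    (fn : forall x, `|f x| <= Normc.normc x) :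
    (fun N => f (\sum_(0 <= n < N) psi n q * conjc (psi n v))) @ \oo --> f (kerpsi q v).
  apply/cvgrPdist_le => eps eps0.
  have /cvgrPdist_le/(_ eps eps0) := cB; apply: filterS => N.
  rewrite sub0r normrN => hN; rewrite -fB (le_trans (fn _))// E cnormM normc_real.
  rewrite ger0_norm; last exact: mulr_ge0 c10 (ltW repc_gt0).
  apply: le_trans (le_trans (ler_norm _) hN).
  by apply: ler_wpM2l (mulr_ge0 c10 (ltW repc_gt0)) _ _ _.
split; apply: sq => //.
- by move=> x y; rewrite cReD cReN.
- exact: normc_Re.
- by move=> x y; rewrite cImD cImN.
- exact: normc_Im.
Qed.

End OrthonormalBasis.

End FockSpace.

(** * Monomial orthonormal basis *)

Section FatouExpansion.
Context d (T : measurableType d) (R : realType).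
Variable mu : {measure set T -> \bar R}.
Variable w : T -> R.
Hypothesis w0 : forall x, 0 <= w x.
Hypothesis mw : measurable_fun setT w.
Implicit Types (F G : T -> R[i]) (c : R[i]).
Local Notation L2 := (wL2 mu w).
Local Notation ip := (wip mu w).
Local Notation n2 := (wn2 mu w).

Lemma ccvg_normc (u : nat -> R[i]) (l : R[i]) : ccvg u l ->
  (fun n => Normc.normc (u n) ^+ 2) @ \oo --> Normc.normc l ^+ 2.
Proof.
move=> [uR uI]; rewrite (sqr_normcE l).
under eq_fun do rewrite (sqr_normcE (u _)).
by rewrite !expr2; under eq_fun do rewrite !expr2; apply: cvgD; exact: cvgM.
Qed.

(* Replaces the completeness of the weighted L2 space. *)
Lemma wn2_fatou (F_ : nat -> T -> R[i]) F (s : R) :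
  (forall n, L2 (F_ n)) -> L2 F -> (forall x, ccvg (F_ ^~ x) (F x)) ->
  (forall n, n2 (F_ n) <= s) -> n2 F <= s.
Proof.
move=> hF_ hF FF Fs.
pose h n x : \bar R := (Normc.normc (F_ n x) ^+ 2 * w x)%:E.
have mh n : measurable_fun setT (h n).
  by have [_ /integrableP[]] := hF_ n.
have h0 n x : setT x -> (0 <= h n x)%E by rewrite lee_fin mulr_ge0 ?sqr_ge0.
have H := fatou mu measurableT mh h0.
have E : (\int[mu]_x limn_einf (h ^~ x) = (n2 F)%:E)%E.
  rewrite /wn2 /Rintegral fineK; last by apply: integrable_fin_num => //; case: hF.
  apply: eq_integral => x _; apply: (cvg_limn_einf_sup _).1.
  apply/fine_cvgP; split; first by apply: nearW.
  by apply: cvgM; [exact: ccvg_normc|exact: cvg_cst].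
rewrite E in H; rewrite -lee_fin; apply: le_trans H _.
rewrite limn_einf_lim; apply: lime_le; first exact: is_cvg_einfs.
apply: nearW => n; apply: (@le_trans _ _ (\int[mu]_x h n x)%E).
  by apply: ereal_inf_lbound; exists n => //=.
have [_ iF] := hF_ n; have := Fs n; rewrite -lee_fin; apply: le_trans.
by rewrite /wn2 /Rintegral fineK//; exact: integrable_fin_num.
Qed.

Variable I : eqType.
Variable e : I -> T -> R[i].
Hypothesis he : forall i, L2 (e i).
Hypothesis one : forall i j, ip (e i) (e j) = (i == j)%:R.

Lemma wn2_proj F (r : seq I) : uniq r -> L2 F ->
  n2 (fun x => \sum_(i <- r) ip F (e i) * e i x) =
  \sum_(i <- r) Normc.normc (ip F (e i)) ^+ 2.
Proof.
move=> ur hF; set S := fun x => _.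
have hS : L2 S by apply: (wL2_sum w0 mw) => i; exact: wL2Z.
have : ip S S = (\sum_(i <- r) Normc.normc (ip F (e i)) ^+ 2)%:C; last first.
  by rewrite wip_self// => -[].
rewrite {1}/S (wip_suml w0 mw)// rmorph_sum !big_seq; apply: eq_bigr => i ir /=.
rewrite (wipC w0 mw hS (he i)) (_ : ip S (e i) = ip F (e i)).
  by rewrite mulcJ.
exact: (wip_proj w0 mw he one).
Qed.

(** [r] gives the finite index sets along which pointwise convergence is known (boxes of exponents),
    [b] the single enumeration along which norm convergence is wanted. *)
Variables (r : nat -> seq I) (b : nat -> I).
Hypothesis ur : forall N, uniq (r N).
Hypothesis bI : injective b.
Hypothesis rb : forall N, exists n, {subset r N <= map b (iota 0 n)}.

(** Bessel bounds the sum of squared coefficients by the squared norm of F. Fatou along the sets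
    [r], each covered by an initial segment of [b], gives the reverse inequality. Parseval then
    holds, and by [bessel_id] the remainders tend to 0. *)
Lemma expansion_onb F : L2 F ->
  (forall x, ccvg (fun N => \sum_(i <- r N) ip F (e i) * e i x) (F x)) ->
  (fun n => n2 (fun x => F x - \sum_(0 <= k < n) ip F (e (b k)) * e (b k) x))
    @ \oo --> (0 : R).
Proof.
move=> hF FF.
pose c n := \sum_(0 <= k < n) Normc.normc (ip F (e (b k))) ^+ 2.
have heb k : L2 (e (b k)) by [].
have oneb i j : ip (e (b i)) (e (b j)) = (i == j)%:R by rewrite one inj_eq.
have E n : n2 (fun x => F x - \sum_(0 <= k < n) ip F (e (b k)) * e (b k) x) = n2 F - c n.
  exact: (bessel_id w0 mw heb oneb (iota_uniq 0 (n - 0)) hF).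
have cF n : c n <= n2 F by exact: (bessel_le w0 mw heb oneb (iota_uniq 0 (n - 0)) hF).
have ndc : nondecreasing_seq c.
  apply/nondecreasing_seqP => n; rewrite /c big_nat_recr//= lerDl; exact: sqr_ge0.
have cc : cvgn c by apply: nondecreasing_is_cvgn => //; exists (n2 F) => _ [n _ <-].
have cs n : c n <= limn c by exact: nondecreasing_cvgn_le.
have Fs : n2 F = limn c.
  apply/eqP; rewrite eq_le; apply/andP; split; last by apply: limr_le => //; exact: nearW.
  apply: (@wn2_fatou (fun N x => \sum_(i <- r N) ip F (e i) * e i x)) => // N.
    by apply: (wL2_sum w0 mw) => i; exact: wL2Z.
  rewrite wn2_proj//; have [n rn] := rb N; apply: le_trans (cs n).
  rewrite /c /index_iota subn0 -(big_map b predT (fun i => Normc.normc (ip F (e i)) ^+ 2)).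
  apply: (@le_trans _ _ (\sum_(i <- map b (iota 0 n) | i \in r N) Normc.normc (ip F (e i)) ^+ 2)).
    rewrite -[leRHS]big_filter le_eqVlt; apply/orP; left; apply/eqP; apply: perm_big.
    apply: uniq_perm => //; first by rewrite filter_uniq// map_inj_uniq// iota_uniq.
    by move=> i; rewrite mem_filter; apply/idP/andP => [h|[]//]; split => //; exact: rn.
  by rewrite [leRHS](bigID (mem (r N)))/= lerDl; apply: sumr_ge0 => i _; exact: sqr_ge0.
under eq_fun do rewrite E.
by have := cvgB (cvg_cst (n2 F)) cc; rewrite -Fs subrr; exact.
Qed.

End FatouExpansion.

(** * Two complex coordinates adapted to the complex structure *)

Section Frame.
Variable R : realType.
Variable a : imquat R.
Hypothesis a0 : a <> 0.
Local Notation J := (qrot a).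
Local Notation u := (unit_dir a).
Local Notation q1 := ((1, 0, 0, 0) : quat R).

Lemma exists_orthogonal_unit :
  exists h : quat R, [/\ h.1.1.1 = 0, qdot h h = 1 & qdot h u = 0].
Proof.
have := unit_dir_norm a0; have := unit_dir_re a.
case: (unit_dir a) => [[[x0 x1] x2] x3] /= -> H.
(* If u is parallel to k then i is orthogonal to it; otherwise the projection of u to the plane of i
   and j is turned by a right angle and normalized. *)
have [E|E] := eqVneq (x1 ^+ 2 + x2 ^+ 2) 0.
  move: (E) => /eqP; rewrite paddr_eq0 ?sqr_ge0// !sqrf_eq0 => /andP[/eqP z1 /eqP z2].
  by exists (0, 1, 0, 0); rewrite !qdotE /= z1; split => //; ring.
pose s := Num.sqrt (x1 ^+ 2 + x2 ^+ 2).
have s2 : s ^+ 2 = x1 ^+ 2 + x2 ^+ 2 by rewrite sqr_sqrtr// addr_ge0// sqr_ge0.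
have s0 : s != 0 by apply: contra_neq E => s0; rewrite -s2 s0 expr0n.
exists (0, - x2 / s, x1 / s, 0); rewrite !qdotE /=; split => //; last by field.
apply: (@mulIf _ (s ^+ 2)); first by rewrite sqrf_eq0.
by rewrite mul1r {2}s2; field.
Qed.

Variable h2 : quat R.
Hypothesis h2_re : h2.1.1.1 = 0.
Hypothesis h2_norm : qdot h2 h2 = 1.
Hypothesis h2_dir : qdot h2 u = 0.

(** The vectors 1, u, h2 and h2 u form an orthonormal basis of the quaternions; the imaginary part
    of h2 u is the cross product of h2 and u. *)
Lemma frame_parseval (q w : quat R) : qdot q w = qdot q q1 * qdot w q1 +
  qdot q (J q1) * qdot w (J q1) + qdot q h2 * qdot w h2 + qdot q (J h2) * qdot w (J h2).
Proof.
have := h2_re; have := h2_norm; have := h2_dir; have := unit_dir_norm a0.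
have := unit_dir_re a; rewrite !qrotE !qdotE.
case: (unit_dir a) => [[[x0 x1] x2] x3]; case: h2 => [[[p0 p1] p2] p3].
case: q => [[[z0 z1] z2] z3]; case: w => [[[w0 w1] w2] w3] /=.
move=> -> + + + p00; rewrite p00 => U PU P.
pose UU := x1 ^+ 2 + x2 ^+ 2 + x3 ^+ 2; pose PP := p1 ^+ 2 + p2 ^+ 2 + p3 ^+ 2.
pose UP := p1 * x1 + p2 * x2 + p3 * x3.
have HU : UU = 1 by rewrite -U /UU; ring.
have HP : PP = 1 by rewrite -P /PP; ring.
have HUP : UP = 0 by rewrite -PU /UP; ring.
(* A Gram identity valid for any two vectors of R^3 and their cross product; orthonormality is
   substituted only afterwards, which keeps it within reach of [ring]. *)
have E : (UU * PP - UP ^+ 2) * (z1 * w1 + z2 * w2 + z3 * w3) =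
  UU * ((z1 * p1 + z2 * p2 + z3 * p3) * (w1 * p1 + w2 * p2 + w3 * p3)) +
  PP * ((z1 * x1 + z2 * x2 + z3 * x3) * (w1 * x1 + w2 * x2 + w3 * x3)) -
  UP * ((z1 * p1 + z2 * p2 + z3 * p3) * (w1 * x1 + w2 * x2 + w3 * x3) +
        (z1 * x1 + z2 * x2 + z3 * x3) * (w1 * p1 + w2 * p2 + w3 * p3)) +
  (z1 * (p2 * x3 - p3 * x2) + z2 * (p3 * x1 - p1 * x3) + z3 * (p1 * x2 - p2 * x1)) *
  (w1 * (p2 * x3 - p3 * x2) + w2 * (p3 * x1 - p1 * x3) + w3 * (p1 * x2 - p2 * x1)).
  by rewrite /UU /PP /UP; ring.
rewrite HU HP HUP in E.
have E2 : z1 * w1 + z2 * w2 + z3 * w3 =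
  (z1 * p1 + z2 * p2 + z3 * p3) * (w1 * p1 + w2 * p2 + w3 * p3) +
  (z1 * x1 + z2 * x2 + z3 * x3) * (w1 * x1 + w2 * x2 + w3 * x3) +
  (z1 * (p2 * x3 - p3 * x2) + z2 * (p3 * x1 - p1 * x3) + z3 * (p1 * x2 - p2 * x1)) *
  (w1 * (p2 * x3 - p3 * x2) + w2 * (p3 * x1 - p1 * x3) + w3 * (p1 * x2 - p2 * x1)).
  transitivity ((1 * 1 - 0 ^+ 2) * (z1 * w1 + z2 * w2 + z3 * w3)); first by ring.
  by rewrite E; ring.
(* The real part of h2 u is minus this inner product; [ring] eliminates it through this equation. *)
have H0 : p1 * x1 = - (p2 * x2) - p3 * x3.
  by apply/eqP; rewrite -subr_eq0 -[X in _ == X]HUP /UP; apply/eqP; ring.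
transitivity (z0 * w0 + (z1 * w1 + z2 * w2 + z3 * w3)); first by ring.
rewrite E2; ring: H0.
Qed.

Definition fz1 (q : quat R) := zeta a q1 q.
Definition fz2 (q : quat R) := zeta a h2 q.

(** Splits the reproducing kernel into a product of two exponentials, one for each coordinate, whose
    power series produce the monomials. *)
Lemma zeta_frame (w q : quat R) :
  zeta a w q = fz1 q * conjc (fz1 w) + fz2 q * conjc (fz2 w).
Proof.
apply: complex_ext; rewrite /fz1 /fz2 /zeta !(cReE, cImE).
  by rewrite frame_parseval; ring.
rewrite frame_parseval !(qdot_rotl a0 w) !(qrotK a0) !qdotNr; ring.
Qed.

Lemma normc_frame q : Normc.normc (fz1 q) ^+ 2 + Normc.normc (fz2 q) ^+ 2 = qdot q q.
Proof.
rewrite (sqr_normcE (fz1 q)) (sqr_normcE (fz2 q)) /fz1 /fz2 /zeta !(cRe_mk, cIm_mk).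
by rewrite (frame_parseval q q) -!expr2; ring.
Qed.

(** Left multiplication by e^{tu}. It commutes with J, and since u commutes with 1 but anticommutes
    with h2, it turns the two coordinates in opposite directions. *)
Definition lrot (t : R) (q : quat R) : quat R := cos t *: q + sin t *: qmul u q.

Lemma qdot_uu q : qdot (qmul u q) (qmul u q) = qdot q q.
Proof. by rewrite qdot_qmull unit_dir_norm// mul1r. Qed.

Lemma qdot_ul q h : qdot (qmul u q) h = - qdot q (qmul u h).
Proof.
have := unit_dir_re a; rewrite !qdotE.
case: (unit_dir a) => [[[x0 x1] x2] x3]; case: q => [[[? ?] ?] ?].
by case: h => [[[? ?] ?] ?] /= ->; ring.
Qed.

Lemma qmul_uu q : qmul u (qmul u q) = - q.
Proof.
rewrite qmulA qmul_unit_dir//.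
by case: q => [[[? ?] ?] ?]; rewrite !quat_oppE /qmul /=; congr (_, _, _, _); ring.
Qed.

Lemma qdot_lrot t q : qdot (lrot t q) (lrot t q) = qdot q q.
Proof.
rewrite /lrot !qdotLE qdot_uu qdot_ul (qdotC q (qmul u q)) qdot_ul.
have -> : qdot q (qmul u q) = 0.
  have := qdot_ul q q; rewrite qdotC => /eqP; rewrite -addr_eq0.
  by rewrite -mulr2n mulrn_eq0 /= => /eqP.
by rewrite -[RHS]mul1r -(cos2Dsin2 t); ring.
Qed.

Lemma lrotK t : cancel (lrot (- t)) (lrot t).
Proof.
move=> q; rewrite /lrot cosN sinN !qmulDr !qmulZr qmul_uu.
rewrite !scalerDr !scalerN !scalerA [X in _ + X]addrC addrACA -!scaleNr -!scalerDl.
rewrite (_ : cos t * cos t + _ = 1); last first.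
  by rewrite -[RHS](cos2Dsin2 t) /GRing.scale /=; ring.
rewrite (_ : cos t * - sin t + _ = 0); last by rewrite mulrN mulrC addNr.
by rewrite scale1r scale0r addr0.
Qed.

Local Notation Q4 := (measurableTypeR R * measurableTypeR R *
  measurableTypeR R * measurableTypeR R)%type.

Lemma mpres_lrot t : mpres leb_quat (lrot t).
Proof.
apply: (@mpres_isometry R _ (lrot (- t))).
- apply: measurable_quatD; apply: measurable_quatZ => //.
  by apply: measurable_qmul => //; exact: measurable_cst.
- by move=> x y; rewrite /lrot qmulDr !scalerDr addrACA.
- exact: lrotK.
- exact: qdot_lrot.
Qed.

Definition ceix (t : R) : R[i] := cos t +i* sin t.

Lemma zeta_comb h (c s : R) p q :
  zeta a h (c *: p + s *: q) = c%:C * zeta a h p + s%:C * zeta a h q.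
Proof. by apply: complex_ext; rewrite /zeta !(cReE, cImE) !qdotLE; ring. Qed.

Lemma zeta_rotE h t q : zeta a h (rot_by a t q) = ceix t * zeta a h q.
Proof.
rewrite /rot_by zeta_comb zeta_rot//.
by apply: complex_ext; rewrite /ceix !(cReE, cImE); ring.
Qed.

Lemma fz1_lrot t q : fz1 (lrot t q) = ceix t * fz1 q.
Proof.
rewrite /fz1 /lrot zeta_comb.
have -> : zeta a q1 (qmul u q) = 'i%C * zeta a q1 q.
  apply: complex_ext; rewrite /zeta !(cReE, cImE) !qdot_ul !qrotE.
    have -> : qmul u q1 = qmul q1 u.
      by case: (unit_dir a) => [[[? ?] ?] ?]; rewrite /qmul /=; congr (_, _, _, _); ring.
    by ring.
  have -> : qmul q1 u = u.
    by case: (unit_dir a) => [[[? ?] ?] ?]; rewrite /qmul /=; congr (_, _, _, _); ring.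
  by rewrite qmul_unit_dir// qdotNr; ring.
by apply: complex_ext; rewrite /ceix !(cReE, cImE); ring.
Qed.

Lemma fz2_lrot t q : fz2 (lrot t q) = ceix (- t) * fz2 q.
Proof.
have uh : qmul u h2 = - J h2.
  have := h2_re; have := h2_dir; have := unit_dir_re a; rewrite !qrotE !qdotE.
  case: (unit_dir a) => [[[x0 x1] x2] x3]; case: h2 => [[[p0 p1] p2] p3] /= -> + p00.
  rewrite p00 mul0r add0r => H; rewrite quat_oppE /qmul /=; congr (_, _, _, _); try ring.
  apply/eqP; rewrite -subr_eq0; apply/eqP.
  transitivity (- (1 + 1) * (p1 * x1 + p2 * x2 + p3 * x3)); first by ring.
  by rewrite H mulr0.
rewrite /fz2 /lrot zeta_comb.
have -> : zeta a h2 (qmul u q) = - 'i%C * zeta a h2 q.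
  apply: complex_ext; rewrite /zeta !(cReE, cImE) !qdot_ul.
    by rewrite uh qdotNr; ring.
  have -> : J h2 = (-1) *: qmul u h2 by rewrite uh scaleN1r opprK.
  by rewrite qmulZr qmul_uu !qdotLE uh; ring.
by apply: complex_ext; rewrite /ceix cosN sinN !(cReE, cImE); ring.
Qed.

End Frame.

Section Monomials.
Variable R : realType.
Variable a : imquat R.
Hypothesis a0 : a <> 0.
Local Notation J := (qrot a).
Local Notation lam := (imabs a).
Local Notation u := (unit_dir a).
Local Notation mR := (measurableTypeR R).
Local Notation Q4 := (mR * mR * mR * mR)%type.
Local Notation w := (gauss (2 * lam)).
Local Notation L2 := (@wL2 _ Q4 R leb_quat w).
Local Notation ip := (@wip _ Q4 R leb_quat w).
Local Notation n2 := (@wn2 _ Q4 R leb_quat w).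
Variable h2 : quat R.
Hypothesis h2_re : h2.1.1.1 = 0.
Hypothesis h2_norm : qdot h2 h2 = 1.
Hypothesis h2_dir : qdot h2 u = 0.
Local Notation z1 := (fz1 a).
Local Notation z2 := (fz2 a h2).

Let lam0 : 0 < lam. Proof. exact: lam_gt0. Qed.
Let w0 q : 0 <= w q. Proof. exact: gauss_ge0. Qed.
Let mw : measurable_fun [set: Q4] w. Proof. exact: measurable_gauss. Qed.

(** By c v <= c^2/(4 lam) + lam v^2, exponential growth in the coordinates is paid for with half of
    the weight; the other half remains as an integrable Gaussian. *)
Lemma frame_growth (c1 c2 : R) q :
  expR (c1 * Normc.normc (z1 q) + c2 * Normc.normc (z2 q)) * w q <=
  expR ((c1 ^+ 2 + c2 ^+ 2) / (4 * lam)) * gauss lam q.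
Proof.
rewrite /gauss -!expRD ler_expR -(normc_frame a0 h2_re h2_norm h2_dir).
set x := Normc.normc _; set y := Normc.normc _.
have H (c v : R) : c * v <= c ^+ 2 / (4 * lam) + lam * v ^+ 2.
  rewrite -subr_ge0 (_ : _ - _ = (c - 2 * lam * v) ^+ 2 / (4 * lam)).
    by rewrite divr_ge0 ?sqr_ge0// mulr_ge0// ltW.
  by field; rewrite gt_eqF.
have := H c1 x; have := H c2 y; rewrite (mulrDl (c1 ^+ 2)).
move: (c1 ^+ 2 / _) (c2 ^+ 2 / _) (c1 * x) (c2 * y) => A B C D h1 h2'.
rewrite -subr_ge0; move: h1 h2'; rewrite -subr_ge0 => h1; rewrite -subr_ge0 => h2'.
apply: le_trans (addr_ge0 h1 h2') _; rewrite le_eqVlt; apply/orP; left; apply/eqP; ring.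
Qed.

Lemma frame_growth_integrable (c1 c2 : R) : leb_quat.-integrable setT
  (EFin \o (fun q : Q4 => expR ((c1 ^+ 2 + c2 ^+ 2) / (4 * lam)) * gauss lam q)).
Proof. by apply: integrable_mulrl; exact: integrable_gauss. Qed.

(** The inequality y <= e^y at y = x/(m+1), raised to the power m; dividing by m+1 instead of m
    covers m = 0. *)
Lemma pow_le_expR (m : nat) (x : R) : 0 <= x -> x ^+ m <= m.+1%:R ^+ m * expR x.
Proof.
move=> x0; have m0 : 0 < m.+1%:R :> R by rewrite ltr0n.
have h : x <= m.+1%:R * expR (x / m.+1%:R).
  rewrite -ler_pdivrMl// mulrC; apply: le_trans (expR_ge1Dx _).
  by rewrite lerDr.
apply: (@le_trans _ _ ((m.+1%:R * expR (x / m.+1%:R)) ^+ m)).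
  by rewrite lerXn2r// nnegrE// mulr_ge0 ?expR_ge0// ltW.
rewrite exprMn ler_pM2l ?exprn_gt0// -expRM_natl ler_expR mulrA ler_pdivrMr// mulrC.
by rewrite ler_wpM2l// ler_nat.
Qed.

Definition mono (p : nat * nat) q : R[i] := z1 q ^+ p.1 * z2 q ^+ p.2.

Lemma holomorphic_mono p : holomorphic a (mono p).
Proof. by apply: holomorphicM; apply: holomorphicX; exact: holomorphic_zeta. Qed.

Lemma wL2_mono p : L2 (mono p).
Proof.
have mp : @cmeas _ Q4 R (mono p) by exact/holomorphic_cmeas/holomorphic_mono.
split => //.
(* [pow_le_expR] bounds each factor of the monomial by a constant times an exponential; squaring
   gives this constant and the growth rates 2 and 2 used below. *)
pose C : R := (p.1.+1%:R ^+ p.1 * p.2.+1%:R ^+ p.2) ^+ 2.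
apply: (@le_Rintegral_of_integrable _ Q4 R leb_quat _
   (fun q => C * (expR ((2 ^+ 2 + 2 ^+ 2) / (4 * lam)) * gauss lam q))).
- by apply: measurable_funM => //; apply: measurable_funX; exact: cmeas_normc.
- by apply: integrable_mulrl; exact: frame_growth_integrable.
move=> q; rewrite ger0_norm; last by rewrite mulr_ge0 ?sqr_ge0.
apply: le_trans (ler_wpM2l (sqr_ge0 _) (frame_growth 2 2 q)); rewrite mulrA.
apply: ler_wpM2r => //; rewrite /mono cnormM !cnormX.
set x := Normc.normc _; set y := Normc.normc _.
have x0 : 0 <= x by exact: normc_ge0.
have y0 : 0 <= y by exact: normc_ge0.
rewrite expRD !expRM_natl /C -!exprMn; apply: lerXn2r; rewrite ?nnegrE.
- by rewrite mulr_ge0// exprn_ge0.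
- by rewrite !mulr_ge0 ?expR_ge0 ?exprn_ge0// ler0n.
rewrite mulrACA; apply: ler_pM; rewrite ?exprn_ge0//; exact: pow_le_expR.
Qed.

Lemma wip_symmetry (s : quat R -> quat R) (c c' : R[i]) F G :
  mpres leb_quat s -> (forall q, qdot (s q) (s q) = qdot q q) ->
  L2 F -> L2 G -> (forall q, F (s q) = c * F q) -> (forall q, G (s q) = c' * G q) ->
  ip F G = c * conjc c' * ip F G.
Proof.
move=> ms sn hF hG Fs Gs.
have iFG := @wip_integrable _ Q4 R leb_quat w w0 mw _ _ hF hG.
apply: etrans (esym (mpres_cintegral ms (cintegrable_meas iFG))) _.
apply: etrans (@cintegralZl _ Q4 R leb_quat _ (c * conjc c') iFG).
by apply: eq_cintegral => q; rewrite Fs Gs /gauss sn cconjM; ring.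
Qed.

Lemma ceix_cexp t : ceix t = cexp ('i%C * t%:C) :> R[i].
Proof.
by apply: complex_ext; rewrite /cexp !(cReE, cImE) !mul0r ?mul1r !subrr ?subr0 expR0 ?mul1r ?add0r ?addr0 ?mul0r ?mul1r.
Qed.

Lemma ceixD s t : ceix (s + t) = ceix s * ceix t :> R[i].
Proof. by rewrite !ceix_cexp -cexpD rmorphD mulrDr. Qed.

Lemma ceixX t n : ceix t ^+ n = ceix (n%:R * t) :> R[i].
Proof.
elim: n => [|n ih].
  by rewrite mul0r expr0 /ceix cos0 sin0.
by rewrite exprS ih -ceixD -[in RHS]natr1 mulrDl mul1r addrC.
Qed.

Lemma ceixJ t : conjc (ceix t) = ceix (- t) :> R[i].
Proof. by rewrite /ceix cosN sinN. Qed.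

Lemma mono_rot p t q : mono p (rot_by a t q) = ceix ((p.1 + p.2)%:R * t) * mono p q.
Proof.
rewrite /mono /fz1 /fz2 !zeta_rotE// !exprMn !ceixX natrD mulrDl ceixD; ring.
Qed.

Lemma mono_lrot p t q :
  mono p (lrot a t q) = ceix ((p.1%:R - p.2%:R) * t) * mono p q.
Proof.
rewrite /mono fz1_lrot// fz2_lrot// !exprMn !ceixX mulrBl ceixD mulrN; ring.
Qed.

(** At t = pi/x the phase is -1. *)
Lemma phase_zero (x : R) (z : R[i]) : x != 0 ->
  (forall t, z = ceix (x * t) * z) -> z = 0.
Proof.
move=> x0 H; have := H (pi / x); rewrite mulrCA divff// mulr1 /ceix cospi sinpi.
rewrite (_ : (-1) +i* 0 = -1 :> R[i]); last first.
  by apply: complex_ext; rewrite ?(cReN, cImN) //= oppr0.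
rewrite mulN1r => /eqP; rewrite -addr_eq0 -mulr2n -mulr_natl mulf_eq0 => /orP[|/eqP//].
by rewrite pnatr_eq0.
Qed.

(* The isometries q |-> q e^{ut} and q |-> e^{ut} q multiply z1^m z2^n by
   e^{i(m+n)t} and e^{i(m-n)t}, which separate the monomials. *)
Lemma mono_orth p p' : p != p' -> ip (mono p) (mono p') = 0.
Proof.
move=> pp'.
have H1 t : ip (mono p) (mono p') =
    ceix (((p.1 + p.2)%:R - (p'.1 + p'.2)%:R) * t) * ip (mono p) (mono p').
  rewrite {1}(@wip_symmetry _ _ _ _ _ (mpres_rot a0 t) (rot_norm a0 t)
    (wL2_mono p) (wL2_mono p') (mono_rot p t) (mono_rot p' t)).
  by rewrite ceixJ -ceixD mulrBl.
have H2 t : ip (mono p) (mono p') =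
    ceix (((p.1%:R - p.2%:R) - (p'.1%:R - p'.2%:R)) * t) * ip (mono p) (mono p').
  rewrite {1}(@wip_symmetry _ _ _ _ _ (mpres_lrot a0 t) (qdot_lrot a0 t)
    (wL2_mono p) (wL2_mono p') (mono_lrot p t) (mono_lrot p' t)).
  by rewrite ceixJ -ceixD; congr (ceix _ * _); ring.
(* The inner product can be nonzero only if the sums and the differences of the exponents both
   agree, which forces equal pairs. *)
have [E1|/phase_zero] := eqVneq ((p.1 + p.2)%:R - (p'.1 + p'.2)%:R : R) 0; last exact.
have [E2|/phase_zero] := eqVneq ((p.1%:R - p.2%:R) - (p'.1%:R - p'.2%:R) : R) 0; last exact.
move: pp' E1 E2; case: p p' {H1 H2} => [m n] [m' n'] /=; rewrite !natrD => + E1 E2.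
have e1 : m%:R = m'%:R :> R by lra.
have e2 : n%:R = n'%:R :> R by lra.
by move/eqP: e1; move/eqP: e2; rewrite !eqr_nat => /eqP -> /eqP ->; rewrite eqxx.
Qed.

Lemma ccvg_unique_eventually (s : nat -> R[i]) (l c : R[i]) : ccvg s l ->
  (exists N0, forall N, (N0 <= N)%N -> s N = c) -> l = c.
Proof.
move=> [sR sI] [N0 H].
have G (f : R[i] -> R) : (fun n => f (s n)) @ \oo --> f l -> f l = f c.
  move=> fs; suff fc : (fun n => f (s n)) @ \oo --> f c.
    exact: cvg_unique fs fc.
  apply: cvg_near_cst; exists N0 => // N /= N0N.
  by rewrite H.
by apply: complex_ext; apply: G.
Qed.

Lemma ccvgM (s t : nat -> R[i]) (l m : R[i]) : ccvg s l -> ccvg t m ->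
  ccvg (fun n => s n * t n) (l * m).
Proof.
move=> [sR sI] [tR tI]; split.
  by under eq_fun do rewrite cReM; rewrite cReM; apply: cvgB; exact: cvgM.
by under eq_fun do rewrite cImM; rewrite cImM; apply: cvgD; exact: cvgM.
Qed.

Lemma ccvg_cst (c : R[i]) : ccvg (fun=> c) c.
Proof. by split; exact: cvg_cst. Qed.

Lemma ccvgJ (s : nat -> R[i]) (l : R[i]) : ccvg s l ->
  ccvg (fun n => conjc (s n)) (conjc l).
Proof.
move=> [sR sI]; split.
  by under eq_fun do rewrite cReJ; rewrite cReJ.
by under eq_fun do rewrite cImJ; rewrite cImJ; exact: cvgN.
Qed.

(** Read off from the power series of the reproducing kernel, not from the norm of a monomial;
    [nmono_orth] shows afterwards that it normalizes. *)
Definition mono_wt (p : nat * nat) : R :=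
  Num.sqrt (repc a * ((2 * lam) ^+ p.1 / p.1`!%:R) * ((2 * lam) ^+ p.2 / p.2`!%:R)).

Let term_gt0 k : 0 < (2 * lam) ^+ k / k`!%:R.
Proof. by rewrite divr_gt0 ?exprn_gt0 ?mulr_gt0// ltr0n fact_gt0. Qed.

Lemma mono_wt_gt0 p : 0 < mono_wt p.
Proof. by rewrite sqrtr_gt0; apply: mulr_gt0 => //; apply: mulr_gt0 => //; exact: repc_gt0. Qed.

Lemma mono_wt_sqr p : mono_wt p ^+ 2 =
  repc a * ((2 * lam) ^+ p.1 / p.1`!%:R) * ((2 * lam) ^+ p.2 / p.2`!%:R).
Proof.
rewrite sqr_sqrtr//; apply: ltW; apply: mulr_gt0 => //; apply: mulr_gt0 => //.
exact: repc_gt0.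
Qed.

Definition nmono p q : R[i] := (mono_wt p)%:C * mono p q.

Lemma holomorphic_nmono p : holomorphic a (nmono p).
Proof. by apply: holomorphicM; [exact: holomorphic_cst|exact: holomorphic_mono]. Qed.

Lemma wL2_nmono p : L2 (nmono p).
Proof. by apply: wL2Z; exact: wL2_mono. Qed.

Definition box N : seq (nat * nat) := [seq (m, n) | m <- iota 0 N, n <- iota 0 N].

Lemma box_uniq N : uniq (box N).
Proof. by apply: allpairs_uniq; rewrite ?iota_uniq// => -[? ?] [? ?]. Qed.

Lemma mem_box N p : (p \in box N) = (p.1 < N)%N && (p.2 < N)%N.
Proof.
case: p => m n; apply/allpairsP/andP => [[[i j] /= [+ + [-> ->]]]|[/= mN nN]].
  by rewrite !mem_iota /= !add0n.
by exists (m, n); rewrite !mem_iota.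
Qed.

Definition kernel_sum N v q : R[i] := \sum_(p <- box N) conjc (nmono p v) * nmono p q.

(** Over a square box the double sum factors into two truncated exponentials, whose bounds and
    limits are known. *)
Lemma kernel_sumE N v q : kernel_sum N v q = (repc a)%:C *
  (cexp_sum N ((2 * lam)%:C * (z1 q * conjc (z1 v))) *
   cexp_sum N ((2 * lam)%:C * (z2 q * conjc (z2 v)))).
Proof.
rewrite /kernel_sum /box big_allpairs /cexp_sum.
rewrite -[in RHS](big_mkord predT (fun k => ((2 * lam)%:C * (z1 q * conjc (z1 v))) ^+ k * (k`!%:R^-1)%:C)).
rewrite -[in RHS](big_mkord predT (fun k => ((2 * lam)%:C * (z2 q * conjc (z2 v))) ^+ k * (k`!%:R^-1)%:C)).
rewrite /index_iota subn0 big_distrl mulr_sumr; apply: eq_bigr => m _.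
rewrite big_distrr mulr_sumr; apply: eq_bigr => n _.
have cX (z : R[i]) k : conjc (z ^+ k) = conjc z ^+ k by rewrite rmorphXn.
rewrite /nmono /mono !cconjM cconj_real !cX.
have E : (mono_wt (m, n))%:C * (mono_wt (m, n))%:C =
    (repc a)%:C * ((2 * lam)%:C ^+ m * (m`!%:R^-1)%:C) * ((2 * lam)%:C ^+ n * (n`!%:R^-1)%:C).
  have cM (x y : R) : (x * y)%:C = x%:C * y%:C by exact: rmorphM.
  have cX' (x : R) k : (x ^+ k)%:C = x%:C ^+ k by exact: rmorphXn.
  by rewrite -cM -expr2 mono_wt_sqr -!cX' -!cM.
move: (z1 q) (z2 q) (conjc (z1 v)) (conjc (z2 v)) ((2 * lam)%:C) E => x y x' y' l E.
rewrite !exprMn [LHS](_ : _ = (mono_wt (m, n))%:C * (mono_wt (m, n))%:C *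
  (x ^+ m * x' ^+ m * (y ^+ n * y' ^+ n))); last by ring.
by rewrite E [GRing.mul]lock /= -lock; ring.
Qed.

Lemma kernel_sum_cvg v q : ccvg (fun N => kernel_sum N v q) ((repc a)%:C * kernelK a v q).
Proof.
under eq_fun do rewrite kernel_sumE.
apply: ccvgM; first exact: ccvg_cst.
rewrite /kernelK (zeta_frame a0 h2_re h2_norm h2_dir) mulrDr cexpD.
by apply: ccvgM; exact: cexp_sum_cvg.
Qed.

(** A majorant independent of N, for dominated convergence. Squaring doubles the rate 2 lam of each
    exponential, whence the 4 lam. *)
Lemma kernel_sum_bound N v q : Normc.normc (kernel_sum N v q) ^+ 2 * w q <=
  repc a ^+ 2 * (expR (((4 * lam * Normc.normc (z1 v)) ^+ 2 +
                        (4 * lam * Normc.normc (z2 v)) ^+ 2) / (4 * lam)) * gauss lam q).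
Proof.
apply: le_trans (ler_wpM2l (sqr_ge0 _) (frame_growth _ _ q)).
rewrite mulrA; apply: ler_wpM2r => //.
rewrite kernel_sumE cnormM normc_real exprMn real_normK ?num_real//.
apply: ler_wpM2l; first exact: sqr_ge0.
rewrite cnormM exprMn expRD; apply: ler_pM; rewrite ?sqr_ge0//.
  rewrite (_ : 4 * lam * _ * _ = 2%:R * (2 * lam * (Normc.normc (z1 q) * Normc.normc (z1 v)))).
    rewrite expRM_natl lerXn2r ?nnegrE ?normc_ge0 ?expR_ge0//.
    apply: le_trans (normc_cexp_sum _ _) _.
    by rewrite !cnormM normc_real cnormJ ger0_norm// mulr_ge0// ltW.
  by ring.
rewrite (_ : 4 * lam * _ * _ = 2%:R * (2 * lam * (Normc.normc (z2 q) * Normc.normc (z2 v)))).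
  rewrite expRM_natl lerXn2r ?nnegrE ?normc_ge0 ?expR_ge0//.
  apply: le_trans (normc_cexp_sum _ _) _.
  by rewrite !cnormM normc_real cnormJ ger0_norm// mulr_ge0// ltW.
by ring.
Qed.

(** In the reproducing formula the kernel is the pointwise limit of its box sums; dominated
    convergence turns them into the partial sums for F, without any Taylor expansion of F. *)
Lemma mono_expansion F v : holomorphic a F -> L2 F ->
  ccvg (fun N => \sum_(p <- box N) ip F (nmono p) * nmono p v) (F v).
Proof.
move=> hF lF; rewrite (reproducing a0 v hF lF).
have lS N : L2 (kernel_sum N v).
  by apply: (@wL2_sum _ Q4 R leb_quat w w0 mw) => p; apply: wL2Z; exact: wL2_nmono.
have E N : \sum_(p <- box N) ip F (nmono p) * nmono p v = ip F (kernel_sum N v).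
  rewrite (@wipC _ Q4 R leb_quat w w0 mw _ _ (lS N) lF).
  rewrite (@wip_suml _ Q4 R leb_quat w w0 mw _ _ _ _ _ wL2_nmono lF).
  rewrite rmorph_sum; apply: eq_bigr => p _ /=.
  rewrite cconjM cconjK mulrC; congr (_ * _).
  by rewrite -(@wipC _ Q4 R leb_quat w w0 mw _ _ (wL2_nmono p) lF).
under eq_fun do rewrite E.
have lK : L2 (fun q => (repc a)%:C * kernelK a v q) by apply: wL2Z; exact: wL2_K.
have -> : (repc a)%:C * ip F (kernelK a v) = ip F (fun q => (repc a)%:C * kernelK a v q).
  by rewrite (@wipZr _ Q4 R leb_quat w w0 mw _ _ _ (wL2_K a0 v) lF) cconj_real.
pose B : R := expR (((4 * lam * Normc.normc (z1 v)) ^+ 2 +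
                        (4 * lam * Normc.normc (z2 v)) ^+ 2) / (4 * lam)).
apply: (@cdominated_cvg _ Q4 R leb_quat _ _ (fun q => Normc.normc (F q) ^+ 2 * w q +
   repc a ^+ 2 * (B * gauss lam q))).
- by move=> N; apply: cintegrable_meas; exact: (@wip_integrable _ Q4 R leb_quat w w0 mw _ _ lF (lS N)).
- by apply: cintegrable_meas; exact: (@wip_integrable _ Q4 R leb_quat w w0 mw _ _ lF lK).
- move=> q; apply: ccvgM; last exact: ccvg_cst.
  by apply: ccvgM; [exact: ccvg_cst|apply: ccvgJ; exact: kernel_sum_cvg].
- apply: integrable_addr; first by case: lF.
  by do 2 apply: integrable_mulrl; exact: integrable_gauss.
- move=> N q; apply: (@le_trans _ _ (Normc.normc (F q) ^+ 2 * w q +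
    Normc.normc (kernel_sum N v q) ^+ 2 * w q)).
    rewrite !cnormM normc_real cnormJ ger0_norm// -mulrDl.
    by apply: ler_wpM2r => //; exact: amgm.
  by apply: lerD => //; exact: kernel_sum_bound.
Qed.

(** A point where both coordinates equal 1, hence where no monomial vanishes. *)
Lemma mono_diag p : mono p ((1, 0, 0, 0) + h2) = 1.
Proof.
set q1 : quat R := (1, 0, 0, 0).
have q11 : qdot q1 q1 = 1 by rewrite qdotE /=; ring.
have Jq1 : J q1 = u.
  rewrite qrotE; case: (unit_dir a) => [[[? ?] ?] ?].
  by rewrite /qmul /=; congr (_, _, _, _); ring.
have hq : qdot h2 q1 = 0 by rewrite qdotE /= h2_re; ring.
have uq : qdot q1 u = 0.
  by rewrite qdotE unit_dir_re /=; ring.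
have E1 : z1 (q1 + h2) = 1.
  by apply: complex_ext; rewrite /fz1 /zeta !(cRe_mk, cIm_mk) -/q1 ?Jq1 !qdotDl
    ?q11 ?hq ?uq ?h2_dir addr0.
have E2 : z2 (q1 + h2) = 1.
  apply: complex_ext; rewrite /fz2 /zeta !(cRe_mk, cIm_mk) !qdotDl.
    by rewrite h2_norm (qdotC q1) hq add0r.
  rewrite (qdotC h2) qdot_rot_self// -[qdot q1 _]opprK -qdot_rotl// Jq1 qdotC h2_dir.
  by rewrite oppr0 addr0.
by rewrite /mono E1 E2 !expr1n mulr1.
Qed.

(** For the norm, [nmono p] is expanded at the point of [mono_diag]. By orthogonality the box sums
    are eventually its squared norm times its value there, and they tend to that value, which is
    nonzero. *)
Lemma nmono_orth p p' : ip (nmono p) (nmono p') = (p == p')%:R.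
Proof.
have lm := wL2_mono; have ln := wL2_nmono.
have O r r' : r != r' -> ip (nmono r) (nmono r') = 0.
  move=> rr'; rewrite /nmono (@wipZl _ Q4 R leb_quat w w0 mw _ _ _ (lm r) (ln r')).
  by rewrite (@wipZr _ Q4 R leb_quat w w0 mw _ _ _ (lm r') (lm r)) mono_orth// !mulr0.
have [<-|] := eqVneq p p'; last exact: O.
pose v : quat R := (1, 0, 0, 0) + h2.
have v0 : nmono p v != 0.
  rewrite /nmono mono_diag mulr1; apply/eqP => /(congr1 (@complex.Re R)).
  by rewrite cRe_real /= => H; have := mono_wt_gt0 p; rewrite H ltxx.
apply: (mulIf v0); rewrite mul1r; apply: esym.
apply: (ccvg_unique_eventually (mono_expansion v (holomorphic_nmono p) (ln p))).
exists (maxn p.1 p.2).+1 => N; rewrite gtn_max => /andP[h1 h2'].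
have pN : p \in box N by rewrite mem_box h1 h2'.
rewrite (perm_big _ (perm_to_rem pN)) big_cons /= big1_seq ?addr0// => r /andP[_].
rewrite (mem_rem_uniq _ (box_uniq N)) !inE => /andP[rp _].
by rewrite O ?mul0r// eq_sym.
Qed.

Lemma monomial_basis : exists e, orthonormal_basis a e.
Proof.
have /card_set_bijP[b [_ bI bS]] : ([set: nat] #= [set: nat * nat])%card.
  by rewrite card_eq_sym; exact: card_nat2.
have bI' : injective b by move=> i j; apply: bI; rewrite inE.
exists (fun n => nmono (b n)); split.
- by move=> n; apply: wL2_fock; [exact: holomorphic_nmono|exact: wL2_nmono].
- by move=> m n; rewrite fock_innerE nmono_orth inj_eq.
move=> F fF; have lF := fock_wL2 fF; have [hF _] := fF.
(* Only surjectivity of the enumeration is used: every finite set of pairs lies in an initial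
   segment. *)
have rb N : exists n, {subset box N <= map b (iota 0 n)}.
  elim: (box N) => [|p s [n IH]]; first by exists 0%N.
  have [k _ kp] := bS p I; exists (maxn n k.+1) => r; rewrite inE => /orP[/eqP ->|/IH].
    by rewrite -kp map_f// mem_iota /= add0n leq_max leqnn orbT.
  move=> rm; have /mapP[i + ->] : r \in map b (iota 0 n) by exact: rm.
  rewrite mem_iota /= add0n => ni.
  by rewrite map_f// mem_iota /= add0n leq_max ni.
have := @expansion_onb _ Q4 R leb_quat w w0 mw _ nmono wL2_nmono nmono_orth box b
  box_uniq bI' rb F lF (fun x => mono_expansion x hF lF).
pose D n q := F q - \sum_(0 <= k < n) ip F (nmono (b k)) * nmono (b k) q.
have lD n : L2 (D n).
  apply: (@wL2B _ Q4 R leb_quat w w0 mw) => //.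
  apply: (@wL2_sum _ Q4 R leb_quat w w0 mw) => i; apply: wL2Z; exact: wL2_nmono.
have E n : fock_norm2 a (fun q => F q - \sum_(i < n) fock_inner a F (nmono (b i)) * nmono (b i) q)
    = (n2 (D n))%:E.
  rewrite -fock_norm2E//; congr fock_norm2; apply/funext => q.
  rewrite /D big_mkord; apply: (congr1 (fun s => F q - s)); apply: eq_bigr => i _.
  by rewrite fock_innerE.
move=> H; under eq_fun do rewrite E.
by apply: cvg_EFin => //; exact: nearW.
Qed.

End Monomials.

(** Shows that the choice in [fock_basis] succeeds and does not fall back on the zero family. *)
Lemma fock_basis_onb (R : realType) (a : imquat R) : a <> 0 ->
  orthonormal_basis a (fock_basis a).
Proof.
move=> a0; apply: (@xgetPex _ _ [set e | orthonormal_basis a e]).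
by have [h2 [? ? ?]] := exists_orthogonal_unit a0; exact: (@monomial_basis R a a0 h2).
Qed.

(** * Plancherel identity for a fixed frequency *)

Section ScaledMaps.
Context d (T : measurableType d) (R : realType).
Variable mu : {measure set T -> \bar R}.
Variables (s : T -> T) (c : R).
Hypothesis ms : measurable_fun setT s.
Hypothesis c0 : 0 <= c.
Hypothesis sc : forall f : T -> \bar R, measurable_fun setT f -> (forall x, 0 <= f x)%E ->
  (\int[mu]_x f (s x) = c%:E * \int[mu]_x f x)%E.

Lemma scaled_Rintegral (h : T -> R) : mu.-integrable setT (EFin \o h) ->
  \int[mu]_x h (s x) = c * \int[mu]_x h x.
Proof.
move=> ih; have [mh _] := integrableP _ _ _ ih.
have ip := integrable_funepos measurableT ih; have im := integrable_funeneg measurableT ih.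
rewrite /Rintegral integralE [in RHS]integralE.
have -> : (\int[mu]_x (fun x => (h (s x))%:E)^\+ x = c%:E * \int[mu]_x (EFin \o h)^\+ x)%E.
  rewrite (funepos_comp (EFin \o h) s).
  exact: (sc (measurable_funepos mh) (funepos_ge0 _)).
have -> : (\int[mu]_x (fun x => (h (s x))%:E)^\- x = c%:E * \int[mu]_x (EFin \o h)^\- x)%E.
  rewrite (funeneg_comp (EFin \o h) s).
  exact: (sc (measurable_funeneg mh) (funeneg_ge0 _)).
have Fp := integrable_fin_num measurableT ip; have Fm := integrable_fin_num measurableT im.
rewrite -[fun x0 : T => (h x0)%:E]/(EFin \o h) -(fineK Fp) -(fineK Fm).
by rewrite -!EFinM -!EFinB /= mulrBr.
Qed.

Lemma scaled_cintegral (f : T -> R[i]) : cintegrable mu f ->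
  cintegral mu (fun x => f (s x)) = c%:C * cintegral mu f.
Proof.
move=> [fR fI]; apply: complex_ext.
  rewrite cReM cRe_real cIm_real mul0r subr0 /cintegral !cRe_mk.
  exact: (scaled_Rintegral fR).
rewrite cImM cRe_real cIm_real mul0r addr0 /cintegral !cIm_mk.
exact: (scaled_Rintegral fI).
Qed.

End ScaledMaps.

Section HilbertSchmidt.
Variable R : realType.
Variable a : imquat R.
Hypothesis a0 : a <> 0.
Local Notation J := (qrot a).
Local Notation lam := (imabs a).
Local Notation mR := (measurableTypeR R).
Local Notation Q4 := (mR * mR * mR * mR)%type.
Local Notation leb2 := (prod_measure (@leb_quat R) (@leb_quat R)).
Implicit Types (q h x y : quat R).

Let lam0 : 0 < lam. Proof. exact: lam_gt0. Qed.

(** The mean value property is applied to the holomorphic function e^{- al zeta_h}. Translating by a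
    real multiple of h completes the square: the growth of the modulus becomes the constant [c] and
    only the phase remains. *)
Lemma gauss_phase (e al : R) h : 0 < e ->
  cintegral leb_quat (fun q => (gauss e q)%:C * cexp ('i%C * (al * qdot (J q) h)%:C)) =
  ((pi / e) ^+ 2 * expR (- (al ^+ 2 * qdot h h / (4 * e))))%:C.
Proof.
move=> e0.
pose F q := cexp (- al%:C * zeta a h q).
have hF : holomorphic a F.
  by apply: holomorphic_cexp; apply: holomorphicM; [exact: holomorphic_cst|exact: holomorphic_zeta].
pose G q : R[i] := (gauss e q)%:C * cexp ('i%C * (al * qdot (J q) h)%:C).
pose v := (- (al / (2 * e))) *: h.
pose c : R := expR (al ^+ 2 * qdot h h / (4 * e)).
have E q : F (q + v) * (gauss e (q + v))%:C = c%:C * G q.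
  rewrite /F /G /gauss /c -!cexp_real -!cexpD; congr cexp.
  apply: complex_ext; rewrite /zeta /v !(cReE, cImE) !qdotLE.
    by rewrite (qdotC h q); field; rewrite gt_eqF.
  by rewrite qdot_rotl// (qdotC h) qdot_rot_self//; ring.
have iG : cintegrable leb_quat G.
  apply: (@cintegrable_le _ Q4 R leb_quat _ (gauss e)).
  - apply: cmeasM; first by apply: cmeas_real; exact: measurable_gauss.
    apply: cmeas_cexp; apply: cmeasM; first exact: cmeas_cst.
    apply: cmeas_real; apply: measurable_funM => //; apply: measurable_qdot => //.
    exact: measurable_rot.
  - exact: integrable_gauss.
  - move=> q; rewrite /G cnormM normc_real normc_cexp cReM cRe_i cIm_real mul0r mulr0 subrr expR0.
    by rewrite mulr1 ger0_norm// gauss_ge0.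
have iF : cintegrable leb_quat (fun q => F q * (gauss e q)%:C).
  have := mpres_cintegrable (mpres_quat (- v)) (cintegrableZl c%:C iG).
  by congr cintegrable; apply/funext => q; rewrite -E -addrA addNr addr0.
have := cgauss_mean a0 e0 hF iF.
have -> : cintegral leb_quat (fun q => F q * (gauss e q)%:C) = c%:C * cintegral leb_quat G.
  apply: etrans (esym (mpres_cintegral (mpres_quat v) (cintegrable_meas iF))) _.
  by apply: etrans (@eq_cintegral _ Q4 R leb_quat _ _ E) _; exact: cintegralZl.
rewrite /F zeta0 mulr0 cexp0 mul1r => H.
have cc : c != 0 by rewrite gt_eqF// expR_gt0.
have cc' : c%:C != 0 :> R[i].
  by apply/eqP => /(congr1 (@complex.Re R)); rewrite cRe_real; apply/eqP.
apply: (mulfI cc').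
rewrite H expRN -rmorphM /= -/c; congr (_%:C); field.
by rewrite cc gt_eqF.
Qed.

(* Turns the approximate identity in x - y, of width r, into a fixed Gaussian. *)
Definition shear (r : R) (z : Q4 * Q4) : Q4 * Q4 :=
  ((r *: (z.1 : quat R) + (z.2 : quat R) : quat R), z.2).

Lemma measurable_shear r : measurable_fun setT (shear r).
Proof.
apply: measurable_fun_pair; last exact: measurable_snd.
apply: measurable_quatD; last exact: measurable_snd.
apply: measurable_quatZ; [exact: measurable_cst|exact: measurable_fst].
Qed.

Lemma shear_scale (r : R) (f : Q4 * Q4 -> \bar R) : 0 < r ->
  measurable_fun setT f -> (forall z, 0 <= f z)%E ->
  (\int[leb2]_z f (shear r z) = (r ^- 4)%:E * \int[leb2]_z f z)%E.
Proof.
move=> r0 mf f0.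
have mfs : measurable_fun setT (f \o shear r).
  by apply: measurableT_comp => //; exact: measurable_shear.
transitivity (\int[leb_quat]_y \int[leb_quat]_x (f \o shear r) (x, y))%E.
  exact: (@prod_tonelli2 _ _ Q4 Q4 R leb_quat leb_quat _ mfs (fun z => f0 _)).
rewrite (@prod_tonelli2 _ _ Q4 Q4 R leb_quat leb_quat _ mf f0).
have my y : measurable_fun [set: Q4] (fun x : Q4 => f (x, y)).
  by apply: measurableT_comp => //; exact: measurable_pair2.
rewrite -ge0_integralZl//; last 3 first.
- by apply: measurable_fun_fubini_tonelli_G.
- by move=> y _; apply: integral_ge0.
- by rewrite lee_fin invr_ge0 exprn_ge0// ltW.
apply: eq_integral => y _ /=.
have mxy : measurable_fun [set: Q4] (fun x : Q4 => f ((x : quat R) + (y : quat R), y)).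
  apply: (measurableT_comp (my y)); apply: measurable_quatD => //.
apply: etrans (integral_quat_scale r0 mxy _) _ => //; congr (_ * _)%E.
by have [_ H] := mpres_quat y; exact: (H _ (my y) (fun x => f0 (x, y))).
Qed.

(** [g] stands for the partial Fourier transform of f at the frequency a. Continuity is used on the
    diagonal, boundedness and integrability for majorants. *)
Variable g : quat R -> R[i].
Hypothesis mg : @cmeas _ Q4 R g.
Hypothesis cg : forall (s : nat -> quat R) (l : quat R), s @ \oo --> l ->
  ccvg (fun n => g (s n)) (g l).
Variable M : R.
Hypothesis gM : forall q, Normc.normc (g q) <= M.
Hypothesis ig : leb_quat.-integrable [set: Q4] (EFin \o (fun q : Q4 => Normc.normc (g q))).
Variable e : nat -> quat R -> R[i].
Hypothesis one : orthonormal_basis a e.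

(** The image of the n-th basis function under the Fourier transform, multiplied by half of the
    weight: its unweighted L2 norm is the Fock norm of that image. *)
Definition fcoef n q := cintegral leb_quat (fun x : Q4 =>
  g x * cexp ('i%C * (2 * lam * qdot (J q) x)%:C) * psi a e n (q + x)).

(** The part of the kernel in the variables (x, y) that does not involve q. All dependence on q sits
    in the unimodular [phase], which oscillates with x - y, so integration over q concentrates on
    the diagonal. *)
Definition corr (z : Q4 * Q4) : R[i] := g z.1 * conjc (g z.2) *
  (gauss lam ((z.1 : quat R) - (z.2 : quat R)))%:C *
  cexp ('i%C * (2 * lam * qdot (z.1 : quat R) (J z.2))%:C).

Definition phase q (z : Q4 * Q4) : R[i] :=
  cexp ('i%C * (4 * lam * qdot (J q) ((z.1 : quat R) - (z.2 : quat R)))%:C).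

(* By fcoef_sum_cvg this is the sum over n of |fcoef n q|^2. *)
Definition hsdens q : R[i] := cintegral leb2 (fun z => (repc a)%:C * corr z * phase q z).

Lemma normc_phase (t : R) : Normc.normc (cexp ('i%C * t%:C)) = 1.
Proof. by rewrite normc_cexp cReM cRe_i cIm_real mul0r mulr0 subrr expR0. Qed.

Lemma cmeas_phase d (T : measurableType d) (t : T -> R) : measurable_fun setT t ->
  cmeas (fun s : T => cexp ('i%C * (t s)%:C)).
Proof.
move=> mt; apply: cmeas_cexp; apply: cmeasM; first exact: cmeas_cst.
exact: cmeas_real.
Qed.

Lemma cmeas_psi n : @cmeas _ Q4 R (psi a e n).
Proof.
apply: cmeasM.
  by have [/(_ n)[he _] _ _] := one; exact: holomorphic_cmeas he.
apply: cmeas_real.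
rewrite (_ : (fun q => _) = (gauss lam : Q4 -> R)) //.
exact: measurable_gauss.
Qed.

Let fint n q (x : Q4) := g x * cexp ('i%C * (2 * lam * qdot (J q) x)%:C) * psi a e n (q + x).

Let cmeas_fint n q : @cmeas _ Q4 R (fint n q).
Proof.
apply: cmeasM; first apply: cmeasM => //.
  apply: cmeas_phase; apply: measurable_funM => //; apply: measurable_qdot => //.
apply: (@cmeas_comp _ Q4 R (psi a e n) (fun x : Q4 => (q + (x : quat R) : quat R))).
  by apply: measurable_quatD => //.
exact: cmeas_psi.
Qed.

Let fint_integrable n q : cintegrable leb_quat (fint n q).
Proof.
apply: (@cintegrable_le _ Q4 R leb_quat _ (fun x : Q4 => Num.sqrt (repc a) * Normc.normc (g x))).
- exact: cmeas_fint.
- exact: integrable_mulrl.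
move=> x; rewrite /fint [X in X <= _]cnormM [Normc.normc (g x * _)]cnormM normc_phase mulr1 mulrC.
apply: ler_wpM2r; first exact: normc_ge0.
rewrite -[X in X <= _](ger0_norm (normc_ge0 _)) -sqrtr_sqr ler_wsqrtr//.
exact: normc_psi.
Qed.

Let igg : leb2.-integrable setT
  (EFin \o (fun z : Q4 * Q4 => Normc.normc (g z.1) * Normc.normc (g z.2))).
Proof. exact: (@integrable_prodM _ _ Q4 Q4 R leb_quat leb_quat _ _ ig ig). Qed.

Lemma cmeas_corr : cmeas corr.
Proof.
have m1 : measurable_fun setT (fst : Q4 * Q4 -> Q4) by exact: measurable_fst.
have m2 : measurable_fun setT (snd : Q4 * Q4 -> Q4) by exact: measurable_snd.
apply: cmeasM; first apply: cmeasM; first apply: cmeasM.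
- exact: cmeas_fst.
- by apply: cmeasJ; exact: cmeas_snd.
- apply: cmeas_real; apply: (@measurableT_comp _ _ _ _ Q4); first exact: measurable_gauss.
  by apply: measurable_quatD => //; exact: measurable_quatN.
- apply: cmeas_phase; apply: measurable_funM => //; apply: measurable_qdot => //.
  exact: (measurableT_comp (measurable_rot a) m2).
Qed.

Lemma normc_corr z : Normc.normc (corr z) <= Normc.normc (g z.1) * Normc.normc (g z.2).
Proof.
rewrite /corr !cnormM cnormJ normc_phase mulr1 normc_real ger0_norm ?gauss_ge0//.
rewrite ler_piMr ?mulr_ge0 ?normc_ge0//; apply: gauss_le1; exact: ltW.
Qed.

Lemma cmeas_phase2 : @cmeas _ (Q4 * (Q4 * Q4))%type R (fun p => phase p.1 p.2).
Proof.
apply: cmeas_phase; apply: measurable_funM => //; apply: measurable_qdot.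
  exact: (measurableT_comp (measurable_rot a) measurable_fst).
have m2 : measurable_fun setT (snd : Q4 * (Q4 * Q4) -> Q4 * Q4) by exact: measurable_snd.
apply: measurable_quatD; first exact: (measurableT_comp measurable_fst m2).
apply: measurable_quatN; exact: (measurableT_comp measurable_snd m2).
Qed.

(** Each squared modulus is a double integral; the sum over n then acts only on the kernel of the
    [psi], whose partial sums are bounded by 2 [repc], and dominated convergence applies. *)
Lemma fcoef_sum_cvg q :
  ccvg (fun N => (\sum_(0 <= n < N) Normc.normc (fcoef n q) ^+ 2)%:C) (hsdens q).
Proof.
have E n : (Normc.normc (fcoef n q) ^+ 2)%:C =
    cintegral leb2 (fun z => fint n q z.1 * conjc (fint n q z.2)).
  rewrite -mulcJ /fcoef -(@cintegralJ _ Q4 R leb_quat _ (fint_integrable n q)).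
  have iJ := cintegrableJ (fint_integrable n q).
  exact: esym (@cintegral_prodM _ _ Q4 Q4 R leb_quat leb_quat _ _ (fint_integrable n q) iJ).
have iE n : cintegrable leb2 (fun z : Q4 * Q4 => fint n q z.1 * conjc (fint n q z.2)).
  have iJ := cintegrableJ (fint_integrable n q).
  exact: (@cintegrable_prodM _ _ Q4 Q4 R leb_quat leb_quat _ _ (fint_integrable n q) iJ).
have ES N : (\sum_(0 <= n < N) Normc.normc (fcoef n q) ^+ 2)%:C =
    cintegral leb2 (fun z => \sum_(0 <= n < N) fint n q z.1 * conjc (fint n q z.2)).
  by rewrite cintegral_sum// rmorph_sum; apply: eq_bigr => n _; exact: E.
under eq_fun do rewrite ES.
have F N (z : Q4 * Q4) : \sum_(0 <= n < N) fint n q z.1 * conjc (fint n q z.2) =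
    g z.1 * cexp ('i%C * (2 * lam * qdot (J q) z.1)%:C) *
    conjc (g z.2 * cexp ('i%C * (2 * lam * qdot (J q) z.2)%:C)) *
    \sum_(0 <= n < N) psi a e n (q + z.1) * conjc (psi a e n (q + z.2)).
  by rewrite mulr_sumr; apply: eq_bigr => n _; rewrite /fint !cconjM; ring.
apply: (@cdominated_cvg _ (Q4 * Q4)%type R leb2 _ _ (fun z : Q4 * Q4 =>
    2 * repc a * (Normc.normc (g z.1) * Normc.normc (g z.2)))).
- by move=> N; apply: cmeas_sum => n; exact: cintegrable_meas (iE n).
- apply: cmeasM; first by apply: cmeasM; [exact: cmeas_cst|exact: cmeas_corr].
  apply: cmeas_phase; apply: measurable_funM => //; apply: measurable_qdot => //.
  by apply: measurable_quatD; [exact: measurable_fst|apply: measurable_quatN; exact: measurable_snd].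
- move=> z; under eq_fun do rewrite F.
  (* The Gaussian depends only on x - y, so q cancels there. In the phases the skew-symmetry of J
     doubles the terms in <Jq, x> and <Jq, y>, whence the 4 lam in [phase]. *)
  have -> : (repc a)%:C * corr z * phase q z =
      g z.1 * cexp ('i%C * (2 * lam * qdot (J q) z.1)%:C) *
      conjc (g z.2 * cexp ('i%C * (2 * lam * qdot (J q) z.2)%:C)) *
      kerpsi a (q + z.1) (q + z.2).
    rewrite /corr /phase /kerpsi cconjM cexpJ.
    have -> : (q + z.1) - (q + z.2) = (z.1 : quat R) - z.2.
      by rewrite opprD addrACA subrr add0r.
    rewrite (_ : (repc a * _)%:C = (repc a)%:C * (gauss lam ((z.1 : quat R) - z.2))%:C); last exact: rmorphM.
    move: (g z.1) (conjc (g z.2)) (gauss lam _)%:C (repc a)%:C => A B C D.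
    rewrite [LHS](_ : _ = A * B * C * D * (cexp ('i%C * (2 * lam * qdot (z.1 : quat R) (J z.2))%:C) *
      cexp ('i%C * (4 * lam * qdot (J q) ((z.1 : quat R) - z.2))%:C))); last by ring.
    rewrite -cexpD [RHS](_ : _ = A * B * C * D *
      (cexp ('i%C * (2 * lam * qdot (J q) z.1)%:C) * cexp (conjc ('i%C * (2 * lam * qdot (J q) z.2)%:C)) *
       cexp ('i%C * (2 * lam * qdot (q + z.1) (J (q + z.2)))%:C))); last by ring.
    rewrite -!cexpD; congr (_ * cexp _).
    apply: complex_ext; rewrite !(cReE, cImE); first by ring.
    rewrite qrotD !qdotLE (qdotC q (J q)) qdot_rot_self// (qdotC (z.1 : quat R) (J q)).
    rewrite -[qdot q (J z.2)]opprK -qdot_rotl//; ring.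
  apply: ccvgM; first exact: ccvg_cst.
  exact: psi_kernel_cvg.
- by apply: integrable_mulrl.
- move=> N z; rewrite F !cnormM cnormJ cnormM !normc_phase !mulr1 mulrC.
  apply: ler_wpM2r; first by rewrite mulr_ge0 ?normc_ge0.
  exact: psi_kernel_bound.
Qed.

Lemma hsdens_real q : Im (hsdens q) = 0 /\ 0 <= Re (hsdens q).
Proof.
have [hR hI] := fcoef_sum_cvg q; split.
  apply: cvg_unique hI _ => //; exact: cvg_cst.
have <- : limn (fun N => Re ((\sum_(0 <= n < N) Normc.normc (fcoef n q) ^+ 2)%:C)) = Re (hsdens q).
  exact/cvg_lim.
apply: limr_ge; first by apply/cvg_ex; exists (Re (hsdens q)).
by apply: nearW => N; rewrite cRe_real; apply: sumr_ge0 => n _; exact: sqr_ge0.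
Qed.

Let hsint (p : Q4 * (Q4 * Q4)) := (repc a)%:C * corr p.2 * phase p.1 p.2.

Let cmeas_hsint : @cmeas _ (Q4 * (Q4 * Q4))%type R hsint.
Proof.
apply: cmeasM; last exact: cmeas_phase2.
by apply: cmeasM; [exact: cmeas_cst|exact: (@cmeas_snd _ _ Q4 (Q4 * Q4)%type R _ cmeas_corr)].
Qed.

Let cmeas_phase1 q : cmeas (phase q).
Proof.
apply: cmeas_phase; apply: measurable_funM => //; apply: measurable_qdot => //.
by apply: measurable_quatD; [exact: measurable_fst|apply: measurable_quatN; exact: measurable_snd].
Qed.

Let hsint_integrable q : cintegrable leb2 (fun z => hsint (q, z)).
Proof.
apply: (@cintegrable_le _ (Q4 * Q4)%type R leb2 _ (fun z : Q4 * Q4 =>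
    repc a * (Normc.normc (g z.1) * Normc.normc (g z.2)))).
- apply: cmeasM; last exact: cmeas_phase1.
  by apply: cmeasM; [exact: cmeas_cst|exact: cmeas_corr].
- exact: integrable_mulrl.
move=> z; rewrite /hsint /= cnormM [Normc.normc (_ * corr z)]cnormM normc_phase mulr1.
rewrite normc_real ger0_norm ?(ltW (repc_gt0 a0))//.
by apply: ler_wpM2l; [exact: ltW (repc_gt0 a0)|exact: normc_corr].
Qed.

Lemma cmeas_hsdens : @cmeas _ Q4 R hsdens.
Proof.
exact: (@measurable_cintegral1 _ _ Q4 (Q4 * Q4)%type R leb2 _ cmeas_hsint).
Qed.

(** After Fubini, [gauss_phase] turns the integral over q into (pi/r^2)^2 e^{-4 lam^2 |x-y|^2 /
    r^2}. The shear x = r x' + y contributes r^4, so every power of r disappears except inside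
    [corr]. *)
Lemma hsdens_gauss (r : R) : 0 < r ->
  cintegral leb_quat (fun q => hsdens q * (gauss (r ^+ 2) q)%:C) =
  (repc a * pi ^+ 2)%:C *
  cintegral leb2 (fun z => corr (shear r z) * (gauss (4 * lam ^+ 2) z.1)%:C).
Proof.
move=> r0; have r20 : 0 < r ^+ 2 by rewrite exprn_gt0.
pose K (p : Q4 * (Q4 * Q4)) := hsint p * (gauss (r ^+ 2) p.1)%:C.
have mK : @cmeas _ (Q4 * (Q4 * Q4))%type R K.
  apply: cmeasM; first exact: cmeas_hsint.
  by apply: cmeas_real; exact: (measurableT_comp (measurable_gauss _) measurable_fst).
(* The Gaussian in q is what makes this majorant integrable in all the variables together. *)
have bK p : Normc.normc (K p) <=
    gauss (r ^+ 2) p.1 * (repc a * (Normc.normc (g p.2.1) * Normc.normc (g p.2.2))).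
  rewrite /K /hsint 2!cnormM [Normc.normc (_ * corr _)]cnormM normc_phase mulr1 !normc_real.
  rewrite (ger0_norm (ltW (repc_gt0 a0))) (ger0_norm (gauss_ge0 _ _)) mulrC.
  apply: ler_wpM2l; first exact: gauss_ge0.
  by apply: ler_wpM2l; [exact: ltW (repc_gt0 a0)|exact: normc_corr].
have iK : cintegrable (prod_measure leb_quat leb2) K.
  apply: (cintegrable_le mK _ bK).
  apply: (@integrable_prodM _ _ Q4 (Q4 * Q4)%type R leb_quat leb2 (gauss (r ^+ 2))
    (fun z => repc a * (Normc.normc (g z.1) * Normc.normc (g z.2)))).
    exact: integrable_gauss.
  exact: integrable_mulrl.
have iK1 q : cintegrable leb2 (fun z => K (q, z)).
  have := cintegrableZl (gauss (r ^+ 2) q)%:C (hsint_integrable q).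
  by congr cintegrable; apply/funext => z; rewrite /K mulrC.
have iK2 z : cintegrable leb_quat (fun q => K (q, z)).
  apply: (@cintegrable_le _ Q4 R leb_quat _ (fun q => repc a *
    (Normc.normc (g z.1) * Normc.normc (g z.2)) * gauss (r ^+ 2) q)).
  - apply: cmeasM; last by apply: cmeas_real; exact: measurable_gauss.
    apply: (@cmeasM _ Q4 R (fun=> (repc a)%:C * corr z) (fun q => phase q z)).
      exact: cmeas_cst.
    apply: cmeas_phase; apply: measurable_funM => //; apply: measurable_qdot => //.
    exact: measurable_rot.
  - by apply: integrable_mulrl; exact: integrable_gauss.
  - by move=> q; rewrite mulrC; exact: (bK (q, z)).
transitivity (cintegral leb_quat (fun q => cintegral leb2 (fun z => K (q, z)))).
  apply: (@eq_cintegral _ Q4 R leb_quat) => q.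
  by rewrite /hsdens -(cintegralZr _ (hsint_integrable q)).
rewrite -(@cfubini1 _ _ Q4 (Q4 * Q4)%type R leb_quat leb2 K iK iK1).
rewrite (@cfubini2 _ _ Q4 (Q4 * Q4)%type R leb_quat leb2 K iK iK2).
pose F (z : Q4 * Q4) := corr z *
  (gauss (4 * lam ^+ 2 / r ^+ 2) ((z.1 : quat R) - (z.2 : quat R)))%:C.
have iF : cintegrable leb2 F.
  apply: (@cintegrable_le _ (Q4 * Q4)%type R leb2 _ (fun z : Q4 * Q4 =>
     Normc.normc (g z.1) * Normc.normc (g z.2))) => //.
    apply: cmeasM; first exact: cmeas_corr.
    apply: cmeas_real; apply: (@measurableT_comp _ _ _ _ Q4); first exact: measurable_gauss.
    by apply: measurable_quatD; [exact: measurable_fst|apply: measurable_quatN; exact: measurable_snd].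
  move=> z; rewrite /F cnormM normc_real ger0_norm ?gauss_ge0//.
  apply: le_trans (normc_corr z); rewrite ler_piMr ?normc_ge0//.
  by apply: gauss_le1; rewrite divr_ge0 ?sqr_ge0// mulr_ge0 ?sqr_ge0.
transitivity (cintegral leb2 (fun z => (repc a * (pi / r ^+ 2) ^+ 2)%:C * F z)).
  apply: (@eq_cintegral _ (Q4 * Q4)%type R leb2) => z.
  pose G q : R[i] := (gauss (r ^+ 2) q)%:C *
    cexp ('i%C * (4 * lam * qdot (J q) ((z.1 : quat R) - (z.2 : quat R)))%:C).
  transitivity (cintegral leb_quat (fun q => (repc a)%:C * corr z * G q)).
    by apply: (@eq_cintegral _ Q4 R leb_quat) => q; rewrite /K /hsint /G /phase /=; ring.
  have iG : cintegrable leb_quat G.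
    apply: (@cintegrable_le _ Q4 R leb_quat _ (gauss (r ^+ 2))).
    - apply: cmeasM; first by apply: cmeas_real; exact: measurable_gauss.
      apply: cmeas_phase; apply: measurable_funM => //; apply: measurable_qdot => //.
      exact: measurable_rot.
    - exact: integrable_gauss.
    - by move=> q; rewrite /G cnormM normc_phase mulr1 normc_real ger0_norm// gauss_ge0.
  rewrite (cintegralZl _ iG) /G gauss_phase// /F /gauss.
  rewrite [X in expR X](_ : _ = - (4 * lam ^+ 2 / r ^+ 2 *
    qdot ((z.1 : quat R) - (z.2 : quat R)) ((z.1 : quat R) - (z.2 : quat R)))); last first.
    by field; rewrite gt_eqF.
  move: (expR _) (corr z) => x y.
  by rewrite (rmorphM _ _ x) (rmorphM _ (repc a)) /=; ring.
have H : cintegral leb2 (fun z => F (shear r z)) = (r ^- 4)%:C * cintegral leb2 F.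
  by apply: (scaled_cintegral _ iF) => f mf f0; exact: shear_scale.
rewrite (cintegralZl _ iF).
have -> : cintegral leb2 F = (r ^+ 4)%:C * cintegral leb2 (fun z => F (shear r z)).
  by rewrite H mulrA -rmorphM /= mulfV ?mul1r// expf_neq0// gt_eqF.
have -> : cintegral leb2 (fun z => F (shear r z)) =
    cintegral leb2 (fun z => corr (shear r z) * (gauss (4 * lam ^+ 2) z.1)%:C).
  apply: (@eq_cintegral _ (Q4 * Q4)%type R leb2) => z.
  rewrite /F /gauss /= addrK !qdotLE; congr (_ * (expR (- _))%:C).
  by field; rewrite gt_eqF.
rewrite mulrA; congr (_ * _); rewrite -rmorphM /=; congr (_%:C).
by field; rewrite gt_eqF.
Qed.

Lemma hsdens_gauss_integrable (r : R) : 0 < r ->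
  cintegrable leb_quat (fun q => hsdens q * (gauss (r ^+ 2) q)%:C).
Proof.
move=> r0; have r20 : 0 < r ^+ 2 by rewrite exprn_gt0.
pose B := 2 * \int[leb2]_z (repc a * (Normc.normc (g z.1) * Normc.normc (g z.2))).
apply: (@cintegrable_le _ Q4 R leb_quat _ (fun q => B * gauss (r ^+ 2) q)).
- apply: cmeasM; first exact: cmeas_hsdens.
  by apply: cmeas_real; exact: measurable_gauss.
- by apply: integrable_mulrl; exact: integrable_gauss.
move=> q; rewrite cnormM normc_real ger0_norm ?gauss_ge0//.
apply: ler_wpM2r; first exact: gauss_ge0.
apply: le_trans (normc_cintegral_le (hsint_integrable q)) _.
rewrite ler_wpM2l//; apply: le_Rintegral => //.
- exact: cintegrable_normc.
- exact: integrable_mulrl.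
move=> z _; rewrite /hsint /= cnormM [Normc.normc (_ * corr z)]cnormM normc_phase mulr1.
rewrite normc_real ger0_norm ?(ltW (repc_gt0 a0))//.
by apply: ler_wpM2l; [exact: ltW (repc_gt0 a0)|exact: normc_corr].
Qed.

Lemma corr_diag y : corr (y, y) = (Normc.normc (g y) ^+ 2)%:C.
Proof.
rewrite /corr /= subrr /gauss qdot0l mulr0 oppr0 expR0 mulr1 (qdotC y) qdot_rot_self//.
by rewrite mulr0 mulr0 cexp0 mulr1 mulcJ.
Qed.

Lemma shear_cvg (z : Q4 * Q4) :
  (fun n => harmonic n *: (z.1 : quat R) + (z.2 : quat R)) @ \oo --> (z.2 : quat R).
Proof.
rewrite -[X in _ --> X]add0r -(scale0r (z.1 : quat R)).
by apply: cvgD; [apply: cvgZr_tmp; exact: cvg_harmonic|exact: cvg_cst].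
Qed.

Lemma ccvg_continuous (F : quat R -> R[i]) (s : nat -> quat R) (l : quat R) :
  ccontinuous F -> s @ \oo --> l -> ccvg (fun n => F (s n)) (F l).
Proof.
by move=> [cR cI] sl; split; [exact: (cvg_comp _ _ sl (cR l))|exact: (cvg_comp _ _ sl (cI l))].
Qed.

Lemma ccontinuous_realf (f : quat R -> R) : continuous f ->
  ccontinuous (fun x => (f x)%:C).
Proof. by move=> cf; split => x; [exact: cf|exact: cst_continuous]. Qed.

Lemma ccontinuous_cexp (F : quat R -> R[i]) : ccontinuous F ->
  ccontinuous (fun x => cexp (F x)).
Proof.
move=> [cR cI].
have cE x : (fun x => expR (Re (F x))) @ x --> expR (Re (F x)).
  exact: (cvg_comp _ _ (cR x) (@continuous_expR R _)).
split => x; rewrite /cexp.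
  by apply: cvgM; [exact: cE|exact: (cvg_comp _ _ (cI x) (@continuous_cos R _))].
by apply: cvgM; [exact: cE|exact: (cvg_comp _ _ (cI x) (@continuous_sin R _))].
Qed.

Lemma continuous_qdot_self : continuous (fun q : quat R => qdot q q).
Proof.
move=> q; under eq_fun do rewrite qdotE.
have c1 : (fst : quat R -> _) @ q --> q.1 by exact: cvg_fst.
have c11 : (fun q : quat R => q.1.1) @ q --> q.1.1.
  exact: (cvg_comp _ _ c1 cvg_fst).
have c111 : (fun q : quat R => q.1.1.1) @ q --> q.1.1.1.
  exact: (cvg_comp _ _ c11 cvg_fst).
have c112 : (fun q : quat R => q.1.1.2) @ q --> q.1.1.2.
  exact: (cvg_comp _ _ c11 cvg_snd).
have c12 : (fun q : quat R => q.1.2) @ q --> q.1.2.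
  exact: (cvg_comp _ _ c1 cvg_snd).
have c2 : (fun q : quat R => q.2) @ q --> q.2 by exact: cvg_snd.
by do 3 (apply: cvgD; last by apply: cvgM); apply: cvgM.
Qed.

Lemma corr_cvg (z : Q4 * Q4) :
  ccvg (fun n => corr (shear (harmonic n) z)) (corr (z.2, z.2)).
Proof.
have [cgR cgI] := cg (@shear_cvg z).
apply: ccvgM; first apply: ccvgM; first apply: ccvgM.
- by split.
- exact: ccvg_cst.
- split; last exact: cvg_cst.
  apply: (cvg_comp _ (@expR R) _ (@continuous_expR R _)); apply: cvgN.
  apply: cvgM; first exact: cvg_cst.
  have h : (fun n => harmonic n *: (z.1 : quat R) + (z.2 : quat R) - (z.2 : quat R)) @ \oo -->
      (z.2 : quat R) - (z.2 : quat R) by apply: cvgB; [exact: shear_cvg|exact: cvg_cst].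
  exact: (cvg_comp _ (fun q : quat R => qdot q q) h (@continuous_qdot_self _)).
- apply: (@ccvg_continuous (fun x => cexp ('i%C * (2 * lam * qdot x (J z.2))%:C)) _ _ _ (@shear_cvg z)).
  apply: ccontinuous_cexp; apply: ccontinuousM; first exact: ccontinuous_cst.
  apply: ccontinuous_realf => x; apply: cvgMl_tmp; exact: continuous_qdot.
Qed.

Let ig2 : leb_quat.-integrable [set: Q4] (EFin \o (fun q : Q4 => Normc.normc (g q) ^+ 2)).
Proof.
apply: (@le_Rintegral_of_integrable _ Q4 R leb_quat _ (fun q => M * Normc.normc (g q))).
- by apply: measurable_funX; exact: cmeas_normc.
- exact: integrable_mulrl.
by move=> q; rewrite ger0_norm ?sqr_ge0// expr2 ler_wpM2r// normc_ge0.
Qed.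

(** The sheared points tend to (y, y), where [corr] is |g(y)|^2; bounding only the first factor of g
    by M leaves a majorant independent of r. *)
Lemma corr_limit :
  ccvg (fun n => cintegral leb2 (fun z => corr (shear (harmonic n) z) *
                                     (gauss (4 * lam ^+ 2) z.1)%:C))
    ((pi / (4 * lam ^+ 2)) ^+ 2 * \int[leb_quat]_q (Normc.normc (g q) ^+ 2))%:C.
Proof.
have l0 : 0 < 4 * lam ^+ 2 by rewrite mulr_gt0// exprn_gt0.
have gi := integrable_gauss l0.
have rC (f : Q4 -> R) : leb_quat.-integrable setT (EFin \o f) ->
    cintegrable leb_quat (fun x => (f x)%:C).
  move=> fi; split => //.
  by rewrite (_ : _ \o _ = cst 0%E)//; exact: integrable0.
have <- : cintegral leb2 (fun z => corr (z.2, z.2) * (gauss (4 * lam ^+ 2) z.1)%:C) =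
    ((pi / (4 * lam ^+ 2)) ^+ 2 * \int[leb_quat]_q (Normc.normc (g q) ^+ 2))%:C.
  transitivity (cintegral leb2 (fun z => (gauss (4 * lam ^+ 2) z.1)%:C *
      (Normc.normc (g z.2) ^+ 2)%:C)).
    by apply: (@eq_cintegral _ (Q4 * Q4)%type R leb2) => z; rewrite corr_diag mulrC.
  rewrite (@cintegral_prodM _ _ Q4 Q4 R leb_quat leb_quat (fun x => (gauss (4 * lam ^+ 2) x)%:C)
    (fun y => (Normc.normc (g y) ^+ 2)%:C) (rC _ gi) (rC _ ig2)).
  rewrite !cintegral_real -rmorphM /= [X in X * _](_ : _ = (pi / (4 * lam ^+ 2)) ^+ 2)//.
  by rewrite /Rintegral integral_gauss.
apply: (@cdominated_cvg _ (Q4 * Q4)%type R leb2 _ _ (fun z => gauss (4 * lam ^+ 2) z.1 *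
   (M * Normc.normc (g z.2)))).
- move=> n; apply: cmeasM.
    apply: (@cmeas_comp _ (Q4 * Q4)%type R corr); last exact: cmeas_corr.
    exact: measurable_shear.
  by apply: cmeas_real; exact: (measurableT_comp (measurable_gauss _) measurable_fst).
- apply: cmeasM; last by apply: cmeas_real; exact: (measurableT_comp (measurable_gauss _) measurable_fst).
  under eq_fun do rewrite corr_diag.
  apply: cmeas_real; apply: measurable_funX; apply: cmeas_normc.
  exact: (@cmeas_snd _ _ Q4 Q4 R g mg).
- by move=> z; apply: ccvgM; [exact: corr_cvg|exact: ccvg_cst].
- apply: (@integrable_prodM _ _ Q4 Q4 R leb_quat leb_quat _ (fun y => M * Normc.normc (g y)) gi).
  exact: integrable_mulrl.
- move=> n z; rewrite cnormM normc_real ger0_norm ?gauss_ge0// mulrC.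
  apply: ler_wpM2l; first exact: gauss_ge0.
  by apply: le_trans (normc_corr _) _; rewrite ler_wpM2r ?normc_ge0.
Qed.

(** With r = [harmonic n] the Gaussians increase to 1. Since [hsdens] is nonnegative, monotone
    convergence computes its integral without prior knowledge that it is finite; [corr_limit] gives
    the value. *)
Lemma hsdens_integral : (\int[leb_quat]_q (Re (hsdens q))%:E =
  (pi ^+ 2 / (4 * lam ^+ 2) * \int[leb_quat]_q (Normc.normc (g q) ^+ 2))%:E)%E.
Proof.
pose G n (q : Q4) : \bar R := (Re (hsdens q) * gauss (harmonic n ^+ 2) q)%:E.
have [mR _] := cmeas_hsdens.
have mG n : measurable_fun setT (G n).
  by apply/measurable_EFinP; apply: measurable_funM => //; exact: measurable_gauss.
have G0 n q : setT q -> (0 <= G n q)%E.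
  by move=> _; rewrite lee_fin mulr_ge0 ?gauss_ge0//; have [] := hsdens_real q.
have ndG q : setT q -> nondecreasing_seq (G^~ q).
  move=> _; apply/nondecreasing_seqP => n; rewrite lee_fin ler_wpM2l//.
    by have [] := hsdens_real q.
  rewrite /gauss ler_expR lerN2 ler_wpM2r ?qdot_ge0//.
  by rewrite lerXn2r ?nnegrE ?invr_ge0// lef_pV2 ?posrE// ler_nat.
have := @cvg_monotone_convergence _ Q4 R leb_quat setT measurableT G mG G0 ndG.
have -> : (\int[leb_quat]_q limn (G^~ q) = \int[leb_quat]_q (Re (hsdens q))%:E)%E.
  apply: eq_integral => q _; apply/cvg_lim => //; apply: cvg_EFin; first exact: nearW.
  rewrite -[X in _ --> X]mulr1; apply: cvgM; first exact: cvg_cst.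
  rewrite -expR0; apply: (cvg_comp _ (@expR R) _ (@continuous_expR R _)).
  have h2 : (fun n => harmonic n * harmonic n : R) @ \oo --> (0 * 0 : R).
    by apply: cvgM; exact: cvg_harmonic.
  have := cvgN (cvgM h2 (cvg_cst (qdot q q))); rewrite mul0r mul0r oppr0; exact.
move=> H1; apply: cvg_unique H1 _ => //.
have E n : (\int[leb_quat]_q G n q)%E = (Re ((repc a * pi ^+ 2)%:C *
  cintegral leb2 (fun z => corr (shear (harmonic n) z) * (gauss (4 * lam ^+ 2) z.1)%:C)))%:E.
  have h0 : 0 < harmonic n :> R by rewrite /harmonic /= invr_gt0.
  rewrite -(hsdens_gauss h0) /cintegral cRe_mk.
  have [iR _] := hsdens_gauss_integrable h0.
  rewrite /Rintegral fineK; last exact: (integrable_fin_num _ iR).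
  by apply: eq_integral => q _; rewrite cReM cIm_real mulr0 subr0 cRe_real.
suff H2 : (fun n => (Re ((repc a * pi ^+ 2)%:C *
    cintegral leb2 (fun z => corr (shear (harmonic n) z) * (gauss (4 * lam ^+ 2) z.1)%:C)))%:E)
    @ \oo --> (pi ^+ 2 / (4 * lam ^+ 2) * \int[leb_quat]_q (Normc.normc (g q) ^+ 2))%:E.
  by move: H2; rewrite -(funext E); exact.
apply: cvg_EFin; first exact: nearW.
have [cR _] := ccvgM (@ccvg_cst R (repc a * pi ^+ 2)%:C) corr_limit.
have cM (x y : R) : Re (x%:C * y%:C) = x * y by rewrite cReM cIm_real mul0r subr0.
move: cR; rewrite cM.
set x := \int[_]_q _; have -> : repc a * pi ^+ 2 * ((pi / (4 * lam ^+ 2)) ^+ 2 * x) =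
  pi ^+ 2 / (4 * lam ^+ 2) * x; last by [].
rewrite (repcE a); have := pi_gt0 R; move: pi => p p0.
by field; rewrite !gt_eqF.
Qed.

Lemma cmeas_fcoef n : @cmeas _ Q4 R (fcoef n).
Proof.
apply: (@measurable_cintegral1 _ _ Q4 Q4 R leb_quat (fun p => fint n p.1 p.2)).
apply: cmeasM; first apply: cmeasM.
- exact: (@cmeas_snd _ _ Q4 Q4 R g mg).
- apply: cmeas_phase; apply: measurable_funM => //; apply: measurable_qdot; last exact: measurable_snd.
  exact: (measurableT_comp (measurable_rot a) measurable_fst).
have mD : measurable_fun setT (fun p : Q4 * Q4 => ((p.1 : quat R) + (p.2 : quat R) : quat R) : Q4).
  by apply: measurable_quatD; [exact: measurable_fst|exact: measurable_snd].
have [m1 m2] := cmeas_psi n.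
by split; [exact: (measurableT_comp m1 mD)|exact: (measurableT_comp m2 mD)].
Qed.

Lemma fcoef_plancherel :
  (\sum_(0 <= n <oo) \int[leb_quat]_q (Normc.normc (fcoef n q) ^+ 2)%:E =
   (pi ^+ 2 / (4 * lam ^+ 2) * \int[leb_quat]_q (Normc.normc (g q) ^+ 2))%:E)%E.
Proof.
rewrite -hsdens_integral -integral_nneseries//; last 2 first.
- move=> n; apply/measurable_EFinP; apply: measurable_funX; apply: cmeas_normc.
  exact: cmeas_fcoef.
- by move=> n q _; rewrite lee_fin sqr_ge0.
apply: eq_integral => q _; apply/cvg_lim => //.
have [cR _] := fcoef_sum_cvg q.
under eq_fun do rewrite sumEFin.
by apply: cvg_EFin; first exact: nearW.
Qed.

End HilbertSchmidt.

(** * Schwartz functions and the partial Fourier transform *)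

Section Majorants.
Variable R : realType.
Local Notation mR := (measurableTypeR R).
Local Notation Q4 := (mR * mR * mR * mR)%type.
Local Notation Q3 := (mR * mR * mR)%type.
Local Notation leb := (@lebesgue_measure R).
Implicit Types (x : quat R) (t : imquat R).

(** Majorants are products of one-variable weights, so that integrability on R^3 and R^4 follows
    from the arctangent integral. *)
Definition maj1 (y : R) : R := (1 + y ^+ 2)^-1.
Definition maj3 t : R := maj1 t.1.1 * maj1 t.1.2 * maj1 t.2.
Definition maj4 x : R := maj1 x.1.1.1 * maj1 x.1.1.2 * maj1 x.1.2 * maj1 x.2.

Let den_gt0 (y : R) : 0 < 1 + y ^+ 2.
Proof. by rewrite ltr_wpDr ?sqr_ge0. Qed.

Lemma maj1_gt0 y : 0 < maj1 y. Proof. by rewrite invr_gt0. Qed.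
Lemma maj1_le1 y : maj1 y <= 1.
Proof. by rewrite invf_le1// lerDl sqr_ge0. Qed.
Lemma maj3_gt0 t : 0 < maj3 t. Proof. by rewrite !mulr_gt0 ?maj1_gt0. Qed.
Lemma maj4_gt0 x : 0 < maj4 x. Proof. by rewrite !mulr_gt0 ?maj1_gt0. Qed.

Lemma maj3_le1 t : maj3 t <= 1.
Proof. by rewrite !mulr_ile1 ?mulr_ge0 ?maj1_le1 ?(ltW (maj1_gt0 _)). Qed.
Lemma maj4_le1 x : maj4 x <= 1.
Proof. by rewrite !mulr_ile1 ?mulr_ge0 ?maj1_le1 ?(ltW (maj1_gt0 _)). Qed.

Lemma continuous_maj1 : continuous maj1.
Proof. exact: continuous_oneDsqrV. Qed.

Lemma measurable_maj1 : measurable_fun [set: mR] maj1.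
Proof. by apply: continuous_measurable_fun; exact: continuous_maj1. Qed.

Lemma integrable_maj1 : leb.-integrable [set: mR] (EFin \o maj1).
Proof.
apply/integrableP; split; first by apply/measurable_EFinP; exact: measurable_maj1.
under eq_integral do rewrite /= ger0_norm ?(ltW (maj1_gt0 _))//.
rewrite ge0_symfun_integralT.
- rewrite (_ : [set x | _] = `[0%R, +oo[%classic); last first.
    by apply/seteqP; split => y /=; rewrite in_itv /= andbT.
  have -> : (\int[leb]_(x in `[0%R, +oo[) (maj1 x)%:E = (pi / 2)%:E)%E.
    exact: integral0y_oneDsqr.
  by rewrite -EFinM ltry.
- by move=> x; rewrite ltW// maj1_gt0.
- exact: continuous_maj1.
- by move=> x; rewrite /maj1 /= sqrrN.
Qed.

Lemma integrable_maj3 : leb_im.-integrable [set: Q3] (EFin \o maj3).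
Proof.
have i1 := integrable_maj1.
have i2 := @integrable_prodM _ _ mR mR R leb leb _ _ i1 i1.
exact: (@integrable_prodM _ _ (mR * mR)%type mR R (prod_measure leb leb) leb
  (fun p => maj1 p.1 * maj1 p.2) maj1 i2 i1).
Qed.

Lemma integrable_maj4 : leb_quat.-integrable [set: Q4] (EFin \o maj4).
Proof.
have i1 := integrable_maj1.
exact: (@integrable_prodM _ _ Q3 mR R (prod_measure (prod_measure leb leb) leb) leb
  maj3 maj1 integrable_maj3 i1).
Qed.

Lemma maj1_shift (y s : R) : `|s| <= 1 -> maj1 (y + s) <= 3 * maj1 y.
Proof.
move=> s1; have s2 : s ^+ 2 <= 1 by rewrite -real_normK ?num_real// exprn_ile1.
rewrite /maj1 -[leRHS]invrK lef_pV2 ?posrE//; last by rewrite invr_gt0 mulr_gt0 ?invr_gt0.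
rewrite invfM invrK mulrC ler_pdivrMr//.
have := sqr_ge0 (y + 2 * s); nra.
Qed.

(** Each of the three coordinates costs a factor 3, by [maj1_shift]. *)
Lemma maj3_shift t v (s : R) : `|v| <= 1 -> `|s| <= 1 ->
  maj3 (t + s *: v) <= 27 * maj3 t.
Proof.
case: t v => [[t1 t2] t3] [[v1 v2] v3]; rewrite !prod_normE /= !ge_max.
move=> /andP[/andP[h1 h2] h3] hs.
have H (b c : R) : `|c| <= 1 -> maj1 (b + s * c) <= 3 * maj1 b.
  by move=> c1; apply: maj1_shift; rewrite normrM mulr_ile1.
have -> : (27 : R) = 3 * 3 * 3 by ring.
rewrite /maj3 /= (_ : 3 * 3 * 3 * _ = 3 * maj1 t1 * (3 * maj1 t2) * (3 * maj1 t3)); last by ring.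
have m0 y := ltW (maj1_gt0 y).
by apply: ler_pM; rewrite ?mulr_ge0 ?m0 ?H//; apply: ler_pM; rewrite ?m0 ?H.
Qed.

(** Each of the 4 + 3 coordinates is paid for by a factor (1 + |p|)^2, whence 14. *)
Lemma norm_maj x t N (y : R) (p := (x, t) : heis R) :
  0 <= y -> (1 + `|t|) ^+ N * y <= (1 + `|p|) ^+ (N + 14) * y * (maj4 x * maj3 t).
Proof.
move=> y0; have p0 : 0 <= `|p| by exact: normr_ge0.
have le_t : `|t| <= `|p| by rewrite [`|p|]prod_normE le_max lexx orbT.
have le_x : `|x| <= `|p| by rewrite [`|p|]prod_normE le_max lexx.
have H (c : R) : `|c| <= `|p| -> 1 <= (1 + `|p|) ^+ 2 * maj1 c.
  move=> cp; rewrite /maj1 ler_pdivlMr// mul1r sqrrD expr1n mul1r.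
  have : c ^+ 2 <= `|p| ^+ 2 by rewrite -(real_normK (num_real c)) lerXn2r ?nnegrE.
  by move=> h; rewrite -addrA lerD2l (le_trans h)// lerDr mulrn_wge0.
rewrite mulrAC ler_wpM2r//.
have hN : (1 + `|t|) ^+ N <= (1 + `|p|) ^+ N.
  by rewrite lerXn2r ?nnegrE ?addr_ge0// lerD2l.
rewrite exprD (_ : (14 = 2 * 7)%N)// exprM -mulrA -[leLHS]mulr1.
have n0 : 0 <= (1 + `|t|) ^+ N by apply: exprn_ge0; rewrite addr_ge0.
apply: (ler_pM n0 ler01 hN).
have ms (a1 a2 : R) : 1 <= a1 -> 1 <= a2 -> 1 <= a1 * a2.
  by move=> h1 h2; rewrite (le_trans h1)// ler_peMr// (le_trans ler01).
rewrite /maj4 /maj3; move: le_x le_t H ms; move: `|p| => P {p p0 hN n0}.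
case: x t => [[[x0 x1] x2] x3] [[t1 t2] t3]; rewrite !prod_normE /= !ge_max.
move=> /andP[/andP[/andP[h0 h1] h2] h3] /andP[/andP[k1 k2] k3] H ms; set B := (1 + P) ^+ 2.
have -> : B ^+ 7 * (maj1 x0 * maj1 x1 * maj1 x2 * maj1 x3 * (maj1 t1 * maj1 t2 * maj1 t3)) =
  (B * maj1 x0) * ((B * maj1 x1) * ((B * maj1 x2) * ((B * maj1 x3) *
  ((B * maj1 t1) * ((B * maj1 t2) * (B * maj1 t3)))))) by ring.
by do 6 (apply: (ms); first exact: (H)); exact: (H).
Qed.

Lemma cderives_cat (V : normedModType R) (us vs : seq V) (f : V -> R[i]) :
  cderives (us ++ vs) f = cderives us (cderives vs f).
Proof. by rewrite /cderives foldr_cat. Qed.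

Lemma schwartz_cderives (V : normedModType R) (vs : seq V) (f : V -> R[i]) :
  schwartz f -> schwartz (cderives vs f).
Proof. by move=> sf us; rewrite -cderives_cat; exact: sf. Qed.

Lemma schwartz_decay (f : heis R -> R[i]) N : schwartz f ->
  exists2 C : R, 0 <= C &
    forall x t, (1 + `|t|) ^+ N * Normc.normc (f (x, t)) <= C * (maj4 x * maj3 t).
Proof.
move=> sf; have [_ /(_ (N + 14)%N)[C HC]] := sf [::]; exists (Num.max C 0).
  by rewrite le_max lexx orbT.
move=> x t; apply: le_trans (norm_maj x t N (normc_ge0 _)) _.
apply: ler_wpM2r; first exact: ltW (mulr_gt0 (maj4_gt0 x) (maj3_gt0 t)).
by apply: le_trans (HC (x, t)) _; rewrite le_max lexx.
Qed.

End Majorants.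
Arguments maj1 {R} y.
Arguments maj3 {R} t.
Arguments maj4 {R} x.

(** * Fourier transform in the central variable *)

Section PartialFourier.
Variable R : realType.
Local Notation mR := (measurableTypeR R).
Local Notation Q4 := (mR * mR * mR * mR)%type.
Local Notation Q3 := (mR * mR * mR)%type.
Implicit Types (x : quat R) (t a v : imquat R) (f : heis R -> R[i]).

Lemma schwartz_cmeas f : schwartz f -> @cmeas _ (Q4 * Q3)%type R f.
Proof.
move=> sf; have [df _] := sf [::].
by split; apply: continuous_measurable_heis => p;
  have [d1 d2] := df p; exact: differentiable_continuous.
Qed.

Lemma schwartz_cmeas1 f x : schwartz f -> @cmeas _ Q3 R (fun t => f (x, t)).
Proof.
move=> /schwartz_cmeas[m1 m2].
have mp : measurable_fun [set: Q3] (fun t : Q3 => (x : Q4, t)) by exact: measurable_pair1.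
by split; [exact: (measurableT_comp m1 mp)|exact: (measurableT_comp m2 mp)].
Qed.

(** The constant depends only on f and N: the same bound serves phases, polynomial moments and
    Taylor remainders, uniformly in a and x. *)
Lemma moment_bound f N : schwartz f -> exists2 C : R, 0 <= C &
  forall (k : imquat R -> R[i]) (c : R) x, 0 <= c -> @cmeas _ Q3 R k ->
    (forall t, Normc.normc (k t) <= c * (1 + `|t|) ^+ N) ->
    cintegrable leb_im (fun t => f (x, t) * k t) /\
    Normc.normc (cintegral leb_im (fun t => f (x, t) * k t)) <= c * C * maj4 x.
Proof.
move=> sf; have [C C0 HC] := schwartz_decay N sf.
have M0 : 0 <= \int[@leb_im R]_t maj3 t by apply: Rintegral_ge0 => t _; exact: ltW (maj3_gt0 t).
exists (2 * C * \int[leb_im]_t maj3 t); first by rewrite !mulr_ge0.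
move=> k c x c0 mk bk.
have B t : Normc.normc (f (x, t) * k t) <= c * C * maj4 x * maj3 t.
  rewrite cnormM; apply: le_trans (ler_wpM2l (normc_ge0 _) (bk t)) _.
  rewrite mulrCA [Normc.normc _ * _]mulrC -(mulrA (c * C)) -(mulrA c).
  by apply: ler_wpM2l => //; exact: HC.
have iM : leb_im.-integrable [set: Q3] (EFin \o (fun t => c * C * maj4 x * maj3 t)).
  by apply: integrable_mulrl; exact: integrable_maj3.
have I : cintegrable leb_im (fun t => f (x, t) * k t).
  by apply: (cintegrable_le _ iM B); apply: cmeasM => //; exact: schwartz_cmeas1.
split => //; apply: le_trans (normc_cintegral_le I) _.
have -> : c * (2 * C * \int[leb_im]_t maj3 t) * maj4 x =
    2 * \int[leb_im]_t (c * C * maj4 x * maj3 t).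
  by rewrite RintegralZl//; [ring|exact: integrable_maj3].
by rewrite ler_wpM2l//; apply: le_Rintegral => //; exact: cintegrable_normc.
Qed.

Definition imphase a t : R[i] := cexp ('i%C * (imdot a t)%:C).

Definition gft f a x : R[i] := cintegral leb_im (fun t => f (x, t) * imphase a t).

Lemma normc_imphase a t : Normc.normc (imphase a t) = 1.
Proof. by rewrite /imphase normc_cexp cReM cRe_i cIm_real mul0r mulr0 subrr expR0. Qed.

Lemma imdotE a t : imdot a t = a.1.1 * t.1.1 + a.1.2 * t.1.2 + a.2 * t.2.
Proof.
by case: a t => [[? ?] ?] [[? ?] ?]; rewrite /imdot qdotE /= mul0r add0r.
Qed.

Lemma measurable_imdot d (T : measurableType d) (s u : T -> Q3) :
  measurable_fun setT s -> measurable_fun setT u ->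
  measurable_fun setT (fun z => @imdot R (s z) (u z)).
Proof.
move=> ms mu; under eq_fun do rewrite imdotE.
have m1 (w : T -> Q3) : measurable_fun setT w -> measurable_fun setT (fun z => (w z).1).
  by move=> mw; exact: (measurableT_comp measurable_fst mw).
have m2 (w : T -> Q3) : measurable_fun setT w -> measurable_fun setT (fun z => (w z).2).
  by move=> mw; exact: (measurableT_comp measurable_snd mw).
have m11 (w : T -> Q3) : measurable_fun setT w -> measurable_fun setT (fun z => (w z).1.1).
  by move=> mw; exact: (measurableT_comp measurable_fst (m1 _ mw)).
have m12 (w : T -> Q3) : measurable_fun setT w -> measurable_fun setT (fun z => (w z).1.2).
  by move=> mw; exact: (measurableT_comp measurable_snd (m1 _ mw)).
apply: measurable_funD; last by apply: measurable_funM; exact: m2.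
by apply: measurable_funD; apply: measurable_funM; [exact: m11|exact: m11|exact: m12|exact: m12].
Qed.

Lemma cmeas_imphase a : @cmeas _ Q3 R (imphase a).
Proof. by apply: cmeas_phase; apply: measurable_imdot. Qed.

Lemma gft_bound f : schwartz f -> exists2 C : R, 0 <= C &
  forall a x, cintegrable leb_im (fun t => f (x, t) * imphase a t) /\
    Normc.normc (gft f a x) <= C * maj4 x.
Proof.
move=> sf; have [C C0 HC] := moment_bound 0 sf; exists C => // a x.
have := HC (imphase a) 1 x ler01 (cmeas_imphase a); rewrite mul1r; apply => t.
by rewrite normc_imphase mulr1.
Qed.

End PartialFourier.
Arguments gft {R} f a x.
Arguments imphase {R} a t.

(** * Derivatives under the partial Fourier transform *)

Section IntegrationByParts.
Variable R : realType.
Local Notation mR := (measurableTypeR R).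
Local Notation Q4 := (mR * mR * mR * mR)%type.
Local Notation Q3 := (mR * mR * mR)%type.
Implicit Types (x : quat R) (t a v : imquat R) (f : heis R -> R[i]).

Local Notation vert v := ((0 : quat R, v) : heis R).

Lemma vertE x t v (s : R) : s *: vert v + ((x, t) : heis R) = (x, t + s *: v).
Proof.
have -> : s *: vert v + ((x, t) : heis R) = (s *: (0 : quat R) + x, s *: v + t) by [].
by rewrite scaler0 add0r addrC.
Qed.

Lemma difference_cvg (U : heis R -> R) (p w : heis R) : differentiable U p ->
  (fun n => (harmonic n)^-1 * (U (harmonic n *: w + p) - U p)) @ \oo --> 'D_w U p.
Proof.
move=> dU; have dw : derivable U p w by exact: diff_derivable.
have : (fun h => h^-1 *: ((U \o shift p) (h *: w) - U p)) @ 0^' --> 'D_w U p by [].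
move=> /cvgr_dnbhsP; apply; split; last exact: cvg_harmonic.
by move=> n; rewrite gt_eqF// /harmonic /= invr_gt0.
Qed.

Lemma difference_bound (U : heis R -> R) (p w : heis R) (h M : R) :
  (forall p, differentiable U p) -> 0 < h ->
  (forall s, 0 <= s <= 1 -> `|'D_w U ((s * h) *: w + p)| <= M) ->
  `|h^-1 * (U (h *: w + p) - U p)| <= M.
Proof.
move=> dU h0 bM.
have dg (t : R) : is_derive t 1 (fun s : R => (s * h) *: w + p) (h *: w).
  have H1 : is_derive t 1 (fun s : R => s * h) h.
    have := is_deriveM (is_derive_id t (1 : R)) (is_derive_cst h t (1 : R)).
    by rewrite scaler0 add0r /GRing.scale /= mulr1.
  have := is_deriveD (is_derive_scalel w H1) (is_derive_cst p t (1 : R)).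
  by rewrite addr0.
have D (t : R) := is_derive_comp_curve (dU ((t * h) *: w + p)) (dg t).
have Dh q : 'D_(h *: w : heis R) U q = h * 'D_w U q.
  by rewrite !deriveE// linearZ.
have := MVT_bound D (M := h * M).
rewrite mul1r mul0r scale0r add0r normrM (gtr0_norm (x := h^-1)) ?invr_gt0//.
rewrite ler_pdivrMl//; apply => s s01; rewrite Dh normrM gtr0_norm// ler_pM2l//.
exact: bM.
Qed.

Lemma cexp_sum2 (z : R[i]) : cexp_sum 2 z = 1 + z.
Proof.
have E k : (k`!%:R^-1)%:C = 1 :> R[i] -> z ^+ k * (k`!%:R^-1)%:C = z ^+ k.
  by move=> ->; rewrite mulr1.
rewrite /cexp_sum big_ord_recl big_ord_recl big_ord0 addr0 !E ?expr0 ?expr1//.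
  by rewrite (_ : _`! = 1%N)// invr1.
by rewrite (_ : _`! = 1%N)// invr1.
Qed.

Lemma derive_normc_Re f w p :
  `|'D_w (fun y => Re (f y)) p| <= Normc.normc (cderive w f p).
Proof. by have := normc_Re (cderive w f p); rewrite {1}/cderive cRe_mk. Qed.

Lemma derive_normc_Im f w p :
  `|'D_w (fun y => Im (f y)) p| <= Normc.normc (cderive w f p).
Proof. by have := normc_Im (cderive w f p); rewrite {1}/cderive cIm_mk. Qed.

(** Difference quotients replace boundary terms. Dominated convergence sends the transform of the
    quotients to the transform of the derivative, while translation invariance moves the shift to
    the phase, where the limit is explicit. The bound on v keeps all shifts within reach of
    [maj3_shift]. *)
Lemma gft_derive f v a x : schwartz f -> `|v| <= 1 ->
  gft (cderive (vert v) f) a x = - 'i%C * (imdot a v)%:C * gft f a x.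
Proof.
move=> sf v1; pose w : heis R := vert v.
have sw : schwartz (cderive w f) by exact: (schwartz_cderives [:: w] sf).
have [df _] := sf [::].
have dR p : differentiable (fun y => Re (f y)) p by have [] := df p.
have dI p : differentiable (fun y => Im (f y)) p by have [] := df p.
have [C C0 HC] := schwartz_decay 0 sw.
have [Cg Cg0 HCg] := gft_bound sf; have [iF _] := HCg a x.
have h0 n : 0 < harmonic n :> R by rewrite /harmonic /= invr_gt0.
have h1 n : harmonic n <= 1 :> R by rewrite /harmonic /= invf_le1// ler1n.
pose D n t : R[i] := ((harmonic n)^-1)%:C * (f (x, t + harmonic n *: v) - f (x, t)).
(* The mean value theorem bounds the quotient by the derivative at a point shifted by at most v; the
   factor 27 brings the majorant back to t. *)
have bU (U : heis R -> R) (n : nat) t : (forall p, differentiable U p) ->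
    (forall p, `|'D_w U p| <= Normc.normc (cderive w f p)) ->
    `|(harmonic n)^-1 * (U (x, t + harmonic n *: v) - U (x, t))| <= 27 * C * maj4 x * maj3 t.
  move=> dU bd; rewrite -vertE; apply: difference_bound => // s /andP[s0 s1].
  rewrite vertE; apply: le_trans (bd _) _.
  have := HC x (t + (s * harmonic n) *: v); rewrite expr0 mul1r => /le_trans; apply.
  rewrite (_ : 27 * C * _ * _ = C * (maj4 x * (27 * maj3 t))); last by ring.
  apply: ler_wpM2l => //.
  apply: ler_wpM2l; first exact: ltW (maj4_gt0 x).
  apply: maj3_shift => //; rewrite ger0_norm; last by rewrite mulr_ge0// ltW.
  by rewrite mulr_ile1// ?ltW.
have DRe n t : Re (D n t) = (harmonic n)^-1 * (Re (f (x, t + harmonic n *: v)) - Re (f (x, t))).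
  by rewrite /D cReM cIm_real mul0r subr0 cRe_real cReD cReN.
have DIm n t : Im (D n t) = (harmonic n)^-1 * (Im (f (x, t + harmonic n *: v)) - Im (f (x, t))).
  by rewrite /D cImM cIm_real mul0r addr0 cRe_real cImD cImN.
have bD n t : Normc.normc (D n t * imphase a t) <= 2 * (27 * C * maj4 x) * maj3 t.
  rewrite cnormM normc_imphase mulr1; apply: le_trans (normc_le _) _.
  rewrite -mulrA mulr_natl mulr2n DRe DIm; apply: lerD.
    exact: (bU (fun y => Re (f y)) n t dR (derive_normc_Re f w)).
  exact: (bU (fun y => Im (f y)) n t dI (derive_normc_Im f w)).
have mshift n : @cmeas _ Q3 R (fun t => f (x, t + harmonic n *: v)).
  apply: (@cmeas_comp _ Q3 R (fun t => f (x, t)) (fun t => t + harmonic n *: v)).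
    by have [] := mpres_im (harmonic n *: v).
  exact: schwartz_cmeas1.
have mD n : @cmeas _ Q3 R (fun t => D n t * imphase a t).
  apply: cmeasM; last exact: cmeas_imphase.
  apply: cmeasM; first exact: cmeas_cst.
  by apply: cmeasD; [exact: mshift|apply: cmeasN; exact: schwartz_cmeas1].
have lim1 : ccvg (fun n => cintegral leb_im (fun t => D n t * imphase a t))
    (gft (cderive w f) a x).
  apply: (@cdominated_cvg _ Q3 R leb_im _ _ (fun t => 2 * (27 * C * maj4 x) * maj3 t)) => //.
  - by apply: cmeasM; [exact: schwartz_cmeas1|exact: cmeas_imphase].
  - move=> t; apply: ccvgM; last exact: ccvg_cst.
    have H (U : heis R -> R) : (forall p, differentiable U p) ->
        (fun n => (harmonic n)^-1 * (U (x, t + harmonic n *: v) - U (x, t))) @ \oo --> 'D_w U (x, t).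
      move=> dU; have := @difference_cvg U (x, t) w (dU (x, t)).
      by under eq_fun do rewrite vertE.
    split.
      by under eq_fun do rewrite DRe; rewrite /cderive cRe_mk; exact: (H (fun y => Re (f y)) dR).
    by under eq_fun do rewrite DIm; rewrite /cderive cIm_mk; exact: (H (fun y => Im (f y)) dI).
  - by apply: integrable_mulrl; exact: integrable_maj3.
(* Substituting t + h v in the first term of the quotient multiplies the phase by e^{-ih<a,v>}. *)
have Deq n : cintegral leb_im (fun t => D n t * imphase a t) =
    ((harmonic n)^-1)%:C * (cexp ('i%C * (- (harmonic n * imdot a v))%:C) - 1) * gft f a x.
  pose G t := f (x, t) * imphase a t.
  have Gs t : f (x, t + harmonic n *: v) * imphase a t =
      cexp ('i%C * (- (harmonic n * imdot a v))%:C) * G (t + harmonic n *: v).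
    rewrite /G /imphase mulrCA -cexpD; congr (_ * cexp _).
    apply: complex_ext; rewrite !(cReE, cImE); first by ring.
    rewrite !imdotE /=; case: (t) (v) => [[? ?] ?] [[? ?] ?] /=.
    by rewrite /GRing.scale /=; ring.
  have iGs := mpres_cintegrable (mpres_im (harmonic n *: v)) iF.
  transitivity (cintegral leb_im (fun t => ((harmonic n)^-1)%:C *
     (cexp ('i%C * (- (harmonic n * imdot a v))%:C) * G (t + harmonic n *: v) + (-1) * G t))).
    apply: (@eq_cintegral _ Q3 R leb_im) => t.
    by rewrite -Gs /D /G; ring.
  rewrite cintegralZl; last by apply: cintegrableD; exact: cintegrableZl.
  rewrite cintegralD; [|exact: cintegrableZl|exact: cintegrableZl].
  rewrite !cintegralZl//.
  rewrite (mpres_cintegral (mpres_im (harmonic n *: v)) (cintegrable_meas iF)).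
  by rewrite -mulrA; congr (_ * _); rewrite mulrBl mulN1r mul1r.
have lim2 : ccvg (fun n => cintegral leb_im (fun t => D n t * imphase a t))
    (- 'i%C * (imdot a v)%:C * gft f a x).
  under eq_fun do rewrite Deq.
  apply: ccvgM; last exact: ccvg_cst.
  set b := imdot a v.
  (* The second-order Taylor remainder, divided by h, is O(h). *)
  have E n : Normc.normc (((harmonic n)^-1)%:C * (cexp ('i%C * (- (harmonic n * b))%:C) - 1) -
      - 'i%C * b%:C) <= 2 * b ^+ 2 * harmonic n.
    have := cexp_taylor_im 1 (- (harmonic n * b)).
    rewrite cexp_sum2 (_ : 1`!%:R = 1 :> R)//.
    rewrite -(ler_pM2l (x := (harmonic n)^-1)) ?invr_gt0//.
    rewrite divr1 normrN real_normK ?num_real// => H; apply: le_trans (le_trans H _).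
      rewrite -[X in X * Normc.normc _](ger0_norm (ltW (_ : 0 < (harmonic n)^-1))) ?invr_gt0//.
      rewrite -normc_real -cnormM le_eqVlt; apply/orP; left; apply/eqP; congr Normc.normc.
      have -> : - 'i%C * b%:C = ((harmonic n)^-1)%:C * ('i%C * (- (harmonic n * b))%:C).
        apply: complex_ext; rewrite !(cReE, cImE); first by ring.
        by field; rewrite gt_eqF.
      by rewrite -mulrBr opprD addrA.
    rewrite le_eqVlt; apply/orP; left; apply/eqP; field.
    by rewrite gt_eqF.
  have cB : (fun n => 2 * b ^+ 2 * harmonic n) @ \oo --> (0 : R).
    rewrite -(mulr0 (2 * b ^+ 2)); apply: cvgMl_tmp; exact: cvg_harmonic.
  have sq (k : R[i] -> R) (kB : forall y z : R[i], k (y - z) = k y - k z)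
    (kn : forall z : R[i], `|k z| <= Normc.normc z) :
    (fun n => k (((harmonic n)^-1)%:C * (cexp ('i%C * (- (harmonic n * b))%:C) - 1)))
      @ \oo --> k (- 'i%C * b%:C).
    apply/cvgrPdist_le => eps eps0.
    have /cvgrPdist_le/(_ eps eps0) := cB; apply: filterS => n.
    rewrite sub0r normrN => hN; rewrite distrC -kB (le_trans (kn _))//.
    exact: le_trans (E n) (le_trans (ler_norm _) hN).
  split; apply: sq.
  - by move=> y z; rewrite cReD cReN.
  - exact: normc_Re.
  - by move=> y z; rewrite cImD cImN.
  - exact: normc_Im.
have [r1 i1] := lim1; have [r2 i2] := lim2.
by apply: complex_ext; [exact: cvg_unique r1 r2|exact: cvg_unique i1 i2].
Qed.

End IntegrationByParts.

(** * Decay in the frequency and the Hilbert-Schmidt norm *)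

Section PlancherelFormula.
Variable R : realType.
Local Notation mR := (measurableTypeR R).
Local Notation Q4 := (mR * mR * mR * mR)%type.
Local Notation Q3 := (mR * mR * mR)%type.
Implicit Types (x : quat R) (t a v : imquat R) (f : heis R -> R[i]).

(** Quantified over all Schwartz functions because the inductive step applies it to derivatives of
    f. *)
Definition gft_dominated (phi : imquat R -> R) : Prop :=
  forall f, schwartz f -> exists2 C : R, 0 <= C &
    forall a x, phi a * Normc.normc (gft f a x) <= C * maj4 x.

(* Two integrations by parts along v. *)
Lemma gft_dominated_step (phi : imquat R -> R) v : `|v| <= 1 ->
  (forall a, 0 <= phi a) -> gft_dominated phi ->
  gft_dominated (fun a => phi a * (1 + (imdot a v) ^+ 2)).
Proof.
move=> v1 phi0 H f sf.
pose f1 := cderive ((0, v) : heis R) f; pose f2 := cderive ((0, v) : heis R) f1.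
have s1 : schwartz f1 by exact: (schwartz_cderives [:: ((0, v) : heis R)] sf).
have s2 : schwartz f2 by exact: (schwartz_cderives [:: ((0, v) : heis R)] s1).
have [C C0 HC] := H f sf; have [C2 C20 HC2] := H f2 s2.
exists (C + C2) => [|a x]; first exact: addr_ge0.
have E : Normc.normc (gft f2 a x) = (imdot a v) ^+ 2 * Normc.normc (gft f a x).
  rewrite /f2 gft_derive// /f1 gft_derive// !cnormM cnormN normc_real.
  have -> : Normc.normc ('i%C : R[i]) = 1.
    by rewrite normcE2 cRe_i cIm_i expr0n /= add0r expr1n sqrtr1.
  by rewrite mul1r mulrA -expr2 real_normK ?num_real.
rewrite mulrDl -mulrA mulrDl mul1r -E mulrDr; apply: lerD; [exact: HC|exact: HC2].
Qed.

(** One step along each coordinate vector builds the product of the factors 1 + a_i^2. *)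
Lemma gft_dominated_maj : gft_dominated (fun a => (maj3 a)^-1).
Proof.
have d0 : gft_dominated (fun=> 1).
  move=> f sf; have [C C0 HC] := gft_bound sf; exists C => // a x.
  by rewrite mul1r; have [] := HC a x.
have n1 (i j k : R) : `|i| <= 1 -> `|j| <= 1 -> `|k| <= 1 ->
    `|((i, j, k) : imquat R)| <= 1.
  by move=> h1 h2 h3; rewrite !prod_normE /= !ge_max h1 h2 h3.
have p0 (r : R) : 0 <= 1 + r ^+ 2 by rewrite addr_ge0// sqr_ge0.
have v1 : `|((1, 0, 0) : imquat R)| <= 1 by apply: n1; rewrite ?normr1 ?normr0.
have v2 : `|((0, 1, 0) : imquat R)| <= 1 by apply: n1; rewrite ?normr1 ?normr0.
have v3 : `|((0, 0, 1) : imquat R)| <= 1 by apply: n1; rewrite ?normr1 ?normr0.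
have H1 := gft_dominated_step v1 (fun=> ler01) d0.
have H2 := gft_dominated_step v2 (fun a => mulr_ge0 ler01 (p0 (imdot a _))) H1.
have H3 := gft_dominated_step v3 (fun a => mulr_ge0 (mulr_ge0 ler01 (p0 (imdot a _))) (p0 (imdot a _))) H2.
move=> f sf; have [C C0 HC] := H3 f sf; exists C => // a x.
apply: le_trans (HC a x); rewrite ler_wpM2r ?normc_ge0//.
rewrite !imdotE /= /maj3 /maj1 !invfM !invrK !mulr0 !mulr1 !addr0 !add0r mul1r.
exact: lexx.
Qed.

Lemma gft_le_maj f : schwartz f -> exists2 C : R, 0 <= C &
  forall a x, Normc.normc (gft f a x) <= C * (maj3 a * maj4 x).
Proof.
move=> sf; have [C C0 HC] := gft_dominated_maj sf; exists C => // a x.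
by have := HC a x; rewrite mulrC ler_pdivrMr ?maj3_gt0// -mulrA [maj4 x * _]mulrC.
Qed.

Lemma schwartz_ccontinuous f : schwartz f -> ccontinuous f.
Proof.
by move=> sf; have [df _] := sf [::]; split => p; have [d1 d2] := df p;
  exact: differentiable_continuous.
Qed.

Lemma gft_seq_continuous f a (s : nat -> quat R) (l : quat R) : schwartz f ->
  s @ \oo --> l -> ccvg (fun n => gft f a (s n)) (gft f a l).
Proof.
move=> sf sl; have [C C0 HC] := schwartz_decay 0 sf.
apply: (@cdominated_cvg _ Q3 R leb_im _ _ (fun t => C * maj3 t)).
- by move=> n; apply: cmeasM; [exact: schwartz_cmeas1|exact: cmeas_imphase].
- by apply: cmeasM; [exact: schwartz_cmeas1|exact: cmeas_imphase].
- move=> t; apply: ccvgM; last exact: ccvg_cst.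
  have cp : (fun n => (s n, t) : heis R) @ \oo --> ((l, t) : heis R).
    exact: (cvg_pair sl (cvg_cst t)).
  have [cR cI] := schwartz_ccontinuous sf.
  by split; [exact: (cvg_comp _ _ cp (cR _))|exact: (cvg_comp _ _ cp (cI _))].
- by apply: integrable_mulrl; exact: integrable_maj3.
- move=> n t; rewrite cnormM normc_imphase mulr1.
  have := HC (s n) t; rewrite expr0 mul1r => /le_trans; apply.
  by rewrite ler_wpM2l// ler_piMl ?maj4_le1// ltW// maj3_gt0.
Qed.

Lemma cmeas_gft f : schwartz f -> @cmeas _ (Q3 * Q4)%type R (fun p => gft f p.1 p.2).
Proof.
move=> sf.
apply: (@measurable_cintegral1 _ _ (Q3 * Q4)%type Q3 R leb_im
  (fun p => f (p.1.2, p.2) * imphase p.1.1 p.2)).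
have m1 : measurable_fun setT (fun p : Q3 * Q4 * Q3 => p.1) by exact: measurable_fst.
have m2 : measurable_fun setT (fun p : Q3 * Q4 * Q3 => p.2) by exact: measurable_snd.
have m12 := measurableT_comp (@measurable_snd _ _ Q3 Q4) m1.
have m11 := measurableT_comp (@measurable_fst _ _ Q3 Q4) m1.
apply: cmeasM; last by apply: cmeas_phase; apply: measurable_imdot.
have [r1 r2] := schwartz_cmeas sf.
have mp : measurable_fun setT (fun p : Q3 * Q4 * Q3 => (p.1.2, p.2) : Q4 * Q3).
  exact: measurable_fun_pair.
by split; [exact: (measurableT_comp r1 mp)|exact: (measurableT_comp r2 mp)].
Qed.

Lemma cmeas_gft1 f a : schwartz f -> @cmeas _ Q4 R (gft f a).
Proof.
move=> /cmeas_gft[r1 r2].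
have mp : measurable_fun [set: Q4] (fun x : Q4 => (a : Q3, x)) by exact: measurable_pair1.
by split; [exact: (measurableT_comp r1 mp)|exact: (measurableT_comp r2 mp)].
Qed.

Lemma integrable_gft f a : schwartz f ->
  leb_quat.-integrable [set: Q4] (EFin \o (fun x : Q4 => Normc.normc (gft f a x))).
Proof.
move=> sf; have [C C0 HC] := gft_bound sf.
apply: (@le_Rintegral_of_integrable _ Q4 R leb_quat _ (fun x => C * maj4 x)).
- by apply: cmeas_normc; exact: cmeas_gft1.
- by apply: integrable_mulrl; exact: integrable_maj4.
- by move=> x; rewrite ger0_norm ?normc_ge0//; have [] := HC a x.
Qed.

Lemma integrable_gft2 f a : schwartz f ->
  leb_quat.-integrable [set: Q4] (EFin \o (fun x : Q4 => Normc.normc (gft f a x) ^+ 2)).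
Proof.
move=> sf; have [C C0 HC] := gft_bound sf.
apply: (@le_Rintegral_of_integrable _ Q4 R leb_quat _ (fun x => C * Normc.normc (gft f a x))).
- by apply: measurable_funX; apply: cmeas_normc; exact: cmeas_gft1.
- by apply: integrable_mulrl; exact: integrable_gft.
move=> x; rewrite ger0_norm ?sqr_ge0// expr2 ler_wpM2r ?normc_ge0//.
have [_ h] := HC a x; apply: le_trans h _.
by rewrite ler_piMr// maj4_le1.
Qed.

(** The real exponent of the representation is |a||q|^2 - |a||q + x|^2: its second term joins the
    basis function at q + x to form [psi], its first leaves the integral. Integrating over t first
    gives [gft]. *)
Lemma fourier_fcoef f a (e : nat -> quat R -> R[i]) n q : schwartz f -> a <> 0 ->
  orthonormal_basis a e ->
  fourier a f (e n) q = (expR (imabs a * qdot q q))%:C * fcoef a (gft f a) e n q.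
Proof.
move=> sf a0 one.
pose H x : R[i] := (expR (imabs a * qdot q q))%:C *
  (cexp ('i%C * (2 * imabs a * qdot (qrot a q) x)%:C) * psi a e n (q + x)).
pose F (p : Q4 * Q3) := f p * imphase a p.2 * H p.1.
have E (p : heis R) : f p * fock_rep a p (e n) q = F p.
  case: p => x t; rewrite /F /H /fock_rep /psi.
  rewrite -[(x, t).1]/x -[(x, t).2]/t; move: (f (x, t)) (e n (q + x)) => y z.
  rewrite [RHS](_ : _ = y * (z * (imphase a t * ((expR (imabs a * qdot q q))%:C *
    (cexp ('i%C * (2 * imabs a * qdot (qrot a q) x)%:C) *
     (expR (- (imabs a * qdot (q + x) (q + x))))%:C))))); last by ring.
  congr (_ * _).
  congr (_ * _); rewrite /imphase -!cexp_real -!cexpD; congr cexp.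
  have c2 : (2 : R[i]) = (2 : R)%:C by rewrite rmorph_nat.
  rewrite c2 qabs_sqr; apply: complex_ext; rewrite !(cReE, cImE).
    by rewrite !qdotLE (qdotC x q); ring.
  by ring.
have mH : @cmeas _ Q4 R H.
  apply: cmeasM; first exact: cmeas_cst.
  apply: cmeasM; first by apply: cmeas_phase; apply: measurable_funM => //; apply: measurable_qdot.
  have [m1 m2] := cmeas_psi one n.
  have mD : measurable_fun [set: Q4] (fun x : Q4 => q + (x : quat R) : Q4) by apply: measurable_quatD.
  by split; [exact: (measurableT_comp m1 mD)|exact: (measurableT_comp m2 mD)].
pose B := expR (imabs a * qdot q q) * Num.sqrt (repc a).
have bH x : Normc.normc (H x) <= B.
  rewrite /H cnormM normc_real ger0_norm ?expR_ge0//; apply: ler_wpM2l; first exact: expR_ge0.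
  rewrite cnormM normc_phase mul1r -[X in X <= _](ger0_norm (normc_ge0 _)) -sqrtr_sqr.
  by rewrite ler_wsqrtr//; exact: (normc_psi a0 one).
have B0 : 0 <= B by apply: mulr_ge0; [exact: expR_ge0|exact: sqrtr_ge0].
have [C C0 HC] := schwartz_decay 0 sf.
have bF (p : Q4 * Q3) : Normc.normc (F p) <= B * C * (maj4 p.1 * maj3 p.2).
  case: p => x t; rewrite /F cnormM [Normc.normc (f _ * _)]cnormM normc_imphase mulr1 mulrC -mulrA.
  apply: (ler_pM (normc_ge0 _) (normc_ge0 _) (bH x)).
  by have := HC x t; rewrite expr0 mul1r.
have mF : @cmeas _ (Q4 * Q3)%type R F.
  apply: cmeasM; last exact: (@cmeas_fst _ _ Q4 Q3 R H mH).
  apply: cmeasM; first exact: schwartz_cmeas.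
  exact: (@cmeas_snd _ _ Q4 Q3 R _ (cmeas_imphase a)).
have iF : cintegrable leb_heis F.
  apply: (@cintegrable_le _ (Q4 * Q3)%type R leb_heis _ _ mF _ bF).
  apply: integrable_mulrl.
  exact: (@integrable_prodM _ _ Q4 Q3 R leb_quat leb_im maj4 maj3
    (integrable_maj4 R) (integrable_maj3 R)).
have [Cg Cg0 HCg] := gft_bound sf.
have iG x := (HCg a x).1.
have iF1 x : cintegrable leb_im (fun t => F (x, t)).
  have := cintegrableZl (H x) (iG x).
  by congr cintegrable; apply/funext => t; rewrite /F mulrC.
transitivity (cintegral leb_heis F).
  by apply: (@eq_cintegral _ (Q4 * Q3)%type R leb_heis) => p; exact: E.
transitivity (cintegral leb_quat (fun x => cintegral leb_im (fun t => F (x, t)))).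
  exact: (@cfubini1 _ _ Q4 Q3 R leb_quat leb_im F iF iF1).
transitivity (cintegral leb_quat (fun x => (expR (imabs a * qdot q q))%:C *
   (gft f a x * cexp ('i%C * (2 * imabs a * qdot (qrot a q) x)%:C) * psi a e n (q + x)))).
  apply: (@eq_cintegral _ Q4 R leb_quat) => x.
  transitivity (gft f a x * H x); last by rewrite /H; ring.
  have <- : cintegral leb_im (fun t => f (x, t) * imphase a t * H x) = gft f a x * H x.
    by move: (H x) => z; exact: (cintegralZr z (iG x)).
  by apply: (@eq_cintegral _ Q3 R leb_im) => t.
rewrite /fcoef; apply: cintegralZl.
apply: (@cintegrable_le _ Q4 R leb_quat _ (fun x => Num.sqrt (repc a) * Normc.normc (gft f a x))).
- apply: cmeasM; first apply: cmeasM; first exact: cmeas_gft1.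
    by apply: cmeas_phase; apply: measurable_funM => //; apply: measurable_qdot.
  have [m1 m2] := cmeas_psi one n.
  have mD : measurable_fun [set: Q4] (fun x : Q4 => q + (x : quat R) : Q4) by apply: measurable_quatD.
  by split; [exact: (measurableT_comp m1 mD)|exact: (measurableT_comp m2 mD)].
- by apply: integrable_mulrl; exact: integrable_gft.
- move=> x; rewrite [X in X <= _]cnormM [Normc.normc (gft f a x * _)]cnormM normc_phase mulr1 mulrC.
  apply: ler_wpM2r; first exact: normc_ge0.
  rewrite -[X in X <= _](ger0_norm (normc_ge0 _)) -sqrtr_sqr ler_wsqrtr//.
  exact: (normc_psi a0 one).
Qed.

Definition gft_energy f a : R := \int[leb_quat]_x (Normc.normc (gft f a x) ^+ 2).

(** The Fock weight cancels the square of the factor e^{|a||q|^2} from [fourier_fcoef], so that only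
    unweighted L2 norms are summed. *)
Lemma hs_norm2_gft f a : schwartz f -> a <> 0 ->
  hs_norm2 a (fourier a f) = (pi ^+ 2 / (4 * imabs a ^+ 2) * gft_energy f a)%:E.
Proof.
move=> sf a0; have one := fock_basis_onb a0.
have [C C0 HC] := gft_bound sf.
have gM q : Normc.normc (gft f a q) <= C.
  have [_ h] := HC a q; apply: le_trans h _.
  by rewrite ler_piMr// maj4_le1.
rewrite -(fcoef_plancherel a0 (cmeas_gft1 a sf) (fun s l sl => @gft_seq_continuous f a s l sf sl)
  gM (integrable_gft a sf) one).
apply: eq_eseriesr => n _; apply: eq_integral => q _; congr (_%:E).
rewrite (fourier_fcoef n q sf a0 one) cnormM normc_real ger0_norm ?expR_ge0//.
rewrite exprMn -expRM_natl qabs_sqr mulrAC -expRD.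
by rewrite (_ : _ + _ = 0) ?expR0 ?mul1r//; ring.
Qed.

Lemma gft_energy_ge0 f a : 0 <= gft_energy f a.
Proof. by apply: Rintegral_ge0 => x _; exact: sqr_ge0. Qed.

Lemma measurable_gft_energy f : schwartz f -> measurable_fun [set: Q3] (gft_energy f).
Proof.
move=> sf.
have m : @cmeas _ (Q3 * Q4)%type R (fun p => (Normc.normc (gft f p.1 p.2) ^+ 2)%:C).
  by apply: cmeas_real; apply: measurable_funX; apply: cmeas_normc; exact: cmeas_gft.
have [mR _] := @measurable_cintegral1 _ _ Q3 Q4 R leb_quat _ m.
apply: eq_measurable_fun mR => a _.
by rewrite cintegral_real.
Qed.

Lemma schwartz_R_integrand f a (k : nat) : schwartz f -> a <> 0 ->
  (hs_norm2 a (fourier a f) * (imabs a ^ (2%:Z - k%:Z))%R%:E)%E =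
  (pi ^+ 2 / 4 * (gft_energy f a * imabs a ^- k))%:E.
Proof.
move=> sf a0; rewrite hs_norm2_gft// -EFinM; congr (_%:E).
have l0 : imabs a != 0 by rewrite gt_eqF// imabs_gt0.
rewrite expfzDr// -exprnN -[imabs a ^ 2%:Z]/(imabs a ^+ 2).
have lk : imabs a ^+ k != 0 by rewrite expf_neq0.
by field; rewrite l0 lk.
Qed.

End PlancherelFormula.

(** * Moments *)

Section Moments.
Variable R : realType.
Local Notation mR := (measurableTypeR R).
Local Notation Q4 := (mR * mR * mR * mR)%type.
Local Notation Q3 := (mR * mR * mR)%type.
Implicit Types (x : quat R) (t a v : imquat R) (f : heis R -> R[i]).

Lemma imabsE a : imabs a ^+ 2 = a.1.1 ^+ 2 + a.1.2 ^+ 2 + a.2 ^+ 2.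
Proof. by rewrite imabs_sqr imdotE -!expr2. Qed.

Let le_sqr (c r : R) : 0 <= r -> c ^+ 2 <= r ^+ 2 -> `|c| <= r.
Proof. by move=> r0 h; rewrite -(@ler_pXn2r _ 2) ?nnegrE// real_normK ?num_real. Qed.

Lemma imabs_coord a : [/\ `|a.1.1| <= imabs a, `|a.1.2| <= imabs a & `|a.2| <= imabs a].
Proof.
have h := imabsE a.
by split; apply: le_sqr; rewrite ?imabs_ge0// h;
  have := sqr_ge0 a.1.1; have := sqr_ge0 a.1.2; have := sqr_ge0 a.2; lra.
Qed.

Lemma norm_coord t : [/\ `|t.1.1| <= `|t|, `|t.1.2| <= `|t| & `|t.2| <= `|t|].
Proof.
case: t => [[t1 t2] t3]; rewrite !prod_normE /=.
by split; rewrite !le_max lexx ?orbT.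
Qed.

Lemma imabs_le_norm a : imabs a <= 3 * `|a|.
Proof.
have [h1 h2 h3] := norm_coord a; have n0 := normr_ge0 a.
rewrite -(ger0_norm (imabs_ge0 a)); apply: le_sqr; first by rewrite mulr_ge0.
rewrite imabsE.
have H (c : R) : `|c| <= `|a| -> c ^+ 2 <= `|a| ^+ 2.
  by move=> h; rewrite -(real_normK (num_real c)) lerXn2r ?nnegrE.
have := H _ h1; have := H _ h2; have := H _ h3; have := sqr_ge0 (`|a| : R).
move: (`|a| : R) => n; nra.
Qed.

Lemma imdot_bound a t : `|imdot a t| <= 3 * imabs a * `|t|.
Proof.
rewrite imdotE; have [h1 h2 h3] := imabs_coord a; have [k1 k2 k3] := norm_coord t.
apply: le_trans (ler_normD _ _) _; apply: le_trans (lerD (ler_normD _ _) (lexx _)) _.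
rewrite (_ : 3 * _ * _ = imabs a * `|t| + imabs a * `|t| + imabs a * `|t|); last by ring.
by rewrite !normrM; apply: lerD; [apply: lerD|]; apply: ler_pM.
Qed.

Lemma measurable_imabs : measurable_fun [set: Q3] (@imabs R).
Proof.
rewrite /imabs /qabs.
have E a : qdot (quat_of_im a) (quat_of_im a) = imdot a a by [].
under eq_fun do rewrite E.
apply: (measurableT_comp (f := @Num.sqrt R)); last by apply: measurable_imdot.
by apply: continuous_measurable_fun; exact: sqrt_continuous.
Qed.

Definition poly_growth (k : imquat R -> R) : Prop :=
  measurable_fun [set: Q3] k /\
  exists N, exists2 c : R, 0 <= c & forall t, `|k t| <= c * (1 + `|t|) ^+ N.

Let one_le t N : 1 <= (1 + `|t|) ^+ N.
Proof. by rewrite exprn_ege1// lerDl. Qed.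

Lemma poly_growth_cst (c : R) : poly_growth (fun=> c).
Proof.
split; first exact: measurable_cst.
by exists 0%N, `|c| => // t; rewrite mulr1.
Qed.

Lemma poly_growthM k l : poly_growth k -> poly_growth l ->
  poly_growth (fun t => k t * l t).
Proof.
move=> [mk [N [c c0 hk]]] [ml [M [d d0 hl]]]; split; first exact: measurable_funM.
exists (N + M)%N, (c * d) => [|t]; first exact: mulr_ge0.
by rewrite normrM exprD mulrACA; apply: ler_pM.
Qed.

Lemma poly_growthD k l : poly_growth k -> poly_growth l ->
  poly_growth (fun t => k t + l t).
Proof.
move=> [mk [N [c c0 hk]]] [ml [M [d d0 hl]]]; split; first exact: measurable_funD.
exists (N + M)%N, (c + d) => [|t]; first exact: addr_ge0.
apply: le_trans (ler_normD _ _) _; rewrite mulrDl; apply: lerD.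
  apply: le_trans (hk t) _; apply: ler_wpM2l => //; rewrite exprD; 
  exact: (ler_peMr (le_trans ler01 (one_le t N)) (one_le t M)).
apply: le_trans (hl t) _; apply: ler_wpM2l => //; rewrite exprD; 
exact: (ler_peMl (le_trans ler01 (one_le t M)) (one_le t N)).
Qed.

Lemma poly_growthX k n : poly_growth k -> poly_growth (fun t => k t ^+ n).
Proof.
move=> hk; elim: n => [|n ih]; first by under eq_fun do rewrite expr0; exact: poly_growth_cst.
by under eq_fun do rewrite exprS; exact: poly_growthM.
Qed.

Lemma poly_growth_imdot a : poly_growth (imdot a).
Proof.
split; first by apply: measurable_imdot.
exists 1%N, (3 * imabs a) => [|t]; first by rewrite mulr_ge0 ?imabs_ge0.
apply: le_trans (imdot_bound a t) _; rewrite ler_wpM2l// ?mulr_ge0 ?imabs_ge0//.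
by rewrite expr1 lerDr.
Qed.

Lemma im_monomialE s t : im_monomial s t =
  imdot (1, 0, 0) t ^+ s.1.1 * imdot (0, 1, 0) t ^+ s.1.2 * imdot (0, 0, 1) t ^+ s.2.
Proof.
case: s t => [[s1 s2] s3] [[t1 t2] t3]; rewrite !imdotE /=.
by rewrite !mul0r !mul1r !addr0 !add0r.
Qed.

Lemma poly_growth_monomial s : poly_growth (im_monomial s).
Proof.
rewrite (funext (im_monomialE s)).
have pX a k : poly_growth (fun t => imdot a t ^+ k).
  by apply: poly_growthX; exact: poly_growth_imdot.
exact: (poly_growthM (poly_growthM (pX _ _) (pX _ _)) (pX _ _)).
Qed.

Definition moment f (k : imquat R -> R) x : R[i] :=
  cintegral leb_im (fun t => f (x, t) * (k t)%:C).

Lemma moment_integrable f k x : schwartz f -> poly_growth k ->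
  cintegrable leb_im (fun t => f (x, t) * (k t)%:C).
Proof.
move=> sf [mk [N [c c0 hk]]]; have [C C0 HC] := moment_bound N sf.
have [] // := HC (fun t => (k t)%:C) c x c0 (cmeas_real mk).
by move=> t; rewrite normc_real.
Qed.

Lemma momentD f k l x : schwartz f -> poly_growth k -> poly_growth l ->
  moment f (fun t => k t + l t) x = moment f k x + moment f l x.
Proof.
move=> sf hk hl; rewrite /moment -cintegralD; try exact: moment_integrable.
by apply: (@eq_cintegral _ Q3 R leb_im) => t; rewrite rmorphD mulrDr.
Qed.

Lemma momentZ f k (c : R) x : schwartz f -> poly_growth k ->
  moment f (fun t => c * k t) x = c%:C * moment f k x.
Proof.
move=> sf hk; rewrite /moment -cintegralZl; last exact: moment_integrable.
by apply: (@eq_cintegral _ Q3 R leb_im) => t; rewrite rmorphM /= mulrCA.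
Qed.

Lemma moment_sum f (I : Type) (r : seq I) (c : I -> R) (k : I -> imquat R -> R) x :
  schwartz f -> (forall i, poly_growth (k i)) ->
  moment f (fun t => \sum_(i <- r) c i * k i t) x =
  \sum_(i <- r) (c i)%:C * moment f (k i) x.
Proof.
move=> sf hk; elim: r => [|i r ih].
  rewrite big_nil; under eq_fun do rewrite big_nil.
  rewrite /moment -[RHS](@cintegral0 _ Q3 R leb_im).
  by apply: (@eq_cintegral _ Q3 R leb_im) => t; rewrite mulr0.
have hr : poly_growth (fun t => \sum_(i <- r) c i * k i t).
  elim: r {ih} => [|j r ih].
    by under eq_fun do rewrite big_nil; exact: poly_growth_cst.
  under eq_fun do rewrite big_cons; apply: poly_growthD => //.
  by apply: poly_growthM => //; exact: poly_growth_cst.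
rewrite big_cons -ih -momentZ// -momentD//.
  by congr moment; apply/funext => t; rewrite big_cons.
by apply: poly_growthM => //; exact: poly_growth_cst.
Qed.

(** Multiplication by <a,t> raises one exponent of the monomial, so the induction on k needs all
    monomials at once. *)
Lemma moment_imdot0 f x : schwartz f ->
  (forall s, moment f (im_monomial s) x = 0) ->
  forall k s a, moment f (fun t => im_monomial s t * imdot a t ^+ k) x = 0.
Proof.
move=> sf H; elim=> [|k IH] s a.
  by under eq_fun do rewrite expr0 mulr1; exact: H.
have pg s' : poly_growth (fun t => im_monomial s' t * imdot a t ^+ k).
  apply: poly_growthM; first exact: poly_growth_monomial.
  by apply: poly_growthX; exact: poly_growth_imdot.
have pgc (c : R) s' : poly_growth (fun t => c * (im_monomial s' t * imdot a t ^+ k)).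
  by apply: poly_growthM => //; exact: poly_growth_cst.
have -> : (fun t => im_monomial s t * imdot a t ^+ k.+1) = fun t =>
    a.1.1 * (im_monomial (s.1.1.+1, s.1.2, s.2) t * imdot a t ^+ k) +
    a.1.2 * (im_monomial (s.1.1, s.1.2.+1, s.2) t * imdot a t ^+ k) +
    a.2 * (im_monomial (s.1.1, s.1.2, s.2.+1) t * imdot a t ^+ k).
  apply/funext => t; rewrite exprSr; move: (imdot a t ^+ k) => y; rewrite imdotE.
  by case: s t => [[s1 s2] s3] [[t1 t2] t3] /=; rewrite !exprS; ring.
rewrite momentD//; last by apply: poly_growthD.
by rewrite momentD// !momentZ// !IH !mulr0 !addr0.
Qed.

(** The Taylor remainder of the phase is at most a multiple of |a|^{K+1} (1 + |t|)^{K+1}, to which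
    [moment_bound] applies. *)
Lemma gft_taylor f K : schwartz f -> exists2 C : R, 0 <= C &
  forall a x, Normc.normc (gft f a x - \sum_(j < K.+1)
     'i%C ^+ j * (j`!%:R^-1)%:C * moment f (fun t => imdot a t ^+ j) x) <=
  C * imabs a ^+ K.+1 * maj4 x.
Proof.
move=> sf; have [C C0 HC] := moment_bound K.+1 sf.
exists (2 * (3 ^+ K.+1 / K`!%:R) * C) => [|a x].
  by rewrite !mulr_ge0// invr_ge0.
have pgi j : poly_growth (fun t => imdot a t ^+ j).
  by apply: poly_growthX; exact: poly_growth_imdot.
pose r t := imphase a t - cexp_sum K.+1 ('i%C * (imdot a t)%:C).
have mr : @cmeas _ Q3 R r.
  apply: cmeasD; first exact: cmeas_imphase.
  apply: cmeasN; apply: cmeas_sum => j; apply: cmeasM; last exact: cmeas_cst.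
  apply: cmeasX; apply: cmeasM; first exact: cmeas_cst.
  by apply: cmeas_real; apply: measurable_imdot.
have c0 : 0 <= 2 * ((3 * imabs a) ^+ K.+1 / K`!%:R).
  by rewrite mulr_ge0// mulr_ge0 ?invr_ge0// exprn_ge0// mulr_ge0// imabs_ge0.
have br t : Normc.normc (r t) <= 2 * ((3 * imabs a) ^+ K.+1 / K`!%:R) * (1 + `|t|) ^+ K.+1.
  apply: le_trans (cexp_taylor_im K (imdot a t)) _; rewrite -!mulrA ler_wpM2l//.
  rewrite [K`!%:R^-1 * _]mulrC mulrA ler_wpM2r ?invr_ge0// -exprMn.
  rewrite lerXn2r ?nnegrE ?mulr_ge0 ?imabs_ge0 ?addr_ge0//.
  apply: le_trans (imdot_bound a t) _; rewrite ler_wpM2l ?mulr_ge0 ?imabs_ge0//.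
  by rewrite lerDr.
have [_ H] := HC r _ x c0 mr br.
have iS j : cintegrable leb_im (fun t => 'i%C ^+ j * (j`!%:R^-1)%:C *
    (f (x, t) * (imdot a t ^+ j)%:C)).
  by apply: cintegrableZl; exact: moment_integrable.
have [Cg _ HCg] := gft_bound sf; have [iG _] := HCg a x.
have E : gft f a x - \sum_(j < K.+1) 'i%C ^+ j * (j`!%:R^-1)%:C *
    moment f (fun t => imdot a t ^+ j) x = cintegral leb_im (fun t => f (x, t) * r t).
  transitivity (cintegral leb_im (fun t => f (x, t) * imphase a t + (-1) *
    \sum_(j < K.+1) 'i%C ^+ j * (j`!%:R^-1)%:C * (f (x, t) * (imdot a t ^+ j)%:C))).
    rewrite cintegralD//; last by apply: cintegrableZl; exact: cintegrable_sum.
    rewrite cintegralZl; last exact: cintegrable_sum.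
    rewrite cintegral_sum// mulN1r; congr (_ - _); apply: eq_bigr => j _.
    by rewrite cintegralZl//; exact: moment_integrable.
  apply: (@eq_cintegral _ Q3 R leb_im) => t.
  rewrite /r mulrBr mulN1r /cexp_sum mulr_sumr; congr (_ - _); apply: eq_bigr => j _.
  by rewrite exprMn (rmorphXn _ j) /=; ring.
rewrite E; apply: le_trans H _; rewrite le_eqVlt; apply/orP; left; apply/eqP.
by rewrite exprMn; ring.
Qed.

Lemma gft_energy_bound f a (b : R) : schwartz f -> 0 <= b ->
  (forall x, Normc.normc (gft f a x) <= b * maj4 x) ->
  gft_energy f a <= b ^+ 2 * \int[@leb_quat R]_x maj4 x.
Proof.
move=> sf b0 hb; rewrite /gft_energy -RintegralZl//; last exact: integrable_maj4.
apply: le_Rintegral => //.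
- exact: integrable_gft2.
- by apply: integrable_mulrl; exact: integrable_maj4.
move=> x _; have h := hb x; have m0 := ltW (maj4_gt0 x).
apply: (@le_trans _ _ ((b * maj4 x) ^+ 2)).
  by rewrite lerXn2r ?nnegrE ?normc_ge0// mulr_ge0.
rewrite exprMn ler_wpM2l ?sqr_ge0// expr2 ler_piMr// maj4_le1//.
Qed.

Lemma neq0_imabs : [set a : imquat R | a <> 0] = [set a | 0 < imabs a].
Proof.
apply/seteqP; split => a /=; first by move=> a0; exact: imabs_gt0.
by move=> h a0; move: h; rewrite a0 /imabs /qabs qdotE /= !mul0r !addr0 sqrtr0 ltxx.
Qed.

Lemma measurable_neq0 : measurable ([set a : imquat R | a <> 0] : set Q3).
Proof.
rewrite neq0_imabs (_ : [set a | _] = (@imabs R : Q3 -> R) @^-1` `]0, +oo[%classic).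
  rewrite -[X in measurable X]setTI; exact: measurable_imabs.
by apply/seteqP; split => a /=; rewrite in_itv /= andbT.
Qed.

End Moments.

(** * Inclusions between the two spaces *)

Section StarToR.
Variable R : realType.
Local Notation mR := (measurableTypeR R).
Local Notation Q4 := (mR * mR * mR * mR)%type.
Local Notation Q3 := (mR * mR * mR)%type.
Implicit Types (x : quat R) (t a v : imquat R) (f : heis R -> R[i]).

Lemma measurable_schwartz_R_integrand f k : schwartz f ->
  measurable_fun ([set a : imquat R | a <> 0] : set Q3)
    (fun a => gft_energy f a * imabs a ^- k).
Proof.
(* Off the origin the negative power of |a| is e^{-k ln |a|}, a composition of measurable
   functions. *)
move=> sf; apply: (@eq_measurable_fun _ _ _ _ _
    (fun a => gft_energy f a * expR (- (k%:R * ln (imabs a))))).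
  move=> a; rewrite inE => a0.
  by rewrite expRN expRM_natl lnK// posrE imabs_gt0.
apply: measurable_funTS; apply: measurable_funM; first exact: measurable_gft_energy.
apply: measurableT_comp => //; apply: measurableT_comp => //.
apply: measurable_funM => //; apply: (measurableT_comp (f := @ln R)) => //.
exact: measurable_imabs.
Qed.

Lemma integral_schwartz_R f k : schwartz f ->
  (\int[leb_im]_(a in [set a : imquat R | a <> 0%R])
         (hs_norm2 a (fourier a f) * (imabs a ^ (2%:Z - k%:Z))%R%:E) =
   \int[leb_im]_(a in [set a : imquat R | a <> 0%R])
     (pi ^+ 2 / 4 * (gft_energy f a * imabs a ^- k))%:E)%E.
Proof.
move=> sf; apply: eq_integral => a; rewrite inE => a0.
exact: schwartz_R_integrand.
Qed.

Lemma star_sub_R f : schwartz_star R f -> schwartz_R R f.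
Proof.
move=> [sf ms]; split => // k; rewrite integral_schwartz_R//.
have mz j x a : moment f (fun t => imdot a t ^+ j) x = 0.
  have := moment_imdot0 sf (fun s => ms x s) j (0, 0, 0)%N a.
  by congr (_ = _); congr moment; apply/funext => t; case: t => [[? ?] ?]; rewrite /= !expr0 !mul1r.
(* Order k is enough: the energy is then O(|a|^{2k+2}), which |a|^k dominates for |a| <= 1. *)
have [C1 C10 HC1] := gft_taylor k sf.
have b1 a x : Normc.normc (gft f a x) <= C1 * imabs a ^+ k.+1 * maj4 x.
  by have := HC1 a x; rewrite big1 ?subr0// => j _; rewrite mz mulr0.
have [C2 C20 HC2] := gft_le_maj sf.
pose I4 := \int[@leb_quat R]_x maj4 x.
have I40 : 0 <= I4 by apply: Rintegral_ge0 => x _; exact: ltW (maj4_gt0 x).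
(* The first term serves |a| <= 1, where 8 [maj3] is at least 1; the second serves |a| > 1, where
   the negative power of |a| is at most 1. *)
pose C3 := (8 * C1 ^+ 2 + C2 ^+ 2) * I4.
have C30 : 0 <= C3 by rewrite mulr_ge0// addr_ge0 ?mulr_ge0 ?sqr_ge0.
have bE a : a <> 0 -> gft_energy f a * imabs a ^- k <= C3 * maj3 a.
  move=> a0; have l0 := imabs_gt0 a0; have m0 := maj3_gt0 a.
  have [l1|l1] := lerP (imabs a) 1.
    have m8 : 1 <= 8 * maj3 a.
      have H c : `|c| <= imabs a -> 1 <= 2 * maj1 c.
        move=> ca; rewrite /maj1 ler_pdivlMr ?mul1r; last by rewrite ltr_wpDr ?sqr_ge0.
        rewrite -[leRHS]/(1 + 1 : R) lerD2l -real_normK ?num_real//.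
        by rewrite exprn_ile1// (le_trans ca).
      have [/H h1 /H h2 /H h3] := imabs_coord a.
      rewrite (_ : 8 * maj3 a = (2 * maj1 a.1.1) * ((2 * maj1 a.1.2) * (2 * maj1 a.2))).
        have ms' (p q : R) : 1 <= p -> 1 <= q -> 1 <= p * q.
          by move=> p1 q1; rewrite (le_trans p1)// ler_peMr// (le_trans ler01).
        by apply: (ms') => //; exact: ms'.
      by rewrite /maj3; ring.
    have e1 := gft_energy_bound sf (mulr_ge0 C10 (exprn_ge0 k.+1 (imabs_ge0 a))) (b1 a).
    rewrite ler_pdivrMr ?exprn_gt0//; apply: le_trans e1 _.
    rewrite exprMn -/I4 -exprM.
    have h : imabs a ^+ (k.+1 * 2) <= imabs a ^+ k.
      by apply: ler_wiXn2l; rewrite ?imabs_ge0// muln2 -addnn (leq_trans (leqnSn k))// leq_addr.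
    apply: (@le_trans _ _ (C1 ^+ 2 * imabs a ^+ k * I4)).
      by rewrite ler_wpM2r// ler_wpM2l// sqr_ge0.
    rewrite mulrAC; apply: ler_wpM2r; first exact: exprn_ge0 (imabs_ge0 a).
    rewrite /C3 -mulrA [I4 * _]mulrC mulrA ler_wpM2r//.
    rewrite mulrDl; apply: (@le_trans _ _ (8 * C1 ^+ 2 * maj3 a)).
      by rewrite [8 * _]mulrC -mulrA ler_peMr// sqr_ge0.
    by rewrite lerDl mulr_ge0 ?sqr_ge0// ltW.
  have b2 x : Normc.normc (gft f a x) <= C2 * maj3 a * maj4 x by rewrite -mulrA; exact: HC2.
  have e2 := gft_energy_bound sf (mulr_ge0 C20 (ltW m0)) b2.
  apply: (@le_trans _ _ (gft_energy f a)).
    rewrite ler_pdivrMr ?exprn_gt0// ler_peMr ?gft_energy_ge0//.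
    by rewrite exprn_ege1// ltW.
  apply: le_trans e2 _; rewrite -/I4 exprMn mulrAC /C3.
  apply: (@le_trans _ _ (C2 ^+ 2 * I4 * maj3 a)).
    rewrite ler_wpM2l ?mulr_ge0 ?sqr_ge0// expr2 ler_piMr ?maj3_le1// ltW//.
  apply: ler_wpM2r; first exact: ltW.
  by apply: ler_wpM2r => //; rewrite lerDr mulr_ge0 ?sqr_ge0.
have mD : measurable ([set a : imquat R | a <> 0] : set Q3) by exact: measurable_neq0.
have iM : leb_im.-integrable [set a : imquat R | a <> 0] (EFin \o (fun a : Q3 => pi ^+ 2 / 4 * (C3 * maj3 a))).
  apply: (integrableS measurableT) => //.
  by do 2 apply: integrable_mulrl; exact: integrable_maj3.
have p0 : 0 <= pi ^+ 2 / 4 :> R by rewrite mulr_ge0 ?sqr_ge0.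
apply: (@le_lt_trans _ _ (\int[leb_im]_(a in [set a : imquat R | a <> 0%R])
    (pi ^+ 2 / 4 * (C3 * maj3 a))%R%:E)%E).
  apply: ge0_le_integral => //.
  - move=> a a0; rewrite lee_fin mulr_ge0// mulr_ge0 ?gft_energy_ge0// invr_ge0.
    exact: exprn_ge0 (imabs_ge0 a).
  - apply/measurable_EFinP; apply: measurable_funM => //.
    exact: measurable_schwartz_R_integrand.
  - by have [] := integrableP _ _ _ iM.
  - by move=> a a0; rewrite lee_fin ler_wpM2l// bE.
have [_] := integrableP _ _ _ iM; apply: le_lt_trans.
apply: ge0_le_integral => //.
- by move=> a _; rewrite lee_fin mulr_ge0// mulr_ge0// ltW// maj3_gt0.
- by have [] := integrableP _ _ _ iM.
- by apply: measurableT_comp => //; have [] := integrableP _ _ _ iM.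
- by move=> a _; rewrite lee_fin ler_norm.
Qed.

End StarToR.

(** * From integrability near the origin to vanishing moments *)

Lemma poly_coef_zero (R : realType) (n : nat) (c : nat -> R[i]) :
  (forall m : nat, \sum_(i < n) c i * m%:R ^+ i = 0) -> forall i, (i < n)%N -> c i = 0.
Proof.
move=> H i ilt; pose p := \poly_(j < n) c j.
have p0 : p = 0.
  apply/eqP; apply: contraT => pn0.
  pose rs := [seq m%:R : R[i] | m <- iota 0 (size p)].
  have rp : all (root p) rs.
    by apply/allP => _ /mapP[m _ ->]; rewrite /root horner_poly H.
  have ur : uniq rs.
    rewrite map_inj_uniq ?iota_uniq// => m1 m2 /eqP; by rewrite eqr_nat => /eqP.
  by have := max_poly_roots pn0 rp ur; rewrite size_map size_iota ltnn.
by have := congr1 (fun q : {poly R[i]} => q`_i) p0; rewrite coef_poly ilt coef0.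
Qed.

Lemma integral_ge_cst d (T : measurableType d) (R : realType)
    (mu : {measure set T -> \bar R}) (D V : set T) (F : T -> R) (c : R) :
  measurable D -> measurable V -> V `<=` D -> measurable_fun D F ->
  (forall z, D z -> 0 <= F z) -> 0 <= c -> (forall z, V z -> c <= F z) ->
  (c%:E * mu V <= \int[mu]_(z in D) (F z)%:E)%E.
Proof.
move=> mD mV VD mF F0 c0 cF.
apply: (@le_trans _ _ (\int[mu]_(z in V) (F z)%:E)%E); last first.
  apply: ge0_subset_integral => //; first exact/measurable_EFinP.
rewrite -integral_cst//; apply: ge0_le_integral => //.
by apply/measurable_EFinP; exact: measurable_funS mF.
Qed.

Section RToStar.
Variable R : realType.
Local Notation mR := (measurableTypeR R).
Local Notation Q4 := (mR * mR * mR * mR)%type.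
Local Notation Q3 := (mR * mR * mR)%type.
Local Notation leb := (@lebesgue_measure R).
Implicit Types (x : quat R) (t a v : imquat R) (f : heis R -> R[i]).

(** Closed balls of the sup norm, hence products of intervals whose measure is explicit. *)
Definition imbox a (r : R) : set Q3 := [set b | `|(b : imquat R) - a| <= r].
Definition qbox x (r : R) : set Q4 := [set y | `|(y : quat R) - x| <= r].

Let itv (c r : R) : set mR := `[c - r, c + r]%classic.

Let itv_measure (c r : R) : 0 < r -> leb (itv c r) = (2 * r)%:E.
Proof.
move=> r0; rewrite /itv lebesgue_measure_itv /= lte_fin.
by rewrite ifT ?ltrD2l ?gtrN// -EFinB; congr (_%:E); ring.
Qed.

Let itvE (c r y : R) : (`|y - c| <= r) = (c - r <= y <= c + r).
Proof. by rewrite ler_distl. Qed.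

Let imbox_itv a r : imbox a r = itv a.1.1 r `*` itv a.1.2 r `*` itv a.2 r.
Proof.
apply/seteqP; split => -[[b1 b2] b3] /=; case: a => [[a1 a2] a3];
  rewrite /imbox /itv /= ?in_itv /= !prod_normE /= !ge_max !itvE.
- by move=> /andP[/andP[h1 h2] h3]; split.
- by move=> [[h1 h2] h3]; rewrite h1 h2 h3.
Qed.

Let qbox_itv x r : qbox x r =
  itv x.1.1.1 r `*` itv x.1.1.2 r `*` itv x.1.2 r `*` itv x.2 r.
Proof.
apply/seteqP; split => -[[[b1 b2] b3] b4] /=; case: x => [[[a1 a2] a3] a4];
  rewrite /qbox /itv /= ?in_itv /= !prod_normE /= !ge_max !itvE.
- by move=> /andP[/andP[/andP[h1 h2] h3] h4]; split.
- by move=> [[[h1 h2] h3] h4]; rewrite h1 h2 h3 h4.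
Qed.

Let mitv c r : measurable (itv c r). Proof. exact: measurable_itv. Qed.

Lemma measurable_imbox a r : measurable (imbox a r).
Proof. by rewrite imbox_itv; do 2 (apply: measurableX => //). Qed.

Lemma measurable_qbox x r : measurable (qbox x r).
Proof. by rewrite qbox_itv; do 3 (apply: measurableX => //). Qed.

Let prod_box d1 d2 (T1 : measurableType d1) (T2 : measurableType d2)
    (m1 : {sigma_finite_measure set T1 -> \bar R})
    (m2 : {sigma_finite_measure set T2 -> \bar R}) (A : set T1) (B : set T2) (p q : R) :
  measurable A -> measurable B -> m1 A = p%:E -> m2 B = q%:E ->
  prod_measure m1 m2 (A `*` B) = (p * q)%:E.
Proof. by move=> mA mB mp mq; rewrite EFinM -mp -mq; exact: product_measure1E. Qed.

Lemma imbox_measure a r : 0 < r -> leb_im (imbox a r) = ((2 * r) ^+ 3)%:E.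
Proof.
move=> r0; rewrite imbox_itv.
have I c := itv_measure c r0; have M c := mitv c r.
have m2 := measurableX (M a.1.1) (M a.1.2).
have h := prod_box m2 (M a.2) (prod_box (M a.1.1) (M a.1.2) (I _) (I _)) (I _).
by apply: etrans h _; congr (_%:E); ring.
Qed.

Lemma qbox_measure x r : 0 < r -> leb_quat (qbox x r) = ((2 * r) ^+ 4)%:E.
Proof.
move=> r0; rewrite qbox_itv.
have I c := itv_measure c r0; have M c := mitv c r.
have m2 := measurableX (M x.1.1.1) (M x.1.1.2).
have m3 := measurableX m2 (M x.1.2).
have h2 := prod_box (M x.1.1.1) (M x.1.1.2) (I _) (I _).
have h := prod_box m3 (M x.2) (prod_box m2 (M x.1.2) h2 (I _)) (I _).
by apply: etrans h _; congr (_%:E); ring.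
Qed.

Lemma imdot_seq_cvg (b : nat -> imquat R) a t : b @ \oo --> a ->
  (fun n => imdot (b n) t) @ \oo --> imdot a t.
Proof.
move=> ba.
have c1 : (fun n => (b n).1) @ \oo --> a.1 by exact: (cvg_comp _ _ ba cvg_fst).
have c2 : (fun n => (b n).2) @ \oo --> a.2 by exact: (cvg_comp _ _ ba cvg_snd).
have c11 : (fun n => (b n).1.1) @ \oo --> a.1.1 by exact: (cvg_comp _ _ c1 cvg_fst).
have c12 : (fun n => (b n).1.2) @ \oo --> a.1.2 by exact: (cvg_comp _ _ c1 cvg_snd).
under eq_fun do rewrite imdotE; rewrite imdotE.
by apply: cvgD; [apply: cvgD|]; apply: cvgMr_tmp.
Qed.

Local Notation H f k x a := (moment f (fun t => imdot a t ^+ k) x).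

Lemma moment_seq_continuous f k x0 a0 (s : nat -> quat R) (b : nat -> imquat R) (A : R) :
  schwartz f -> s @ \oo --> x0 -> b @ \oo --> a0 -> (forall n, imabs (b n) <= A) ->
  ccvg (fun n => H f k (s n) (b n)) (H f k x0 a0).
Proof.
move=> sf sx ba bA; have A0 : 0 <= A by exact: le_trans (imabs_ge0 _) (bA 0%N).
have [C C0 HC] := schwartz_decay k sf.
have mI a : measurable_fun [set: Q3] (fun t => imdot a t ^+ k).
  by apply: measurable_funX; apply: measurable_imdot.
apply: (@cdominated_cvg _ Q3 R leb_im _ _ (fun t => (3 * A) ^+ k * (C * maj3 t))).
- by move=> n; apply: cmeasM; [exact: schwartz_cmeas1|exact: cmeas_real].
- by apply: cmeasM; [exact: schwartz_cmeas1|exact: cmeas_real].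
- move=> t; apply: ccvgM.
    have cp : (fun n => (s n, t) : heis R) @ \oo --> ((x0, t) : heis R).
      exact: (cvg_pair sx (cvg_cst t)).
    have [cR cI] := schwartz_ccontinuous sf.
    by split; [exact: (cvg_comp _ _ cp (cR _))|exact: (cvg_comp _ _ cp (cI _))].
  split; last exact: cvg_cst.
  elim: (k) => [|j IH]; first by under eq_fun do rewrite expr0; exact: cvg_cst.
  under eq_fun do rewrite exprS; rewrite exprS; apply: cvgM => //.
  exact: imdot_seq_cvg.
- by do 2 apply: integrable_mulrl; exact: integrable_maj3.
- move=> n t; rewrite cnormM normc_real normrX.
  apply: (@le_trans _ _ ((3 * A) ^+ k * ((1 + `|t|) ^+ k * Normc.normc (f (s n, t))))).
    rewrite mulrA mulrC ler_wpM2r ?normc_ge0// -exprMn lerXn2r ?nnegrE//.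
      by rewrite mulr_ge0 ?mulr_ge0// addr_ge0.
    apply: le_trans (imdot_bound _ _) _; apply: ler_pM => //.
    + by rewrite mulr_ge0// imabs_ge0.
    + by rewrite ler_wpM2l.
    + by rewrite lerDr.
  rewrite ler_wpM2l ?exprn_ge0 ?mulr_ge0//.
  apply: le_trans (HC (s n) t) _; rewrite ler_wpM2l// ler_piMl ?maj4_le1//.
  by rewrite ltW// maj3_gt0.
Qed.

Lemma cvg_harmonic_bound (V : normedModType R) (s : nat -> V) (l : V) :
  (forall n, `|s n - l| <= harmonic n) -> s @ \oo --> l.
Proof.
move=> h; apply/cvgrPdist_le => eps eps0.
have /cvgrPdist_le/(_ eps eps0) := @cvg_harmonic R.
apply: filterS => n; rewrite sub0r normrN => hn; rewrite distrC.
exact: le_trans (h n) (le_trans (ler_norm _) hn).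
Qed.

(** If it failed, points closer than [harmonic n] to (x0, a0) with modulus below half the value
    there would contradict sequential continuity. *)
Lemma moment_lower f k x0 a0 : schwartz f -> H f k x0 a0 != 0 ->
  exists eps : R, exists del : R, [/\ 0 < eps, 0 < del &
    forall x a, `|x - x0| <= del -> `|a - a0| <= del -> eps <= Normc.normc (H f k x a)].
Proof.
move=> sf h0; pose N0 := Normc.normc (H f k x0 a0).
have N00 : 0 < N0.
  rewrite lt_neqAle normc_ge0 andbT eq_sym; apply: contra_neq h0 => h.
  have := sqr_normcE (H f k x0 a0); rewrite -/N0 h expr0n /= => /esym/eqP.
  rewrite paddr_eq0 ?sqr_ge0// !sqrf_eq0 => /andP[/eqP r0 /eqP i0].
  by apply: complex_ext; rewrite ?r0 ?i0.
apply: contrapT => NE.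
have /choice[p hp] : forall n, exists p : quat R * imquat R,
    [/\ `|p.1 - x0| <= harmonic n, `|p.2 - a0| <= harmonic n &
        Normc.normc (H f k p.1 p.2) < N0 / 2].
  move=> n; apply: contrapT => NP; apply: NE; exists (N0 / 2), (harmonic n); split.
  - by rewrite divr_gt0.
  - by rewrite /harmonic /= invr_gt0.
  - move=> x a hx ha; rewrite leNgt; apply/negP => hlt.
    by apply: NP; exists (x, a).
have sx : (fun n => (p n).1) @ \oo --> x0 by apply: cvg_harmonic_bound => n; have [] := hp n.
have sa : (fun n => (p n).2) @ \oo --> a0 by apply: cvg_harmonic_bound => n; have [] := hp n.
have bA n : imabs (p n).2 <= 3 * (1 + `|a0|).
  apply: le_trans (imabs_le_norm _) _; rewrite ler_wpM2l//.
  rewrite -[(p n).2](subrK a0); apply: le_trans (ler_normD _ _) _; rewrite lerD2r.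
  have [_ h _] := hp n; apply: le_trans h _.
  by rewrite /harmonic /= invf_le1// ler1n.
have /ccvg_normc L := moment_seq_continuous k sf sx sa bA.
have : N0 ^+ 2 <= (N0 / 2) ^+ 2.
  have -> : N0 ^+ 2 = limn (fun n => Normc.normc (H f k (p n).1 (p n).2) ^+ 2).
    by apply/esym/cvg_lim.
  apply: limr_le; first by apply/cvg_ex; exists (N0 ^+ 2).
  apply: nearW => n; have [_ _ h] := hp n.
  by rewrite lerXn2r ?nnegrE ?normc_ge0 ?divr_ge0// ltW.
by rewrite ler_pXn2r ?nnegrE ?divr_ge0 ?(ltW N00)// leNgt ltr_pdivrMr// ltr_pMr// ltr1n.
Qed.

Lemma moment_scale f k x (r : R) b : schwartz f ->
  H f k x (r *: b) = (r ^+ k)%:C * H f k x b.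
Proof.
move=> sf; rewrite -momentZ//; last by apply: poly_growthX; exact: poly_growth_imdot.
congr moment; apply/funext => t; rewrite -exprMn; congr (_ ^+ _).
by rewrite !imdotE; case: b => [[? ?] ?] /=; rewrite /GRing.scale /=; ring.
Qed.

Lemma normc_pow_i k : Normc.normc ('i%C ^+ k : R[i]) = 1.
Proof.
rewrite cnormX (_ : Normc.normc 'i%C = 1) ?expr1n//.
by rewrite normcE2 cRe_i cIm_i expr0n /= add0r expr1n sqrtr1.
Qed.

(* The bound |gft f a x| >= r^k e1 on the box of radius r del around r a0
   contributes at least r^(2k) r^3 r^(- (2k+4)) = 1/r to the integral. *)
Lemma moment_vanish f k x0 a0 : schwartz f -> a0 <> 0 ->
  (forall j x a, (j < k)%N -> a <> 0 -> H f j x a = 0) ->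
  (\int[leb_im]_(a in [set a : imquat R | a <> 0%R])
     (pi ^+ 2 / 4 * (gft_energy f a * imabs a ^- (2 * k + 4)))%R%:E < +oo)%E ->
  H f k x0 a0 = 0.
Proof.
move=> sf a00 IH fin; apply/eqP; apply: contraT => h0.
have [eps [del0 [eps0 del00 low0]]] := moment_lower sf h0.
have na0 : 0 < `|a0| by rewrite normr_gt0; apply/eqP.
(* Staying below |a0| keeps the scaled boxes away from the origin. *)
pose del := Num.min del0 (`|a0| / 2).
have del_gt0 : 0 < del by rewrite lt_min del00 divr_gt0.
have del_le0 : del <= del0 by rewrite ge_min lexx.
have del_lea : del < `|a0|.
  by rewrite gt_min; apply/orP; right; rewrite ltr_pdivrMr// ltr_pMr// ltr1n.
pose A := 3 * (`|a0| + del).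
have A0 : 0 < A by rewrite mulr_gt0// addr_gt0.
have [C C0 HC] := gft_taylor k sf.
(* Half of the lower bound eps/k! for the leading Taylor term; the other half absorbs the
   remainder. *)
pose e1 := eps / (2 * k`!%:R).
have kf : 0 < k`!%:R :> R by rewrite ltr0n fact_gt0.
have e10 : 0 < e1 by rewrite divr_gt0// mulr_gt0.
(* Makes C (r A)^{k+1} at most r^k e1 for r <= r0; the added 1 keeps the denominator positive when C
   = 0. *)
pose r0 := e1 / (C * A ^+ k.+1 + 1).
have d0 : 0 < C * A ^+ k.+1 + 1 by rewrite ltr_wpDl// mulr_ge0// exprn_ge0// ltW.
have r00 : 0 < r0 by rewrite divr_gt0.
have low r x a : 0 < r -> r <= r0 -> `|x - x0| <= del -> `|a - r *: a0| <= r * del ->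
  [/\ 0 < imabs a, imabs a <= r * A & r ^+ k * e1 <= Normc.normc (gft f a x)].
  (* The moment is homogeneous of degree k in a, so its lower bound near a0 transfers to the scaled
     box. *)
  move=> rp rr0 hx ha; pose b := r^-1 *: a.
  have ab : a = r *: b by rewrite /b scalerA mulfV ?scale1r// gt_eqF.
  have hb : `|b - a0| <= del.
    move: ha; rewrite {1}ab -scalerBr normrZ gtr0_norm// ler_pM2l//.
  have b0 : b <> 0.
    by move=> b0; move: hb; rewrite b0 sub0r normrN leNgt del_lea.
  have an0 : a <> 0.
    rewrite ab => /eqP; rewrite scaler_eq0 gt_eqF//= => /eqP; exact: b0.
  have iA : imabs a <= r * A.
    apply: le_trans (imabs_le_norm _) _; rewrite ab normrZ gtr0_norm// mulrCA ler_pM2l//.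
    rewrite /A ler_pM2l//; apply: le_trans (_ : `|b - a0 + a0| <= _); first by rewrite subrK.
    by apply: le_trans (ler_normD _ _) _; rewrite addrC lerD2l.
  split=> //; first exact: imabs_gt0.
  have := HC a x; rewrite big_ord_recr /= big1 ?add0r; last first.
    by move=> j _; rewrite IH// mulr0.
  set z := 'i%C ^+ k * _ * _ => hz.
  have nz : Normc.normc z = k`!%:R^-1 * r ^+ k * Normc.normc (H f k x b).
    rewrite /z !cnormM normc_pow_i mul1r normc_real ger0_norm; last by rewrite invr_ge0 ltW.
    rewrite {1}ab moment_scale// cnormM normc_real ger0_norm ?exprn_ge0 ?(ltW rp)//.
    by rewrite mulrA.
  have hb2 : eps <= Normc.normc (H f k x b).
    by apply: low0; [exact: le_trans hx del_le0|exact: le_trans hb del_le0].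
  have zl : 2 * (r ^+ k * e1) <= Normc.normc z.
    rewrite nz /e1 (_ : 2 * _ = k`!%:R^-1 * r ^+ k * eps); last by field; rewrite gt_eqF.
    by rewrite ler_wpM2l// mulr_ge0 ?invr_ge0 ?exprn_ge0 ?(ltW rp) ?(ltW kf).
  have tri : Normc.normc z <= Normc.normc (gft f a x) + Normc.normc (gft f a x - z).
    rewrite -[Normc.normc (gft f a x - z)]cnormN opprB.
    by apply: le_trans (cnormD _ _); rewrite addrC subrK.
  have rem : C * imabs a ^+ k.+1 * maj4 x <= r ^+ k * e1.
    apply: (@le_trans _ _ (C * (r * A) ^+ k.+1)).
      apply: (@le_trans _ _ (C * imabs a ^+ k.+1)).
        by rewrite ler_piMr ?maj4_le1// mulr_ge0// exprn_ge0// imabs_ge0.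
      by rewrite ler_wpM2l// lerXn2r ?nnegrE ?imabs_ge0// mulr_ge0// ltW.
    rewrite exprMn exprSr (_ : C * _ = r ^+ k * (r * (C * A ^+ k.+1))); last by ring.
    rewrite ler_pM2l ?exprn_gt0//.
    apply: (@le_trans _ _ (r0 * (C * A ^+ k.+1 + 1))); last by rewrite /r0 divfK ?gt_eqF.
    by apply: ler_pM => //; rewrite ?(ltW rp) ?lerDl// mulr_ge0// exprn_ge0// ltW.
  rewrite -(lerD2r (r ^+ k * e1)); apply: (@le_trans _ _ (Normc.normc z)).
    by rewrite -mulr2n -mulr_natl.
  by apply: le_trans tri _; rewrite lerD2l; exact: le_trans hz rem.
have mD : measurable ([set a : imquat R | a <> 0] : set Q3) by exact: measurable_neq0.
(* The volume of the box in x on which the lower bound for [gft] holds. *)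
pose mB := (2 * del) ^+ 4.
pose c1 := pi ^+ 2 / 4 * (e1 ^+ 2 * mB * A ^- (2 * k + 4)) * (2 * del) ^+ 3.
have mB0 : 0 < mB by rewrite exprn_gt0// mulr_gt0.
have pi0 : 0 < pi ^+ 2 / 4 :> R by rewrite divr_gt0// exprn_gt0// pi_gt0.
have c10 : 0 < c1.
  have h1 : 0 < e1 ^+ 2 * mB by apply: mulr_gt0 => //; exact: exprn_gt0.
  have h2 : 0 < A ^- (2 * k + 4) by rewrite invr_gt0 exprn_gt0.
  apply: mulr_gt0; first exact: mulr_gt0 pi0 (mulr_gt0 h1 h2).
  by apply: exprn_gt0; exact: mulr_gt0.
have blow r : 0 < r -> r <= r0 -> ((c1 / r)%:E <=
    \int[leb_im]_(a in [set a : imquat R | a <> 0%R])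
     (pi ^+ 2 / 4 * (gft_energy f a * imabs a ^- (2 * k + 4)))%R%:E)%E.
  move=> rp rr0.
  pose c := pi ^+ 2 / 4 * ((r ^+ k * e1) ^+ 2 * mB * (r * A) ^- (2 * k + 4)).
  have c0 : 0 <= c.
    apply: mulr_ge0; first exact: ltW.
    apply: mulr_ge0; first exact: mulr_ge0 (sqr_ge0 _) (ltW mB0).
    by rewrite invr_ge0 exprn_ge0// mulr_ge0// ltW.
  have -> : (c1 / r)%:E = (c%:E * leb_im (imbox (r *: a0) (r * del)))%E.
    rewrite imbox_measure ?mulr_gt0// -EFinM; congr (_%:E).
    have e : (r * A) ^+ (2 * k + 4) = (r ^+ k) ^+ 2 * r ^+ 4 * A ^+ (2 * k + 4).
      by rewrite exprMn exprD mulnC exprM.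
    rewrite /c1 /c e.
    have X0 : r ^+ k != 0 by rewrite gt_eqF// exprn_gt0.
    have Y0 : A ^+ (2 * k + 4) != 0 by rewrite gt_eqF// exprn_gt0.
    have r_0 : r != 0 by rewrite gt_eqF.
    move: (r ^+ k) (A ^+ (2 * k + 4)) X0 Y0 => X Y X0 Y0; field.
    by rewrite X0 Y0 r_0.
  apply: integral_ge_cst => //.
  - exact: measurable_imbox.
  - move=> a /= ha a_0; have := low r x0 a rp rr0; rewrite subrr normr0 => /(_ (ltW del_gt0) ha)[].
    by rewrite a_0 /imabs /qabs qdotE /= !mul0r !addr0 sqrtr0 ltxx.
  - by apply: measurable_funM => //; exact: measurable_schwartz_R_integrand.
  - move=> a _; apply: mulr_ge0; first exact: ltW.
    by apply: mulr_ge0; [exact: gft_energy_ge0|rewrite invr_ge0; exact: exprn_ge0 (imabs_ge0 a)].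
  move=> a /= ha; rewrite /c ler_pM2l//.
  have xx : `|x0 - x0| <= del by rewrite subrr normr0 ltW.
  have [ia0 iaA _] := low r x0 a rp rr0 xx ha.
  have en : (r ^+ k * e1) ^+ 2 * mB <= gft_energy f a.
    rewrite -lee_fin /gft_energy /Rintegral fineK; last exact: integrable_fin_num (integrable_gft2 a sf).
    rewrite EFinM -(qbox_measure x0 del_gt0).
    apply: (@integral_ge_cst _ Q4 R leb_quat setT (qbox x0 del)) => //.
    - exact: measurable_qbox.
    - by apply: measurable_funX; apply: cmeas_normc; exact: cmeas_gft1.
    - by move=> x _; exact: sqr_ge0.
    - exact: sqr_ge0.
    - move=> x /= hx; have [_ _ h] := low r x a rp rr0 hx ha.
      by rewrite lerXn2r ?nnegrE ?normc_ge0// mulr_ge0 ?exprn_ge0 ?ltW.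
  apply: ler_pM => //.
  - by rewrite mulr_ge0 ?sqr_ge0// ltW.
  - by rewrite invr_ge0; apply: exprn_ge0; exact: ltW (mulr_gt0 rp A0).
  - rewrite lef_pV2 ?posrE ?(exprn_gt0 _ ia0) ?(exprn_gt0 _ (mulr_gt0 rp A0))//.
    by apply: lerXn2r; rewrite ?nnegrE ?imabs_ge0 ?(ltW (mulr_gt0 rp A0)).
move: fin blow; set I := (\int[leb_im]_(a in _) _)%E => fin blow.
have I0 : (0 <= I)%E by apply: le_trans (blow r0 r00 (lexx _)); rewrite lee_fin divr_ge0 ?ltW.
have Ifin : I \is a fin_num by rewrite ge0_fin_numE.
(* For this r the lower bound c1/r is at least [fine I + 1], a contradiction. *)
pose r := Num.min r0 (c1 / (fine I + 1)).
have y0 : 0 <= fine I by rewrite fine_ge0.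
have y1 : 0 < fine I + 1 by rewrite ltr_wpDl.
have rp : 0 < r by rewrite lt_min r00 divr_gt0.
have := blow r rp; rewrite ge_min lexx => /(_ isT).
rewrite -(fineK Ifin) lee_fin leNgt => /negP; case.
apply: (@lt_le_trans _ _ (fine I + 1)); first by rewrite ltrDl.
by rewrite ler_pdivlMr// mulrC -ler_pdivlMr// ge_min lexx orbT.
Qed.

Lemma imdot_shift a v t (r : R) : imdot (a + r *: v) t = imdot a t + r * imdot v t.
Proof.
rewrite !imdotE; case: a v => [[? ?] ?] [[? ?] ?] /=.
by rewrite /GRing.scale /=; ring.
Qed.

(** Polarization: the moment with <a + m v,t>^{k+1} is a polynomial in m vanishing at all natural
    numbers. Its coefficient of degree one is k + 1 times the moment sought, which explains the
    exponent k + 1. *)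
Lemma moment_extraction f x (g : imquat R -> R) v : schwartz f -> poly_growth g ->
  (forall k a, moment f (fun t => g t * imdot a t ^+ k) x = 0) ->
  forall k a, moment f (fun t => g t * imdot v t * imdot a t ^+ k) x = 0.
Proof.
move=> sf hg H k a.
have hp i j : poly_growth (fun t => g t * imdot v t ^+ i * imdot a t ^+ j).
  apply: poly_growthM; last by apply: poly_growthX; exact: poly_growth_imdot.
  by apply: poly_growthM => //; apply: poly_growthX; exact: poly_growth_imdot.
pose c i : R[i] := ('C(k.+1, i)%:R : R)%:C *
  moment f (fun t => g t * imdot v t ^+ i * imdot a t ^+ (k.+1 - i)) x.
have c0 : c 1%N = 0.
  apply: (@poly_coef_zero R k.+2) => // m.
  rewrite -[RHS](H k.+1 (a + m%:R *: v)).
  have -> : (fun t => g t * imdot (a + m%:R *: v) t ^+ k.+1) = fun t =>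
      \sum_(i <- index_enum 'I_k.+2) ('C(k.+1, i)%:R * m%:R ^+ i) *
        (g t * imdot v t ^+ i * imdot a t ^+ (k.+1 - i)).
    apply/funext => t.
    rewrite imdot_shift exprDn mulr_sumr; apply: eq_bigr => i _.
    by rewrite exprMn -mulr_natl; ring.
  rewrite moment_sum//; apply: eq_bigr => i _.
  have cM (y z : R) : (y * z)%:C = y%:C * z%:C by exact: rmorphM.
  have -> : (m%:R : R[i]) ^+ i = ((m%:R : R) ^+ i)%:C by rewrite rmorphXn rmorph_nat.
  by rewrite cM /c mulrAC.
move: c0; rewrite /c bin1 subn1 /= => /eqP; rewrite mulf_eq0 => /orP[|/eqP <-].
  move=> /eqP/(congr1 (@complex.Re R)); rewrite cRe_real => /eqP.
  by rewrite pnatr_eq0.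
by congr moment; apply/funext => t; rewrite expr1.
Qed.

Lemma R_sub_star f : schwartz_R R f -> schwartz_star R f.
Proof.
move=> [sf fin]; split => // x s.
(* Strong induction on k, for all x and a together: [moment_vanish] needs the lower moments to
   vanish near every point, not only at the given one. *)
have mz k : forall x a, a <> 0 -> H f k x a = 0.
  have [n kn] := ubnP k; elim: n k kn => // n IH k; rewrite ltnS => kn y a a0.
  apply: moment_vanish => //.
    by move=> j z b jk b0; apply: IH => //; exact: leq_trans jk kn.
  by rewrite -integral_schwartz_R.
(* The value a = 0 must be included, since polarization runs through all vectors a + m v. For k = 0
   the power does not depend on a; for k > 0 it is zero. *)
have mz' k a : H f k x a = 0.
  have [->|/eqP a0] := eqVneq a 0; last exact: mz.
  case: k => [|k].
    rewrite -(mz 0%N x ((1, 0, 0) : imquat R)); last first.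
      by move=> /(congr1 (fun b : imquat R => b.1.1)) /= /eqP; rewrite oner_eq0.
    by congr moment; apply/funext => t; rewrite !expr0.
  rewrite -[RHS](@cintegral0 _ Q3 R leb_im); apply: (@eq_cintegral _ Q3 R leb_im) => t.
  by rewrite imdotE /= !mul0r !addr0 expr0n mulr0.
(* Releases n factors <v,t>, one polarization each; used below for the three coordinate vectors in
   turn. *)
have step v n g : poly_growth g ->
    (forall k a, moment f (fun t => g t * imdot a t ^+ k) x = 0) ->
    forall k a, moment f (fun t => g t * imdot v t ^+ n * imdot a t ^+ k) x = 0.
  move=> hg Hg; elim: n => [|n IH].
    move=> k a; rewrite -[RHS](Hg k a); congr moment; apply/funext => t.
    by rewrite expr0 mulr1.
  move=> k a; have hn : poly_growth (fun t => g t * imdot v t ^+ n).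
    by apply: poly_growthM => //; apply: poly_growthX; exact: poly_growth_imdot.
  rewrite -[RHS](moment_extraction v sf hn IH k a); congr moment; apply/funext => t.
  by rewrite exprSr mulrA.
have pX v n : poly_growth (fun t => imdot v t ^+ n).
  by apply: poly_growthX; exact: poly_growth_imdot.
have p1 := poly_growth_cst (1 : R).
have H1 k a : moment f (fun t => 1 * imdot a t ^+ k) x = 0.
  by rewrite -(mz' k a); congr moment; apply/funext => t; rewrite mul1r.
have H2 := step (1, 0, 0) s.1.1 _ p1 H1.
have q2 := poly_growthM p1 (pX (1, 0, 0) s.1.1).
have H3 := step (0, 1, 0) s.1.2 _ q2 H2.
have q3 := poly_growthM q2 (pX (0, 1, 0) s.1.2).
have H4 := step (0, 0, 1) s.2 _ q3 H3.
rewrite -(H4 0%N 0); apply: (@eq_cintegral _ Q3 R leb_im) => t.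
by rewrite im_monomialE expr0 mulr1 mul1r.
Qed.

End RToStar.

Theorem theorem9 (R : realType) : schwartz_R R = schwartz_star R.
Proof.
by apply/seteqP; split => f; [exact: R_sub_star|exact: star_sub_R].
Qed.
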